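(* Let $(X,d)$ be a compact metric space with $\mathcal{J}_{AR}(X,d)\neq\emptyset$, and fix the covering data $\kappa,\lambda,a,(\mathcal S_n)_{n\ge 0}$, the parent assignment and the graph $Z_d$ described in the context. Suppose that $\rho:\mathcal S\to(0,1)$ satisfies the following four conditions. (H1) There exist $0<\eta_-\le\eta_+<1$ such that $\eta_-\le\rho(B)\le\eta_+$ for all $B\in\mathcal S$. (H2) There exists $K_0\ge 1$ such that $\pi(B)\le K_0\,\pi(B')$ for all $B,B'\in\mathcal S$ with $B\sim B'$. (H3) There exist $\alpha\in[2,\lambda/4]$ and $K_1\ge 1$ such that for any pair of distinct points $x,y\in X$ there exists $n_0\ge 1$ such that if $n\ge n_0$ and $\gamma\in\Gamma_n(x,y)$, then $L_\rho(\gamma)\ge K_1^{-1}\,\pi(c_\alpha(x,y))$. (H4) There exist $p>0$ and $K_2\ge 1$ such that for all $m\ge 0$, $B\in\mathcal S_m$ and $n>m$, $$K_2^{-1}\,\pi(B)^p\le\sum_{B'\in D_n(B)}\pi(B')^p\le K_2\,\pi(B)^p .$$ Then there exists a distance $\theta_\rho$ on $X$ which is quasisymmetrically equivalent to $d$ and Ahlfors regular of dimension $p$. Furthermore (for the fixed space $(X,d)$ and covering data) the distortion function of $\mathrm{id}:(X,d)\to(X,\theta_\rho)$ depends only on the constants $\eta_-,\eta_+,K_0,K_1$, and there is a constant $C\ge1$ such that $$C^{-1}\,\pi(c_\alpha(x,y))\le\theta_\rho(x,y)\le C\,\pi(c_\alpha(x,y))\quad\text{for all distinct }x,y\in X,$$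 where $\alpha$ is the number in (H3). Conversely, every distance $\theta\in\mathcal J_{AR}(X,d)$ is bi-Lipschitz equivalent to a distance $\theta_\rho$ obtained in this way from some function $\rho:\mathcal S\to(0,1)$ satisfying (H1), (H2), (H3) and (H4).
   Context: Gauge. A homeomorphism $h:(X,d)\to(Y,\theta)$ is quasisymmetric if there is an increasing homeomorphism $\eta:[0,\infty)\to[0,\infty)$ (a distortion function) with $\frac{\theta(h(x),h(z))}{\theta(h(y),h(z))}\le\eta\left(\frac{d(x,z)}{d(y,z)}\right)$ for all $x,y,z$ with $y\ne z$. Two distances on $X$ are quasisymmetrically equivalent if the identity map between them is a quasisymmetric homeomorphism. A distance $\theta$ on $X$ is Ahlfors regular of dimension $q>0$ if there are a Radon measure $\mu$ on $X$ and $K\ge1$ with $K^{-1}\le\mu(B_r)/r^q\le K$ for every $\theta$-ball $B_r$ of radius $0<r\le\mathrm{diam}_\theta X$. $\mathcal J_{AR}(X,d)$ is the set of all distances on $X$ that are quasisymmetrically equivalent to $d$ and Ahlfors regular of some dimension. $\mathcal J_{AR}(X,d)\ne\emptyset$ holds iff $(X,d)$ is doubling (there is $K_D\ge1$ such that every ball can be covered by at most $K_D$ balls of half the radius) and uniformly perfect (there is $K_P>1$ such that $B(x,r)\setminus B(x,K_P^{-1}r)\neq\emptyset$ for all $x$ and $0<r\le\mathrm{diam}\,X$). Coverings. $B(x,r)=\{y:d(x,y)<r\}$. Fix $\kappa\ge1$, $\lambda\ge32$ and $a\ge 6\kappa^2\max\{\lambda,K_P\}$; put $r_n=a^{-n}$.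 For $n\ge1$, $\mathcal S_n$ is a finite covering of $X$ such that each $B\in\mathcal S_n$ has a chosen center $x_B\in X$ with $B(x_B,\kappa^{-1}r_n)\subset B\subset B(x_B,\kappa r_n)$, and $B(x_B,\kappa^{-1}r_n)\cap B(x_{B'},\kappa^{-1}r_n)=\emptyset$ for $B\ne B'$ in $\mathcal S_n$. $\mathcal S_0=\{w\}$ has a single element $w$, representing the covering $\{X\}$, with a center $x_w\in X$; the normalization $X=B(x_w,\kappa)$ is assumed. $\mathcal S=\bigsqcup_n\mathcal S_n$ (elements of different levels are regarded as different). For $\mu>0$ and $B\in\mathcal S_n$, $\mu\cdot B:=B(x_B,\mu\kappa r_n)$. For $B,B'$ in the same $\mathcal S_n$, $B\sim B'$ means $\lambda\cdot B\cap\lambda\cdot B'\ne\emptyset$ (in particular $B\sim B$). Parents. Let $X_n=\{x_B:B\in\mathcal S_n\}$ and $V_n(B)=\{y\in X:d(y,x_B)=\mathrm{dist}(y,X_n)\}$ for $B\in\mathcal S_n$. For each $B'\in\mathcal S_{n+1}$ choose once and for all one $B\in\mathcal S_n$ with $x_{B'}\in V_n(B)$, called the parent of $B'$. For $B\in\mathcal S_m$ and $n>m$, $D_n(B)$ is the set of $B'\in\mathcal S_n$ having $B$ as their ancestor in $\mathcal S_m$. Graph. $Z_d$ is the graph with vertex set $\mathcal S$, with a horizontal edge between distinct $B,B'$ of the same level with $B\sim B'$ and a vertical edge between each element of $\mathcal S_{n+1}$ and its parent. For $B\in\mathcal S$, $[w,B]$ is the vertical path from $w$ to $B$ through the successive ancestors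 of $B$. Weights. For $\rho:\mathcal S\to(0,1)$ put $\pi(B)=\prod\rho(B')$, the product over all vertices $B'$ of $[w,B]$. For an edge path $\gamma$ in $Z_d$ with successive vertices $B_1,\dots,B_N$, $L_\rho(\gamma)=\sum_{i=1}^N\pi(B_i)$. For $\alpha>1$ and distinct $x,y\in X$, let $m$ be the maximal level for which some $B\in\mathcal S_m$ satisfies $x,y\in\alpha\cdot B$; $c_\alpha(x,y)=\{B\in\mathcal S_m:x,y\in\alpha\cdot B\}$ and $\pi(c_\alpha(x,y))=\max\{\pi(B):B\in c_\alpha(x,y)\}$. $\Gamma_n(x,y)$ is the family of edge paths in $Z_d$ (not necessarily staying in level $n$) joining two elements $B,B'\in\mathcal S_n$ with $x\in B$ and $y\in B'$.
   Formalization: The converse is stated only for X with at least two distinct points; for a one-point space it fails, since J_AR is nonempty vacuously, each S_n has one element, and (H1) forces π→0 along the chain, contradicting (H4). *)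

(* Defs.v *)
From HB Require Import structures.
From mathcomp Require Import all_boot all_order all_algebra.
From mathcomp Require Import all_classical all_reals all_analysis.

Set Implicit Arguments.
Unset Strict Implicit.
Unset Printing Implicit Defensive.

Import Order.TTheory GRing.Theory Num.Theory.
Import numFieldNormedType.Exports.

Local Open Scope classical_set_scope.
Local Open Scope ring_scope.

(* Measurable types are pointed in the library, so metric spaces carrying
   Borel measures are pointed here; the point only records nonemptiness. *)
#[short(type="pointedMetricType")]
HB.structure Definition PointedMetric (R : numDomainType) :=
  {T of Pointed T & Metric R T}.

Record distance (R : realType) (X : Type) := Distance {
  dist_fun :> X -> X -> R;
  dist_xx : forall x, dist_fun x x = 0;
  dist_positivity : forall x y, dist_fun x y = 0 -> x = y;
  dist_sym : forall x y, dist_fun x y = dist_fun y x;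
  dist_triangle : forall y x z, dist_fun x z <= dist_fun x y + dist_fun y z
}.

(* The set X with the metric structure (balls, topology) given by theta,
   forgetting any metric that X already carries. *)
Definition remetric (R : realType) (X : pointedType) (theta : distance R X) :
  Type := X.

Section Remetric.
Variables (R : realType) (X : pointedType) (theta : distance R X).
HB.instance Definition _ := Pointed.on (remetric theta).
HB.instance Definition _ := @isMetric.Build R (remetric theta) theta
  (dist_xx theta) (@dist_positivity _ _ theta) (dist_sym theta)
  (@dist_triangle _ _ theta).
End Remetric.

Section Gauge.
Variable R : realType.

Definition homeomorphism (Y Z : topologicalType) (h : Y -> Z) :=
  continuous h /\
  exists g : Z -> Y, [/\ continuous g, cancel h g & cancel g h].

(* Increasing homeomorphisms of [0, +oo[; values at negative reals are junk. *)
Definition distortion (eta : R -> R) :=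
  [/\ {in `[0, +oo[ &, {homo eta : s t / s < t}},
      set_bij `[0, +oo[ `[0, +oo[ eta,
      {within `[0, +oo[, continuous eta} &
      exists2 g : R -> R, {within `[0, +oo[, continuous g} &
        {in `[0, +oo[, cancel eta g}].

Definition quasisymmetric (eta : R -> R) (Y Z : metricType R) (h : Y -> Z) :=
  [/\ distortion eta, homeomorphism h &
      forall x y z : Y, y <> z ->
        mdist (h x) (h z) / mdist (h y) (h z)
          <= eta (mdist x z / mdist y z)].

Definition diam (Y : metricType R) : \bar R :=
  ereal_sup [set (mdist p.1 p.2)%:E | p in [set: Y * Y]].

Definition borel (Y : pointedMetricType R) := g_sigma_algebraType (@open Y).

Definition radon (Y : pointedMetricType R)
    (mu : {measure set (borel Y) -> \bar R}) :=
  [/\ forall K : set Y, compact K -> (mu K < +oo)%E,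
      forall A : set (borel Y), measurable A ->
        mu A = ereal_inf [set mu U | U in [set U : set Y | open U /\ A `<=` U]] &
      forall U : set Y, open U ->
        mu U = ereal_sup
          [set mu K | K in [set K : set Y | compact K /\ K `<=` U]]].

Definition ahlfors_regular (q : R) (Y : pointedMetricType R) :=
  0 < q /\
  exists (mu : {measure set (borel Y) -> \bar R}) (K : R),
    [/\ radon mu, 1 <= K &
        forall (x : Y) (r : R), 0 < r -> (r%:E <= diam Y)%E ->
          ((K^-1)%:E <= mu (ball x r) * ((r `^ q)^-1)%:E <= K%:E)%E].

Definition J_AR (X : pointedMetricType R) : set (distance R X) :=
  [set theta |
    (exists eta, quasisymmetric eta (id : X -> remetric theta)) /\
    (exists q, ahlfors_regular q (remetric theta))].

Definition uniformly_perfect (KP : R) (X : metricType R) :=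
  1 < KP /\
  forall (x : X) (r : R), 0 < r -> (r%:E <= diam X)%E ->
    ball x r `\` ball x (KP^-1 * r) !=set0.

Definition bilipschitz (X : Type) (theta theta' : distance R X) :=
  exists2 L : R, 1 <= L &
    forall x y, L^-1 * theta x y <= theta' x y <= L * theta x y.

Definition dist_set (X : metricType R) (y : X) (A : set X) : R :=
  inf [set mdist y x | x in A].

End Gauge.

(* The covering S_n is given as an injective family of subsets of X (cell)
   over a finite index type (level n). *)
Record covering_data (R : realType) (X : metricType R) (kappa a : R) :=
  CoveringData {
  level : nat -> finType;
  cell : forall n, level n -> set X;
  center : forall n, level n -> X;
  parent : forall n, level n.+1 -> level n;
  cell_inj : forall n, injective (@cell n);
  card_level0 : #|level 0| = 1%N;
  cell0 : forall w : level 0, cell w = [set: X];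
  normalization : forall w : level 0, ball (center w) kappa = [set: X];
  cell_cover : forall n, (0 < n)%N ->
    \bigcup_(B in [set: level n]) cell B = [set: X];
  cell_sandwich : forall n (B : level n), (0 < n)%N ->
    ball (center B) (kappa^-1 * a ^- n) `<=` cell B /\
    cell B `<=` ball (center B) (kappa * a ^- n);
  cell_disjoint : forall n (B B' : level n), (0 < n)%N -> B <> B' ->
    ball (center B) (kappa^-1 * a ^- n)
      `&` ball (center B') (kappa^-1 * a ^- n) = set0;
  (* center B' belongs to V_n(parent B') *)
  parent_nearest : forall n (B' : level n.+1),
    mdist (center B') (center (parent B'))
      = dist_set (center B') (range (@center n))
}.

Section Graph.
Variables (R : realType) (X : metricType R) (kappa a : R).
Variable S : covering_data X kappa a.
Variable lambda : R.

(* Vertices of Z_d: the disjoint union of the levels, tag v being the level. *)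
Definition vertex := {n : nat & level S n}.

Definition vtx n (B : level S n) : vertex := Tagged (level S) B.

Definition dilate (m : R) (v : vertex) : set X :=
  ball (center (tagged v)) (m * kappa * a ^- tag v).

Definition sim n (B B' : level S n) :=
  dilate lambda (vtx B) `&` dilate lambda (vtx B') !=set0.

(* Fixes the root. *)
Definition parent_vertex (v : vertex) : vertex :=
  match v with
  | existT n.+1 B => vtx (parent B)
  | v0 => v0
  end.

(* The vertices of [w, v], listed from v to the root w. *)
Definition geodesic (v : vertex) : seq vertex :=
  traject parent_vertex v (tag v).+1.

Definition descendants m (B : level S m) n : {set level S n} :=
  [set B' : level S n | iter (n - m) parent_vertex (vtx B') == vtx B].

Inductive edge : vertex -> vertex -> Prop :=
| horizontal n (B B' : level S n) : B <> B' -> sim B B' ->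
    edge (vtx B) (vtx B')
| vertical_up n (B : level S n.+1) : edge (vtx B) (vtx (parent B))
| vertical_down n (B : level S n.+1) : edge (vtx (parent B)) (vtx B).

(* An edge path with successive vertices v :: s is coded by (v, s). *)
Definition Gamma n (x y : X) : set (vertex * seq vertex) :=
  [set g | path (fun u v => `[< edge u v >]) g.1 g.2 /\
    exists B B' : level S n,
      [/\ cell B x, cell B' y, g.1 = vtx B & last g.1 g.2 = vtx B']].

Section Weight.
Variable rho : vertex -> R.

Definition weight (v : vertex) : R := \prod_(u <- geodesic v) rho u.

Definition path_length (g : vertex * seq vertex) : R :=
  \sum_(v <- g.1 :: g.2) weight v.

Definition c_set (alpha : R) (x y : X) : set vertex :=
  [set v | [/\ dilate alpha v x, dilate alpha v y &
    forall v', dilate alpha v' x -> dilate alpha v' y ->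
      (tag v' <= tag v)%N]].

(* A maximum: c_set alpha x y is finite, and nonempty when x <> y. *)
Definition weight_c (alpha : R) (x y : X) : R :=
  sup [set weight v | v in c_set alpha x y].

Definition H1 (eta_m eta_p : R) :=
  [/\ 0 < eta_m, eta_m <= eta_p, eta_p < 1 &
      forall v, eta_m <= rho v <= eta_p].

Definition H2 (K0 : R) :=
  1 <= K0 /\
  forall n (B B' : level S n), sim B B' ->
    weight (vtx B) <= K0 * weight (vtx B').

Definition H3 (alpha K1 : R) :=
  [/\ 2 <= alpha, alpha <= lambda / 4, 1 <= K1 &
      forall x y : X, x <> y ->
        exists2 n0, (1 <= n0)%N &
          forall n g, (n0 <= n)%N -> Gamma n x y g ->
            K1^-1 * weight_c alpha x y <= path_length g].

Definition H4 (p K2 : R) :=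
  [/\ 0 < p, 1 <= K2 &
      forall m (B : level S m) n, (m < n)%N ->
        K2^-1 * weight (vtx B) `^ p
          <= \sum_(B' in descendants B n) weight (vtx B') `^ p
          <= K2 * weight (vtx B) `^ p].

Definition admissible (eta_m eta_p K0 alpha K1 p K2 : R) :=
  [/\ forall v, 0 < rho v < 1, H1 eta_m eta_p, H2 K0, H3 alpha K1 & H4 p K2].

End Weight.
End Graph.

Definition is_theta_rho (R : realType) (X : pointedMetricType R) (kappa a : R)
    (S : covering_data X kappa a) (rho : vertex S -> R) (alpha p : R)
    (eta : R -> R) (theta : distance R X) :=
  [/\ quasisymmetric eta (id : X -> remetric theta),
      ahlfors_regular p (remetric theta) &
      exists2 C : R, 1 <= C &
        forall x y : X, x <> y ->
          C^-1 * weight_c rho alpha x y <= theta x y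
            <= C * weight_c rho alpha x y].

(* Main.v *)
(** A weight gives the path pseudo-distance l_n(x, y), the infimum of the lengths
    of the paths of Gamma_n(x, y).  It satisfies the triangle inequality, so the
    limit of l_n along a fixed ultrafilter of nat is a distance theta.  Climbing
    from level n to the scale of (x, y) and down again costs a geometric series,
    hence theta <= C pi(c(x, y)); (H3) is the reverse bound.  Comparing weights
    along ancestral lines by (H1) and (H2) then gives a quasisymmetry whose gauge
    is a maximum of two powers.  Under (H4) the limit along the ultrafilter of
    the sums of pi^p over the descendants of B of level n is a weight nu(B),
    comparable to pi(B)^p, which is exactly additive over children.  Additivity
    codes the tree by nested intervals of length nu(B), and the push-forward of
    Lebesgue measure under the limit map from the intervals to X is the Ahlfors
    regular measure.

    Conversely, for theta in the gauge, let t(B) be the theta-distance from the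
    center of B to a point of X at distance about r_n.  The measure bounds turn
    into packing and covering inequalities for theta-balls, which show that the
    sums of t^q over the descendants of B are comparable to t(B)^q, and the same
    ultrafilter limit makes t^q additive.  Uniform perfectness provides two
    children to every cell of small diameter, so the ratio of the additive
    weights of a child and of its parent stays away from 1; its q-th root is
    rho. *)

(* The lengths [ell n x y] need not be monotone in n, and the sums in (H4) are only comparable from
   one level to the next. An upper limit would keep the triangle inequality but lose additivity over
   children; an ultrafilter limit preserves inequalities and finite sums alike, and exists for every
   bounded sequence.

   The gauge must not see alpha, p or K2. The number alpha enters only through the scale of a pair
   of points, where 2 alpha <= lambda replaces it by fixed data; p and K2 concern the measure alone.

   Doubling serves only to bound the number of cells of one level near a given cell. This bound is
   read off from any one Ahlfors regular distance of the gauge, by packing disjoint balls.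

   The converse assumes two distinct points. In a one-point space every level has a single cell, so
   (H1) drives the sums of (H4) to 0 and no weight is admissible, although the zero distance is
   vacuously Ahlfors regular. *)
Require Import Defs.
From mathcomp Require Import all_boot all_order all_algebra.
From mathcomp Require Import all_classical all_reals all_analysis.
From mathcomp Require Import ring lra zify.
Set Implicit Arguments.
Unset Strict Implicit.
Unset Printing Implicit Defensive.

Import Order.TTheory GRing.Theory Num.Theory.
Import numFieldNormedType.Exports.

Local Open Scope classical_set_scope.
Local Open Scope ring_scope.

(** * Limits along an ultrafilter *)

Section UltrafilterLimit.
Variable R : realType.
Implicit Types u v : nat -> R.

Let ultra_oo : {U : set_system nat | UltraFilter U /\ \oo `<=` U}.
Proof. by apply: cid; exact: ultraFilterLemma. Qed.
Let U := projT1 ultra_oo.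
#[local] Instance U_ultra : UltraFilter U := (projT2 ultra_oo).1.

Let U_and (A B : set nat) : U A -> U B -> U (A `&` B).
Proof. exact: filterI. Qed.

(** Written as a supremum to be total; it is the limit along [U] when [u] is bounded. *)
Definition ulim u : R := sup [set c | U [set n | c <= u n]].

Definition bounded_seq u := exists M, forall n, `|u n| <= M.

Lemma ulim_near u e : bounded_seq u -> 0 < e ->
  U [set n | `|u n - ulim u| < e].
Proof.
move=> [M uM] e0.
have hs : has_sup [set c | U [set n | c <= u n]].
  split.
    exists (- M); apply: filterS (@filterT _ U _) => n _ /=.
    by have := uM n; rewrite ler_norml => /andP[].
  exists M => c /filter_ex [n /= cn]; apply: (le_trans cn).
  exact: le_trans (ler_norm _) (uM n).
have U1 : U [set n | ulim u - e < u n].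
  have [c /= Uc ce] := sup_adherent e0 hs.
  by apply: filterS Uc => n /= cn; exact: lt_le_trans ce cn.
have U2 : U [set n | u n < ulim u + e].
  (* Maximality of [U] enters here: either this set or its complement belongs to [U], and the first
     case would put [ulim u + e] below the supremum. *)
  have [UA|UA] := in_ultra_setVsetC [set n | ulim u + e <= u n] U_ultra.
    have : ulim u + e <= ulim u by apply: ub_le_sup => //; case: hs.
    by rewrite gerDl leNgt e0.
  by apply: filterS UA => n /= /negP; rewrite -ltNge.
apply: filterS2 U1 U2 => n /= h1 h2.
by rewrite ltr_norml; apply/andP; split; lra.
Qed.

(** [U] is free, so inequalities valid from some level on pass to the limit. *)
Lemma U_ge N : U [set n | (N <= n)%N].
Proof. by apply: (projT2 ultra_oo).2; exists N. Qed.

Lemma bounded_seqD u v : bounded_seq u -> bounded_seq v ->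
  bounded_seq (fun n => u n + v n).
Proof.
move=> [M uM] [M' vM]; exists (M + M') => n.
exact: le_trans (ler_normD _ _) (lerD (uM n) (vM n)).
Qed.

Lemma bounded_seq_cst c : bounded_seq (fun=> c).
Proof. by exists `|c|. Qed.

Lemma bounded_seq_ge0 u M : (forall n, 0 <= u n <= M) -> bounded_seq u.
Proof. by move=> uM; exists M => n; have /andP[u0 ?] := uM n; rewrite ger0_norm. Qed.

Lemma ler_ulim u v N : bounded_seq u -> bounded_seq v ->
  (forall n, (N <= n)%N -> u n <= v n) -> ulim u <= ulim v.
Proof.
move=> bu bv uv; apply/ler_addgt0Pl => e e0.
have e2 : 0 < e / 2 by lra.
have := U_and (U_and (ulim_near bu e2) (ulim_near bv e2)) (U_ge N).
move=> /filter_ex [n /= [[]]].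
rewrite !ltr_norml => /andP[h1 h2] /andP[h3 h4] /uv h5.
by lra.
Qed.

Lemma ulimD u v : bounded_seq u -> bounded_seq v ->
  ulim (fun n => u n + v n) = ulim u + ulim v.
Proof.
move=> bu bv; apply/eqP; rewrite -subr_eq0 -normr_eq0 eq_le normr_ge0 andbT.
apply/ler_addgt0Pl => e e0; rewrite addr0.
have e2 : 0 < e / 3 by lra.
have := U_and (U_and (ulim_near bu e2) (ulim_near bv e2))
  (ulim_near (bounded_seqD bu bv) e2).
move=> /filter_ex [n /= []].
rewrite !ltr_norml => -[/andP[h1 h2] /andP[h3 h4]] /andP[h5 h6].
by rewrite ler_norml; apply/andP; split; lra.
Qed.

Lemma ulim_cst c : ulim (fun=> c) = c.
Proof.
apply/eqP; rewrite -subr_eq0 -normr_eq0 eq_le normr_ge0 andbT.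
apply/ler_addgt0Pl => e e0; rewrite addr0 distrC.
by have /filter_ex [n /= /ltW] := ulim_near (bounded_seq_cst c) e0.
Qed.

Lemma eq_ulim u v N : bounded_seq u -> bounded_seq v ->
  (forall n, (N <= n)%N -> u n = v n) -> ulim u = ulim v.
Proof.
move=> bu bv uv; apply/eqP; rewrite eq_le; apply/andP; split;
by apply: (@ler_ulim _ _ N) => // n /uv ->.
Qed.

Lemma ulim_sum (T : Type) (r : seq T) (P : pred T) (f : T -> nat -> R) :
  (forall i, bounded_seq (f i)) ->
  bounded_seq (fun n => \sum_(i <- r | P i) f i n) /\
  ulim (fun n => \sum_(i <- r | P i) f i n) = \sum_(i <- r | P i) ulim (f i).
Proof.
move=> bf; elim: r => [|x r [IHb IH]].
  under [X in bounded_seq X]eq_fun do rewrite big_nil.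
  under [X in ulim X]eq_fun do rewrite big_nil.
  by rewrite big_nil ulim_cst; split => //; exact: bounded_seq_cst.
rewrite big_cons.
under [X in bounded_seq X]eq_fun do rewrite big_cons.
under [X in ulim X]eq_fun do rewrite big_cons.
case: (P x) => //; rewrite -IH; split; [exact: bounded_seqD|exact: ulimD].
Qed.

End UltrafilterLimit.

(** * The tree of coverings *)

Section Geometry.
Variables (R : realType) (X : metricType R) (kappa a : R).
Variable S : covering_data X kappa a.
Local Notation d := (@mdist R X).
Local Notation vertex := (vertex S).
Implicit Types u v B : vertex.

Definition rad v : R := a ^- tag v.
Definition ctr v : X := Defs.center (tagged v).
Definition anc k v : vertex := iter k (@parent_vertex R X kappa a S) v.

Lemma anc0 v : anc 0 v = v. Proof. by []. Qed.
Lemma ancS k v : anc k.+1 v = parent_vertex (anc k v). Proof. by []. Qed.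
Lemma ancSr k v : anc k.+1 v = anc k (parent_vertex v).
Proof. by rewrite /anc iterSr. Qed.
Lemma anc_add j k v : anc (j + k) v = anc j (anc k v).
Proof. by rewrite /anc iterD. Qed.

Lemma tag_parent v : tag (parent_vertex v) = (tag v).-1.
Proof. by case: v => -[|n] B. Qed.

Lemma tag_anc k v : tag (anc k v) = (tag v - k)%N.
Proof.
by elim: k v => [|k IH] v; [rewrite subn0|rewrite ancSr IH tag_parent; lia].
Qed.

Hypotheses (kappa_ge1 : 1 <= kappa) (a_ge : 192 * kappa ^+ 2 <= a).

Let kappa_gt0 : 0 < kappa. Proof. exact: lt_le_trans ltr01 kappa_ge1. Qed.

Lemma a_ge192k : 192 * kappa <= a.
Proof. by move: kappa_ge1 a_ge; rewrite expr2; nra. Qed.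

Lemma a_ge192 : 192 <= a.
Proof. by have := a_ge192k; move: kappa_ge1; lra. Qed.

Lemma a_gt0 : 0 < a. Proof. by have := a_ge192; lra. Qed.

Lemma rn_gt0 n : 0 < a ^- n.
Proof. by rewrite invr_gt0 exprn_gt0// a_gt0. Qed.

Lemma rad_gt0 v : 0 < rad v. Proof. exact: rn_gt0. Qed.

Lemma rnS n : a ^- n = a * a ^- n.+1.
Proof. by rewrite exprS invfM mulrA mulfV ?mul1r// gt_eqF// a_gt0. Qed.

Lemma ler_rn m n : (m <= n)%N -> a ^- n <= a ^- m.
Proof.
move=> mn; rewrite lef_pV2 ?posrE ?exprn_gt0 ?a_gt0//.
by apply: ler_weXn2l => //; have := a_ge192; lra.
Qed.

Lemma rn_le1 n : a ^- n <= 1.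
Proof. by have := ler_rn (leq0n n); rewrite expr0 invr1. Qed.

Lemma rn_small e : 0 < e -> exists n, a ^- n < e.
Proof.
move=> e0.
have h : (fun n => (a^-1) ^+ n) @ \oo --> (0 : R).
  apply: cvg_expr; rewrite gtr0_norm ?invr_gt0 ?a_gt0// invf_lt1 ?a_gt0//.
  by have := a_ge192; lra.
have /cvgrPdist_lt /(_ _ e0) [N _ /(_ N (leqnn N))] := h.
rewrite /= sub0r normrN gtr0_norm ?exprn_gt0 ?invr_gt0 ?a_gt0// exprVn => hN.
by exists N.
Qed.

Lemma root_unique u v : tag u = 0%N -> tag v = 0%N -> u = v.
Proof.
case: u v => n B [m B'] /= ? ?; subst n m; congr existT.
by have := card_level0 S => /eqP /fintype1P [x xP]; rewrite (xP B) (xP B').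
Qed.

Lemma cell_ball v x : cell (tagged v) x -> d x (ctr v) < kappa * rad v.
Proof.
case: v => -[|n] B /=; rewrite /ctr /rad /= => Bx.
  have := normalization B; rewrite expr0 invr1 mulr1 ballEmdist => h.
  by have : [set: X] x by []; rewrite -h /= metric_sym.
have [_] := cell_sandwich B isT => /(_ _ Bx).
by rewrite ballEmdist /= metric_sym.
Qed.

Lemma cover n x : exists v, tag v = n /\ cell (tagged v) x.
Proof.
case: n => [|n].
  have /eqP /fintype1P [B _] := card_level0 S.
  by exists (vtx B); rewrite /= cell0.
have : [set: X] x by []; rewrite -(cell_cover S (ltn0Sn n)) => -[B _ Bx].
by exists (vtx B).
Qed.

Lemma cover_ball n x : exists v, tag v = n /\ d x (ctr v) < kappa * rad v.
Proof. by have [v [tv /cell_ball]] := cover n x; exists v. Qed.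

Lemma ctr_sep u v : tag u = tag v -> u <> v ->
  kappa^-1 * rad v <= d (ctr u) (ctr v).
Proof.
case: u v => n B [m B'] /= nm; subst m => uv.
case: n B B' uv => [|n] B B' uv; first by case: uv; exact: root_unique.
have BB' : B <> B' by move=> h; apply: uv; rewrite h.
have := cell_disjoint (ltn0Sn n) BB'.
rewrite leNgt => h; apply/negP => lt.
have : (ball (Defs.center B) (kappa^-1 * a ^- n.+1)
          `&` ball (Defs.center B') (kappa^-1 * a ^- n.+1)) (Defs.center B').
  split; rewrite ballEmdist /=; first exact: lt.
  by rewrite mdistxx mulr_gt0 ?rn_gt0// invr_gt0.
by rewrite h.
Qed.

Lemma parent_min u B : tag u = (tag B).+1 ->
  d (ctr u) (ctr (parent_vertex u)) <= d (ctr u) (ctr B).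
Proof.
case: u B => m B' [n B] /= mn; subst m.
rewrite /ctr /= parent_nearest /dist_set; apply: ge_inf.
  by exists 0 => _ [x _ <-]; exact: mdist_ge0.
by exists (Defs.center B) => //; exists B.
Qed.

Lemma parent_dist u : d (ctr u) (ctr (parent_vertex u))
  < kappa * rad (parent_vertex u).
Proof.
case: u => -[|n] B; first by rewrite mdistxx mulr_gt0 ?rad_gt0.
have [v [tv lt]] := cover_ball n (ctr (existT _ n.+1 B)).
rewrite (_ : rad (parent_vertex _) = rad v); last by rewrite /rad tv.
by apply: le_lt_trans lt; apply: parent_min; rewrite tv.
Qed.

Lemma rad_parent u : (0 < tag u)%N -> rad (parent_vertex u) = a * rad u.
Proof. by rewrite /rad tag_parent; case: (tag u) => //= n _; rewrite -rnS. Qed.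

Lemma ler_rad u v : (tag u <= tag v)%N -> rad v <= rad u.
Proof. exact: ler_rn. Qed.

(** Radii grow by the factor a at each step up, so the last step dominates the chain: 6/5 of one
    radius is at most 1/5 of the next, and the step itself costs 1. *)
Lemma anc_dist k v : (k <= tag v)%N ->
  d (ctr v) (ctr (anc k v)) <= 6 / 5 * kappa * rad (anc k v).
Proof.
elim: k => [|k IH] kv.
  by rewrite mdistxx !mulr_ge0// ?(ltW (rad_gt0 _))// ltW.
have {}IH := IH (ltnW kv).
have h2 := ltW (parent_dist (anc k v)).
have tk : (0 < tag (anc k v))%N by rewrite tag_anc; lia.
have h3 := rad_parent tk.
have h4 : 6 / 5 * kappa * rad (anc k v) <= 1 / 5 * kappa * rad (anc k.+1 v).
  rewrite ancS h3 -!mulrA [kappa * _]mulrC [kappa * (a * _)]mulrC !mulrA.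
  rewrite ler_pM2r//; have := rad_gt0 (anc k v); have := a_ge192; nra.
have := metric_triangle (ctr v) (ctr (anc k v)) (ctr (anc k.+1 v)).
by rewrite !ancS in h4 *; lra.
Qed.

(* The factor 1/3 leaves room for the error of the whole ancestral chain. *)
Lemma anc_near v B z : (tag B < tag v)%N ->
  d z (ctr v) < kappa * rad v -> d z (ctr B) < rad B / (3 * kappa) ->
  anc (tag v - tag B) v = B.
Proof.
move=> tBv zv zB.
have [k kE] : exists k, (tag v - tag B = k.+1)%N.
  by exists (tag v - tag B).-1; lia.
rewrite kE; set u := anc k v.
have tu : tag u = (tag B).+1 by rewrite tag_anc; lia.
have rBu : rad B = a * rad u by rewrite /rad tu -rnS.
have h1 : d (ctr v) (ctr u) <= 6 / 5 * kappa * rad u by apply: anc_dist; lia.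
have h2 : rad v <= rad u by apply: ler_rad; lia.
have h3 : d (ctr u) (ctr B) < rad B / (2 * kappa).
  have t1 := metric_triangle (ctr u) z (ctr B).
  have t2 := metric_triangle (ctr u) (ctr v) z.
  rewrite (metric_sym (ctr u) (ctr v)) (metric_sym (ctr v) z) in t2.
  have h4 : kappa * rad v <= kappa * rad u by rewrite ler_pM2l.
  have h5 : 11 / 5 * kappa * rad u <= rad B / (6 * kappa).
    rewrite rBu ler_pdivlMr ?mulr_gt0//.
    have := rad_gt0 u; move: a_ge; rewrite expr2; nra.
  have -> : rad B / (2 * kappa) = rad B / (3 * kappa) + rad B / (6 * kappa).
    by field; rewrite gt_eqF.
  lra.
have h4 : d (ctr u) (ctr (anc k.+1 v)) <= d (ctr u) (ctr B) := parent_min tu.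
have h5 := metric_triangle (ctr (anc k.+1 v)) (ctr u) (ctr B).
rewrite (metric_sym _ (ctr u)) in h5.
(* The ancestor at the level of [B] is a center nearest to [ctr u], hence at distance less than
   [rad B / kappa] from [ctr B]; distinct centers of that level are further apart. *)
apply: contrapT => h6.
have : kappa^-1 * rad B <= d (ctr (anc k.+1 v)) (ctr B).
  by apply: ctr_sep => //; rewrite tag_anc; lia.
have -> : kappa^-1 * rad B = rad B / (2 * kappa) + rad B / (2 * kappa).
  by field; rewrite gt_eqF.
by move=> h7; lra.
Qed.

End Geometry.

(** * Sums over descendants and exactly additive weights *)

Section Additive.
Variables (R : realType) (X : metricType R) (kappa a : R).
Variable S : covering_data X kappa a.
Local Notation vertex := (vertex S).
Implicit Types (u v B : vertex) (f : vertex -> R).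

Definition dsum f n B : R :=
  \sum_(u : level S n | anc (n - tag B) (vtx u) == B) f (vtx u).

Lemma vtx_inj n : injective (@vtx R X kappa a S n).
Proof. by move=> u v /eqP; rewrite eq_Tagged => /eqP. Qed.

Lemma vtx_lev n v : tag v = n -> exists u : level S n, vtx u = v.
Proof. by case: v => m u /= <-; exists u. Qed.

Lemma dsumE f m (B : level S m) n :
  \sum_(B' in descendants B n) f (vtx B') = dsum f n (vtx B).
Proof. by apply: eq_bigl => u; rewrite inE. Qed.

Lemma dsum_split f B n k : (tag B <= n <= k)%N ->
  dsum f k B = dsum (dsum f k) n B.
Proof.
move=> /andP[mn nk]; rewrite /dsum [in RHS](exchange_big_dep xpredT) //=.
rewrite big_mkcond /=; apply: eq_bigr => u _.
have [u' u'E] : exists u' : level S n, vtx u' = anc (k - n) (vtx u).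
  by apply: vtx_lev; rewrite tag_anc; exact: subKn.
have e : anc (k - tag B) (vtx u) = anc (n - tag B) (vtx u').
  by rewrite u'E -anc_add; congr anc; move: mn nk; lia.
case: ifPn => h.
  transitivity (\sum_(w | w == u') f (vtx u)); first by rewrite big_pred1_eq.
  have hu : anc (n - tag B) (vtx u') == B by rewrite -e.
  apply: eq_bigl => w; rewrite -u'E eq_Tagged /= [u' == w]eq_sym.
  by have [->|] := eqVneq w u'; rewrite ?hu ?andbF.
rewrite big1// => w /andP[/eqP h1].
rewrite -u'E => /eqP /vtx_inj h2; move: h; rewrite e h2 h1 eqxx //.
Qed.

Lemma dsum_ge0 f n B : (forall v, 0 <= f v) -> 0 <= dsum f n B.
Proof. by move=> f0; apply: sumr_ge0. Qed.

(** For k > n the level-k sum below [B] is the sum, over the level-n descendants of [B], of their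
    own level-k sums. This finite identity survives the limit k to infinity. *)
Lemma additive_weight f K : (forall v, 0 <= f v) ->
  (forall B n, (tag B < n)%N -> K^-1 * f B <= dsum f n B <= K * f B) ->
  exists nu : vertex -> R, (forall B, K^-1 * f B <= nu B <= K * f B) /\
    (forall B n, (tag B <= n)%N -> dsum nu n B = nu B).
Proof.
move=> f0 fK.
(* The bounds hold strictly below [B] only; the value 0 elsewhere keeps the sequence bounded. *)
pose g B n := if (tag B < n)%N then dsum f n B else 0.
have bg B : bounded_seq (g B).
  apply: (@bounded_seq_ge0 _ _ (K * f B)) => n; rewrite /g.
  have h := fK B (tag B).+1 (ltnSn _).
  case: ifPn => [/fK/andP[_ ->]|_]; first by rewrite dsum_ge0.
  rewrite lexx (le_trans (dsum_ge0 (tag B).+1 B f0))//.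
  by case/andP: h.
exists (fun B => ulim (g B)); split=> [B|B n Bn].
  rewrite -(ulim_cst (K^-1 * f B)) -(ulim_cst (K * f B)).
  by apply/andP; split; apply: (@ler_ulim _ _ _ (tag B).+1) => //;
    try exact: bounded_seq_cst; move=> n Bn; rewrite /g Bn;
    have /andP[] := fK _ _ Bn.
rewrite /dsum /=.
have [h1 <-] := @ulim_sum R _ (index_enum (level S n))
  (fun w => anc (n - tag B) (vtx w) == B) (fun w => g (vtx w))
  (fun w => bg (vtx w)).
apply: (@eq_ulim _ _ _ n.+1) => // k nk; rewrite /g.
rewrite (leq_ltn_trans Bn nk) (@dsum_split _ _ n); last by rewrite Bn ltnW.
by apply: eq_bigr => u _; rewrite /= nk.
Qed.

End Additive.

(** * Coding the tree by nested half-open intervals *)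

Section SplitInterval.
Variables (R : realType) (T : eqType) (w : T -> R).
Hypothesis w_ge0 : forall i, 0 <= w i.

Lemma split_itv (r : seq T) (s : R) : uniq r ->
  exists f : T -> R, [/\
    forall t, s <= t < s + \sum_(i <- r) w i ->
      exists2 i, i \in r & f i <= t < f i + w i,
    forall i t, i \in r -> f i <= t < f i + w i ->
      s <= t < s + \sum_(i <- r) w i &
    forall i j t, i \in r -> j \in r ->
      f i <= t < f i + w i -> f j <= t < f j + w j -> i = j].
Proof.
elim: r s => [|x r IH] s /=.
  move=> _; exists (fun=> 0); split=> // t.
  by rewrite big_nil addr0 => /andP[h1]; rewrite ltNge h1.
move=> /andP[xr ur].
have [f [oc oin oun]] := IH (s + w x) ur.
have sum0 : 0 <= \sum_(i <- r) w i by apply: sumr_ge0.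
have wx0 := w_ge0 x.
have ineq i : i \in r -> (i == x) = false.
  by move=> ir; apply/negP => /eqP ix; rewrite -ix ir in xr.
exists (fun i => if i == x then s else f i).
rewrite big_cons; split.
- move=> t /andP[t1 t2]; have [t3|t3] := ltP t (s + w x).
    by exists x; rewrite ?mem_head// eqxx t1.
  have [|i ir h] := oc t; first by rewrite t3 -addrA.
  by exists i; rewrite ?inE ?ir ?orbT// ineq.
- move=> i t; rewrite inE => /predU1P[->|ir].
    rewrite eqxx => /andP[-> h] /=; apply: lt_le_trans h _.
    by rewrite addrA lerDl.
  rewrite ineq// => /(oin _ _ ir) /andP[h1 h2].
  by rewrite addrA h2 andbT; apply: le_trans h1; rewrite lerDl.
- move=> i j t; rewrite !inE => /predU1P[->|ir] /predU1P[->|jr] //.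
  + rewrite eqxx ineq// => /andP[_ h1] /(oin _ _ jr) /andP[h2].
    by have := lt_le_trans h1 h2; rewrite ltxx.
  + rewrite eqxx ineq// => /(oin _ _ ir) /andP[h2 _] /andP[_ h1].
    by have := lt_le_trans h1 h2; rewrite ltxx.
  + by rewrite !ineq//; exact: oun.
Qed.

End SplitInterval.

Section NestedIntervals.
Variables (R : realType) (X : metricType R) (kappa a : R).
Variable S : covering_data X kappa a.
Variable nu : vertex S -> R.
Hypotheses (nu_ge0 : forall v, 0 <= nu v)
  (nu_add : forall B, dsum nu (tag B).+1 B = nu B).
Local Notation vertex := (vertex S).
Implicit Types (u v B : vertex).

Definition children n (B : level S n) : seq (level S n.+1) :=
  [seq c <- enum (level S n.+1) | parent c == B].

Lemma mem_children n (B : level S n) c : (c \in children B) = (parent c == B).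
Proof. by rewrite mem_filter mem_enum andbT. Qed.

Lemma children_uniq n (B : level S n) : uniq (children B).
Proof. by rewrite filter_uniq// enum_uniq. Qed.

Lemma sum_children n (B : level S n) :
  \sum_(c <- children B) nu (vtx c) = nu (vtx B).
Proof.
rewrite -nu_add /dsum /children big_filter big_enum_cond /=.
apply: eq_bigl => c; rewrite subSnn /anc /=.
by rewrite (inj_eq (@vtx_inj _ _ _ _ _ n)).
Qed.

Definition child_offset n (B : level S n) (s : R) : level S n.+1 -> R :=
  projT1 (cid (split_itv (fun c : level S n.+1 => nu_ge0 (vtx c)) s
    (children_uniq B))).

Lemma child_offsetP n (B : level S n) s (f := child_offset B s) : [/\
    forall t, s <= t < s + nu (vtx B) ->
      exists2 c, parent c == B & f c <= t < f c + nu (vtx c),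
    forall c t, parent c == B -> f c <= t < f c + nu (vtx c) ->
      s <= t < s + nu (vtx B) &
    forall b c t, parent b == B -> parent c == B ->
      f b <= t < f b + nu (vtx b) -> f c <= t < f c + nu (vtx c) -> b = c].
Proof.
have := projT2 (cid (split_itv (fun c : level S n.+1 => nu_ge0 (vtx c)) s
    (children_uniq B))).
rewrite -/(child_offset B s) -/f sum_children => -[oc oin oun]; split.
- by move=> t /oc [c]; rewrite mem_children; exists c.
- by move=> c t cB; apply: oin; rewrite mem_children.
- by move=> b c t bB cB; apply: oun; rewrite mem_children.
Qed.

(** Left endpoints. The children fill the interval of their parent exactly because [nu] is
    additive. *)
Fixpoint offset n : level S n -> R :=
  match n with
  | 0 => fun=> 0
  | n.+1 => fun c => child_offset (parent c) (offset (parent c)) c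
  end.

Definition itv_of v (t : R) : bool :=
  (offset (tagged v) <= t < offset (tagged v) + nu v).

Lemma itv_of_parent v t : itv_of v t -> itv_of (parent_vertex v) t.
Proof.
case: v => -[|n] u //; have [_ oin _] := child_offsetP (parent u) (offset (parent u)).
exact: oin.
Qed.

Lemma itv_of_child B t : itv_of B t ->
  exists u, [/\ parent_vertex u = B, tag u = (tag B).+1 & itv_of u t].
Proof.
case: B => n B; have [oc _ _] := child_offsetP B (offset B).
move=> /oc [c /eqP cB ct]; exists (vtx c); split => //.
  by rewrite /= cB.
by rewrite /itv_of /= cB.
Qed.

Lemma itv_of_uniq u v t : tag u = tag v -> itv_of u t -> itv_of v t -> u = v.
Proof.
move en : (tag v) => n; elim: n u v en => [|n IH] u v tv tu.
  by move=> _ _; exact: root_unique.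
move=> ut vt.
have := IH _ _ _ _ (itv_of_parent ut) (itv_of_parent vt).
rewrite !tag_parent tu tv => /(_ erefl erefl).
case: u v tu tv ut vt => m u [m' v] /= mE mE'; subst m; subst m'.
rewrite /itv_of /= => ut vt /vtx_inj uv.
have [_ _ oun] := child_offsetP (parent v) (offset (parent v)).
move: ut; rewrite uv => ut.
by rewrite (oun u v t) ?uv.
Qed.

Lemma itv_of_level n (w : level S 0) t : itv_of (vtx w) t ->
  exists u, tag u = n /\ itv_of u t.
Proof.
move=> wt; elim: n => [|n [u [<- ut]]]; first by exists (vtx w).
by have [v [_ tv vt]] := itv_of_child ut; exists v.
Qed.

Lemma itv_of_anc k v t : itv_of v t -> itv_of (anc k v) t.
Proof. by move=> vt; elim: k => // k IH; apply: itv_of_parent. Qed.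

End NestedIntervals.

(** * The measure of an additive weight *)

Lemma compact_seq_cluster (R : realType) (X : metricType R) :
  compact [set: X] -> forall f : nat -> X,
  exists y, forall m e, 0 < e -> exists2 n, (m <= n)%N & mdist (f n) y < e.
Proof.
move=> cX f; have [y [_ fy]] := cX (f @ \oo) _ filterT.
exists y => m e e0.
have fm : (f @ \oo) [set f n | n in [set n | (m <= n)%N]].
  by exists m => // n /= mn; exists n.
have [_ [[n mn <-]]] := fy _ _ fm (nbhsx_ballx y e e0).
by rewrite ballEmdist /= metric_sym; exists n.
Qed.

Lemma measure_bigsetU_le d (T : measurableType d) (R : realType)
    (mu : {measure set T -> \bar R}) (I : Type) (r : seq I) (P : pred I)
    (F : I -> set T) : (forall i, measurable (F i)) ->
  (mu (\big[setU/set0]_(i <- r | P i) F i) <= \sum_(i <- r | P i) mu (F i))%E.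
Proof.
move=> mF; elim: r => [|x r IH]; first by rewrite !big_nil measure0.
rewrite !big_cons; case: (P x) => //.
have mU : measurable (\big[setU/set0]_(j <- r | P j) F j).
  exact: bigsetU_measurable.
by apply: (le_trans (measureU2 mu (mF x) mU)); exact: leeD.
Qed.

Lemma bigsetUP (T : Type) (I : finType) (P : pred I) (F : I -> set T) t :
  (\big[setU/set0]_(i | P i) F i) t <-> exists2 i, P i & F i t.
Proof.
rewrite -bigcup_seq_cond; split=> [[i /= /andP[_ Pi] Fi]|[i Pi Fi]].
  by exists i.
by exists i => //=; rewrite mem_index_enum.
Qed.

Section TreeMeasure.
Variables (R : realType) (X : pointedMetricType R) (kappa a : R).
Variable S : covering_data X kappa a.
Hypotheses (kappa_ge1 : 1 <= kappa) (a_ge : 192 * kappa ^+ 2 <= a).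
Hypothesis X_compact : compact [set: X].
Variable nu : vertex S -> R.
Hypotheses (nu_ge0 : forall v, 0 <= nu v)
  (nu_add : forall B, dsum nu (tag B).+1 B = nu B).
Local Notation d := (@mdist R X).
Local Notation vertex := (vertex S).
Local Notation itv_of := (itv_of nu_ge0).
Implicit Types (u v B : vertex).

Let kappa_gt0 : 0 < kappa. Proof. exact: lt_le_trans ltr01 kappa_ge1. Qed.

(** The cells whose interval contains t form one ancestral line. By compactness their centers
    cluster at a point, and [anc_dist] bounds its distance to every center of the line. *)
Lemma limit_map : exists Phi : R -> X, forall v t, itv_of v t ->
  d (ctr v) (Phi t) <= 6 / 5 * kappa * rad v.
Proof.
suff h t : exists y, forall v, itv_of v t -> d (ctr v) y <= 6 / 5 * kappa * rad v.
  by exists (fun t => projT1 (cid (h t))) => v t; case: (cid (h t)) => y /=; apply.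
have [w [w0 _]] := cover S 0 point.
have [w' w'E] := vtx_lev w0.
have [wt|wt] := boolP (itv_of w t); last first.
  (* Outside the interval of the root no cell contains t, so any value will do. *)
  exists point => v vt; exfalso; move/negP: wt; apply.
  have := itv_of_anc nu_add (tag v) vt.
  by rewrite (@root_unique _ _ _ _ _ (anc (tag v) v) w)// tag_anc subnn.
have ex n : exists v, tag v = n /\ itv_of v t.
  by apply: (@itv_of_level _ _ _ _ _ _ nu_ge0 nu_add n w'); rewrite w'E.
pose f n := projT1 (cid (ex n)).
have ft n : tag (f n) = n by rewrite /f; case: cid => v [].
have fi n : itv_of (f n) t by rewrite /f; case: cid => v [].
have [y yP] := compact_seq_cluster X_compact (fun n => ctr (f n)).
exists y => v vt; apply/ler_addgt0Pl => e e0.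
have [n vn yn] := yP (tag v) e e0.
have fv : anc (n - tag v) (f n) = v.
  apply: (itv_of_uniq nu_add _ _ vt); last exact: (itv_of_anc nu_add).
  by rewrite tag_anc ft subKn.
have := @anc_dist _ _ _ _ _ kappa_ge1 a_ge (n - tag v) (f n).
rewrite ft leq_subr fv => /(_ isT) h.
have := metric_triangle (ctr v) (ctr (f n)) y.
by rewrite (metric_sym (ctr v) (ctr (f n))); move: h yn => /=; lra.
Qed.

Variable theta : distance R X.
Local Notation Y := (remetric theta).
Hypothesis theta_open : forall A : set X, @open Y A -> @open X A.

Let J v : set R := [set t | itv_of v t].

Let JE v : J v = [set` `[offset nu_ge0 (tagged v),
  offset nu_ge0 (tagged v) + nu v[].
Proof. by apply/seteqP; split=> t /=; rewrite in_itv. Qed.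

Let mJ v : measurable (J v).
Proof. by rewrite JE; exact: measurable_itv. Qed.

Let leb_J v : lebesgue_measure (J v) = (nu v)%:E.
Proof.
rewrite JE lebesgue_measure_itv /= lte_fin ltrDl.
case: ltP => [_|h]; first by rewrite -EFinB addrAC subrr add0r.
by congr EFin; apply/eqP; rewrite eq_le nu_ge0 h.
Qed.

(** The measure lives on the Borel sets of [theta], while cells are located by d. Since [Phi] maps
    the interval of v into the closed d-ball of radius 6/5 kappa r_n about its center, such balls
    decide which cells lie in an open set or may meet it. *)
Lemma tree_measure : exists mu : {measure set (borel Y) -> \bar R}, [/\
  (mu [set: Y] < +oo)%E,
  forall (A : set Y) v, @open Y A ->
    (forall x, d (ctr v) x <= 6 / 5 * kappa * rad v -> A x) ->
    ((nu v)%:E <= mu A)%E &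
  forall (A : set Y) n (P : pred (level S n)), @open Y A ->
    (forall x (u : level S n), A x ->
      d (ctr (vtx u)) x <= 6 / 5 * kappa * a ^- n -> P u) ->
    (mu A <= (\sum_(u | P u) nu (vtx u))%:E)%E].
Proof.
have [Phi0 Phi0P] := limit_map.
have [w [w0 _]] := cover S 0 point.
have [w' w'E] := vtx_lev w0.
have rootJ v : J v `<=` J w.
  move=> t /(itv_of_anc nu_add (tag v)).
  by rewrite (@root_unique _ _ _ _ _ (anc (tag v) v) w)// tag_anc subnn.
have lev n t : J w t -> exists v, tag v = n /\ J v t.
  rewrite -w'E; exact: itv_of_level.
(* Outside the root interval [Phi0] is arbitrary, so it is made constant there to be measurable. *)
pose Phi (t : R) : borel Y := if `[< J w t >] then Phi0 t else point.
have PhiP v t : J v t -> d (ctr v) (Phi t) <= 6 / 5 * kappa * rad v.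
  move=> vt; rewrite /Phi; case: asboolP => [_|]; first exact: Phi0P.
  by move/rootJ: vt.
have mPhi : measurable_fun [set: R] Phi.
  apply: (@measurability _ _ R (borel Y) setT Phi (@open Y)) => //.
  move=> _ [A Ao <-]; rewrite setTI.
  (* Inside the root interval, the preimage of an open set is the union of the intervals of the
     cells whose ball lies in it: small enough cells around t qualify. *)
  pose good v := `[< forall x, d (ctr v) x <= 6 / 5 * kappa * rad v -> A x >].
  pose out := ~` J w `&` [set t : R | A point].
  have -> : Phi @^-1` A = out `|` \bigcup_n
      \big[setU/set0]_(u : level S n | good (vtx u)) J (vtx u).
    apply/seteqP; split=> [t At|t].
      have [wt|wt] := pselect (J w t); last first.
        by left; split=> //=; move: At; rewrite /= /Phi; case: asboolP.
      right.
      have /theta_open Ao' := Ao.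
      have := open_nbhs_nbhs (conj Ao' At); rewrite -nbhs_ballE => -[e /= e0 eA].
      have e1 : 0 < e / (12 / 5 * kappa) by rewrite divr_gt0// mulr_gt0.
      have [n ne] := rn_small kappa_ge1 a_ge e1.
      have [v [vn vt]] := lev n _ wt; have [u uE] := vtx_lev vn.
      exists n => //; apply/bigsetUP; exists u; rewrite ?uE//.
      apply/asboolP => x vx; apply: eA; rewrite ballEmdist /=.
      have := @metric_triangle R X (Phi t) (ctr v) x.
      rewrite (@metric_sym R X (Phi t) (ctr v)) => h1; have h2 := PhiP _ _ vt.
      apply: le_lt_trans h1 _; apply: le_lt_trans (lerD h2 vx) _.
      move: ne; rewrite ltr_pdivlMr ?mulr_gt0// /rad vn; lra.
    case=> [[wt At]|[n _ /bigsetUP[u /asboolP gu ut]]].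
      by rewrite /= /Phi asboolF.
    by apply: gu; exact: PhiP.
  apply: measurableU.
    apply: measurableI; first exact: measurableC.
    have [h|h] := pselect (A point).
      rewrite (_ : [set _ | _] = setT); first exact: measurableT.
      by apply/seteqP; split.
    rewrite (_ : [set _ | _] = set0); first exact: measurable0.
    by apply/seteqP; split.
  apply: bigcupT_measurable => n; apply: bigsetU_measurable => u _; exact: mJ.
have mA A : @open Y A -> measurable (A : set (borel Y)).
  by move=> Ao; exact: sub_sigma_algebra.
(* Restricting to the root interval makes the total mass finite. *)
pose m := mrestr (@lebesgue_measure R) (mJ w).
pose mu := measure_function_pushforward__canonical__measure_function_Measure m mPhi.
exists mu.
have mpre A : @open Y A -> measurable (Phi @^-1` A : set R).
  by move=> Ao; rewrite -[X in measurable X]setTI; apply: (mPhi) => //; exact: mA.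
split.
- rewrite [X in (X < _)%E](_ : _ = lebesgue_measure (J w)).
    by rewrite leb_J ltry.
  by rewrite /mu /= /pushforward /m /mrestr preimage_setT setTI.
- move=> A v Ao vA; rewrite -leb_J /mu /= /pushforward /m /mrestr.
  apply: le_measure; rewrite ?inE; [exact: mJ| |].
    by apply: measurableI; [exact: mpre|exact: mJ].
  move=> t vt; split; last exact: rootJ vt.
  by apply: vA; exact: PhiP.
- move=> A n P Ao AP.
  rewrite [X in (X <= _)%E](_ : _ = lebesgue_measure (Phi @^-1` A `&` J w))//.
  apply: (@le_trans _ _ (lebesgue_measure (\big[setU/set0]_(u | P u) J (vtx u)))).
    apply: le_measure; rewrite ?inE.
    + by apply: measurableI; [exact: mpre|exact: mJ].
    + by apply: bigsetU_measurable => u _; exact: mJ.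
    move=> t [At wt]; have [v [vn vt]] := lev n _ wt.
    have [u uE] := vtx_lev vn; apply/bigsetUP; exists u; rewrite ?uE//.
    by apply: (AP (Phi t)) => //; rewrite uE -vn; exact: PhiP.
  apply: le_trans (@measure_bigsetU_le _ _ R (@lebesgue_measure R) _
    (index_enum (level S n)) P (fun c => J (vtx c)) (fun c => mJ (vtx c))) _.
  by rewrite -sumEFin; apply: lee_sum => u _; have /= -> := leb_J (vtx u).
Qed.

End TreeMeasure.

(** * Regularity of finite Borel measures *)

Lemma open_metric_ball (R : realType) (Y : metricType R) (x : Y) (r : R) :
  open (ball x r).
Proof.
rewrite openE => y; rewrite ballEmdist /= => xy.
rewrite /interior -nbhs_ballE; exists (r - mdist x y); first by rewrite /= subr_gt0.
move=> z; rewrite !ballEmdist /= => yz.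
by have := metric_triangle x y z; lra.
Qed.

Section Radon.
Variables (R : realType) (Y : pointedMetricType R).
Variable mu : {measure set (borel Y) -> \bar R}.
Hypothesis mu_fin : (mu [set: Y] < +oo)%E.

Lemma open_borel (A : set Y) : open A -> measurable (A : set (borel Y)).
Proof. by move=> Ao; exact: sub_sigma_algebra. Qed.

Lemma closed_borel (A : set Y) : closed A -> measurable (A : set (borel Y)).
Proof.
by move=> Ac; rewrite -[A]setCK; apply: measurableC; apply: open_borel; exact: closed_openC.
Qed.

Lemma borel_fin (A : set (borel Y)) : measurable A -> (mu A < +oo)%E.
Proof. by move=> mA; apply: le_lt_trans mu_fin; apply: le_measure; rewrite ?inE. Qed.

Lemma nonincreasing_lt (G : (set (borel Y))^nat) e :
  (forall n, measurable (G n)) -> nonincreasing_seq G ->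
  (mu (\bigcap_n G n) < e%:E)%E -> exists n, (mu (G n) < e%:E)%E.
Proof.
move=> mG niG ltG.
have := nonincreasing_cvg_mu (borel_fin (mG 0%N)) mG (bigcapT_measurable mG) niG.
move=> /(_ _ (open_ereal_lt' ltG)) [N _ /(_ N (leqnn N))].
by exists N.
Qed.

(** Inner and outer approximation in one condition, which passes to complements by exchanging the
    roles of [F] and [U]. *)
Definition regular_set (A : set (borel Y)) := forall e : R, 0 < e ->
  exists F U : set Y, [/\ closed F, open U, F `<=` A, A `<=` U &
    (mu (U `\` F : set (borel Y)) < e%:E)%E].

(** An open set is the increasing union of the closed sets of points at distance at least 1/(n+1)
    from its complement. *)
Lemma open_regular (U : set Y) : open U -> regular_set U.
Proof.
move=> Uo e e0.
pose C n : set Y := \bigcup_(y in ~` U) ball y n.+1%:R^-1.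
have Co n : open (C n).
  by apply: bigcup_open => y _; exact: open_metric_ball.
have [n ltn] : exists n, (mu (U `&` C n : set (borel Y)) < e%:E)%E.
  apply: nonincreasing_lt.
  - by move=> n; apply: measurableI; apply: open_borel.
  - move=> m n mn; apply/subsetPset; apply: setIS => x [y Uy yx].
    exists y => //; apply: le_ball yx.
    by rewrite lef_pV2 ?posrE// ler_nat ltnS.
  - rewrite (_ : \bigcap_n _ = set0) ?measure0//.
    apply/seteqP; split=> // x Cx.
    have [Ux _] := Cx 0%N Logic.I.
    have := open_nbhs_nbhs (conj Uo Ux); rewrite -nbhs_ballE => -[r /= r0 rU].
    have [N _ /(_ N (leqnn N)) Nr] := near_infty_natSinv_lt (PosNum r0).
    have [_ [y nUy yx]] := Cx N Logic.I.
    apply: nUy; apply: rU; apply: ball_sym; apply: le_ball yx; exact: ltW.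
exists (~` C n), U; split=> //.
- exact: open_closedC.
- by move=> x nCx; apply: contrapT => Ux; apply: nCx; exists x => //; exact: ballxx.
- by rewrite setDE setCK.
Qed.

(** Approximations with errors in geometric progression cost at most e/4 in total. An infinite union
    of closed sets need not be closed, so a finite one is used; continuity from above keeps its
    defect below e. *)
Lemma bigcup_regular (A : (set (borel Y))^nat) :
  (forall n, regular_set (A n)) -> regular_set (\bigcup_n A n).
Proof.
move=> rA e e0.
have e2 : 0 < e / 4 by rewrite divr_gt0.
have h n : {FU : set Y * set Y | [/\ closed FU.1, open FU.2, FU.1 `<=` A n,
   A n `<=` FU.2 & (mu (FU.2 `\` FU.1 : set (borel Y)) < (e / 4 / (2 ^ n.+1)%:R)%:E)%E]}.
  apply: cid; have [|F [U [? ? ? ? ?]]] := rA n (e / 4 / (2 ^ n.+1)%:R).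
    by rewrite divr_gt0// ltr0n expn_gt0.
  by exists (F, U).
pose F n := (projT1 (h n)).1; pose U n := (projT1 (h n)).2.
have hP n : [/\ closed (F n), open (U n), F n `<=` A n,
   A n `<=` U n & (mu (U n `\` F n : set (borel Y)) < (e / 4 / (2 ^ n.+1)%:R)%:E)%E].
  exact: projT2 (h n).
pose UU := \bigcup_n U n.
have UUo : open UU by apply: bigcup_open => n _; have [] := hP n.
pose FF n := \bigcup_(i in `I_n) F i.
have FFc n : closed (FF n).
  by apply: closed_bigcup => [|i _]; [exact: finite_II|have [] := hP i].
have mUF n : measurable (U n `\` F n : set (borel Y)).
  by have [? ? _ _ _] := hP n; apply: measurableD; [exact: open_borel|exact: closed_borel].
have [n ltn] : exists n, (mu (UU `\` FF n : set (borel Y)) < e%:E)%E.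
  apply: nonincreasing_lt.
  - by move=> n; apply: measurableD; [exact: open_borel|exact: closed_borel].
  - move=> m n mn; apply/subsetPset; apply: setDS => x [i /= im Fi].
    by exists i => //=; exact: leq_trans im mn.
  - apply: (@le_lt_trans _ _ (mu (\bigcup_n (U n `\` F n)))).
      apply: le_measure; rewrite ?inE.
      + by apply: bigcapT_measurable => n; apply: measurableD;
          [exact: open_borel|exact: closed_borel].
      + exact: bigcupT_measurable.
      move=> x xP; have [[i _ Ui] _] := xP 0%N Logic.I; exists i => //; split=> //.
      by move=> Fi; have [_] := xP i.+1 Logic.I; apply; exists i => /=.
    apply: (@le_lt_trans _ _ (e / 4)%:E); last by rewrite lte_fin; lra.
    have hB : (mu (\bigcup_n (U n `\` F n) : set (borel Y)) <=
        \sum_(i <oo) mu (U i `\` F i : set (borel Y)))%E.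
      by apply: measure_sigma_subadditive => //; exact: bigcupT_measurable.
    apply: le_trans hB _.
    apply: le_trans (epsilon_trick0 xpredT (ltW e2)).
    by apply: lee_nneseries => // n _; apply: ltW; have [] := hP n.
exists (FF n), UU; split=> //.
- by move=> x [i _ Fi]; exists i => //; have [_ _ FA _ _] := hP i; exact: FA.
- by move=> x [i _ Ai]; exists i => //; have [_ _ _ AU _] := hP i; exact: AU.
Qed.

Lemma borel_regular (A : set (borel Y)) : measurable A -> regular_set A.
Proof.
move: A; apply: smallest_sub => [|U]; last exact: open_regular.
split.
- by apply: open_regular; exact: open0.
- move=> A rA e e0; have [F [U [Fc Uo FA AU lt]]] := rA e e0.
  exists (~` U), (~` F); split.
  + exact: open_closedC.
  + exact: closed_openC.
  + by move=> x nU; split=> // /AU.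
  + by move=> x [_ nA] /FA.
  + by rewrite setDE setCK setIC -setDE.
- exact: bigcup_regular.
Qed.

Lemma finite_radon : compact [set: Y] -> radon mu.
Proof.
move=> cY; split.
- move=> K /compact_closed-/(_ (@metric_hausdorff _ _)) Kc.
  exact: borel_fin (closed_borel Kc).
- move=> A mA; apply/eqP; rewrite eq_le; apply/andP; split.
    apply: le_ereal_inf_tmp => _ [U [Uo AU] <-].
    by apply: le_measure; rewrite ?inE//; exact: open_borel.
  apply/lee_addgt0Pr => e e0.
  have [F [U [Fc Uo FA AU lt]]] := borel_regular mA e0.
  apply: (@le_trans _ _ (mu U)); first by apply: ereal_inf_lbound; exists U.
  have mU := open_borel Uo; have mF := closed_borel Fc.
  rewrite (measureDI mu mU mF) addeC; apply: leeD; last exact: ltW.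
  by apply: le_measure; rewrite ?inE//; [exact: measurableI|move=> x [_ /FA]].
- move=> U Uo; apply/eqP; rewrite eq_le; apply/andP; split; last first.
    apply: ge_ereal_sup => _ [K [/compact_closed-/(_ (@metric_hausdorff _ _)) Kc KU] <-].
    by apply: le_measure; rewrite ?inE//; [exact: closed_borel|exact: open_borel].
  have mU := open_borel Uo.
  apply/lee_addgt0Pr => e e0.
  have [F [V [Fc Vo FA AV lt]]] := borel_regular mU e0.
  have mF := closed_borel Fc.
  rewrite (measureDI mu mU mF) addeC; apply: leeD.
    apply: (@le_trans _ _ (mu F)).
      by apply: le_measure; rewrite ?inE//; exact: measurableI.
    apply: ereal_sup_ubound; exists F => //; split => //.
    exact: (@subclosed_compact _ _ [set: Y]).
  apply: le_trans (ltW lt); apply: le_measure; rewrite ?inE.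
  + exact: measurableD.
  + by apply: measurableD => //; exact: open_borel.
  + exact: setSD.
Qed.

End Radon.

(** * Ahlfors regularity as packing and covering bounds *)

Lemma sum_measure_le d (T : measurableType d) (R : realType)
    (mu : {measure set T -> \bar R}) (I : choiceType) (r : seq I) (P : pred I)
    (F : I -> set T) : (forall i, measurable (F i)) -> uniq r ->
  (forall i j x, P i -> P j -> F i x -> F j x -> i = j) ->
  (\sum_(i <- r | P i) mu (F i) <= mu (\big[setU/set0]_(i <- r | P i) F i))%E.
Proof.
move=> mF + disj; elim: r => [|x r IH] /=; first by rewrite !big_nil.
move=> /andP[xr /IH {}IH]; rewrite !big_cons; case: ifP => // Px.
rewrite measureU//; first exact: leeD.
- by apply: bigsetU_measurable.
- apply/seteqP; split=> // y [Fx].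
  rewrite -bigcup_seq_cond => -[j /= /andP[jr Pj] Fj].
  by rewrite (disj x j y) ?jr// in xr.
Qed.

Section AhlforsRegular.
Variables (R : realType) (X : pointedMetricType R) (theta : distance R X).
Local Notation Y := (remetric theta).

Lemma theta_ge0 x y : 0 <= theta x y.
Proof. exact: (@mdist_ge0 R Y). Qed.

Lemma theta_gt0 x y : x <> y -> 0 < theta x y.
Proof.
move=> xy; rewrite lt_neqAle theta_ge0 andbT; apply/eqP => h.
by apply: xy; exact/(@dist_positivity _ _ theta).
Qed.

Lemma theta_ballE x r : @ball R Y x r = [set y | theta x y < r].
Proof. by rewrite ballEmdist. Qed.

(** Measure-free forms of regularity, here and in [covering_bound]. The lower measure bound holds
    only for radii up to the diameter, which restricts the small radii [s] in a packing and the
    large radius [r] in a covering. *)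
Definition packing_bound (q C : R) := forall (I : finType) (P : pred I)
  (c : I -> X) (s : I -> R) x r, 0 < r ->
  (forall i, P i -> 0 < s i /\ exists y z, s i <= theta y z) ->
  (forall i j z, P i -> P j -> theta (c i) z < s i -> theta (c j) z < s j -> i = j) ->
  (forall i z, P i -> theta (c i) z < s i -> theta x z < r) ->
  \sum_(i | P i) s i `^ q <= C * r `^ q.

Definition covering_bound (q C : R) := forall (I : finType) (P : pred I)
  (c : I -> X) (s : I -> R) x r, 0 < r -> (exists y z, r <= theta y z) ->
  (forall i, P i -> 0 < s i) ->
  (forall z, theta x z < r -> exists2 i, P i & theta (c i) z < s i) ->
  r `^ q <= C * \sum_(i | P i) s i `^ q.

Lemma theta_le_diam y z : ((theta y z)%:E <= diam Y)%E.
Proof. by apply: ereal_sup_ubound; exists (y, z). Qed.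

Lemma ahlfors_bounds (q : R) : compact [set: Y] -> ahlfors_regular q Y ->
  (exists x y : X, x <> y) ->
  exists C, [/\ 0 < C, packing_bound q C & covering_bound q C].
Proof.
move=> cY [q0 [mu [K [[muK _ _] K1 muB]]]] [x0 [x1 x01]].
have muT : (mu [set: Y] < +oo)%E := muK _ cY.
have K0 : 0 < K := lt_le_trans ltr01 K1.
have mball x r : measurable (@ball R Y x r : set (borel Y)).
  by apply: open_borel; exact: open_metric_ball.
have D0 := theta_gt0 x01; set D := theta x0 x1 in D0.
pose m (A : set (borel Y)) := fine (mu A).
have mE A : measurable A -> mu A = (m A)%:E.
  by move=> mA; rewrite /m fineK// ge0_fin_numE//; exact: borel_fin.
have m_le A B : measurable A -> measurable B -> A `<=` B -> m A <= m B.
  by move=> mA mB AB; rewrite -lee_fin -!mE//; apply: le_measure; rewrite ?inE.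
have bnd x r : 0 < r -> (exists y z, r <= theta y z) ->
    K^-1 * r `^ q <= m (@ball R Y x r) <= K * r `^ q.
  move=> r0 [y [z ryz]].
  have rq := powR_gt0 q r0.
  have := muB x r r0 (le_trans _ (theta_le_diam y z)).
  rewrite lee_fin => /(_ ryz).
  by rewrite mE// -EFinM !lee_fin ler_pdivlMr// ler_pdivrMr.
pose M := m setT.
have M0 : 0 <= M by rewrite fine_ge0.
(* Beyond radius D, the distance of two fixed points, the total mass M gives the upper bound. *)
pose K' := K + M / D `^ q.
have Dq := powR_gt0 q D0.
have K'0 : 0 < K' by rewrite ltr_wpDr// divr_ge0// ltW.
have up x r : 0 < r -> m (@ball R Y x r) <= K' * r `^ q.
  move=> r0; have rq := powR_gt0 q r0; have [rD|Dr] := leP r D.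
    have /andP[_ h] := bnd x r r0 ltac:(by exists x0, x1).
    by apply: (le_trans h); rewrite ler_pM2r// lerDl divr_ge0// ltW.
  apply: (@le_trans _ _ M); first exact: m_le.
  apply: (@le_trans _ _ (M / D `^ q * r `^ q)).
    rewrite mulrAC -mulrA ler_peMr// ler_pdivlMr// mul1r.
    by apply: ge0_ler_powR; rewrite ?nnegrE ltW.
  by rewrite ler_pM2r// lerDr ltW.
exists (K * K'); split; first exact: mulr_gt0.
- move=> I P c s x r r0 sP disj sub.
  have -> : K * K' * r `^ q = K * (K' * r `^ q) by rewrite mulrA.
  apply: le_trans (_ : K * m (@ball R Y x r) <= _); last by rewrite ler_pM2l// up.
  rewrite -ler_pdivrMl// mulr_sumr.
  apply: (@le_trans _ _ (\sum_(i | P i) m (@ball R Y (c i) (s i)))).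
    apply: ler_sum => i Pi; have [si0 sid] := sP i Pi.
    by have /andP[] := bnd (c i) (s i) si0 sid.
  rewrite -lee_fin -sumEFin -mE//.
  rewrite (eq_bigr (fun i => mu (@ball R Y (c i) (s i)))); last first.
    by move=> i _; rewrite mE.
  have disjB i j z : P i -> P j -> @ball R Y (c i) (s i) z ->
      @ball R Y (c j) (s j) z -> i = j.
    by move=> Pi Pj; rewrite !theta_ballE; exact: disj.
  apply: le_trans (sum_measure_le mu (fun i => mball (c i) (s i))
    (index_enum_uniq I) disjB) _.
  apply: le_measure; rewrite ?inE//; first exact: bigsetU_measurable.
  by move=> z /bigsetUP[i Pi]; rewrite !theta_ballE; exact: sub.
- move=> I P c s x r r0 rd sP cov.
  have /andP[h _] := bnd x r r0 rd.
  rewrite -mulrA -ler_pdivrMl//; apply: (le_trans h).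
  rewrite mulr_sumr.
  apply: (@le_trans _ _ (\sum_(i | P i) m (@ball R Y (c i) (s i)))); last first.
    by apply: ler_sum => i Pi; apply: up; exact: sP.
  rewrite -lee_fin -sumEFin -mE//.
  rewrite [leRHS](eq_bigr (fun i => mu (@ball R Y (c i) (s i)))); last first.
    by move=> i _; rewrite mE.
  apply: le_trans (measure_bigsetU_le mu _ _ (fun i => mball (c i) (s i))).
  apply: le_measure; rewrite ?inE//; first exact: bigsetU_measurable.
  move=> z; rewrite theta_ballE => /cov [i Pi zi]; apply/bigsetUP; by exists i.
Qed.

Lemma homeo_compact : compact [set: X] -> homeomorphism (id : X -> Y) ->
  compact [set: Y].
Proof.
move=> cX [h _]; rewrite -(image_id [set: Y]).
by apply: (@continuous_compact X Y id setT) => //; exact: continuous_subspaceT.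
Qed.

(** A division-free form, with y = z allowed, which turns inequalities between d-distances into
    inequalities between theta-distances. *)
Lemma quasisymmetric_weak eta : quasisymmetric eta (id : X -> Y) ->
  forall L, 0 <= L -> exists2 H, 1 <= H & forall x y z : X,
    mdist x z <= L * mdist y z -> theta x z <= H * theta y z.
Proof.
move=> [[mono [img _ _] _ _] _ qs] L L0.
have etaL : 0 <= eta L.
  by have /= := img L; rewrite !in_itv /= !andbT; apply.
exists (1 + eta L); first by rewrite lerDl.
move=> x y z h; have [yz|/eqP yz] := eqVneq y z.
  move: h; rewrite yz mdistxx mulr0 => h.
  have -> : x = z by apply: (@mdist_positivity R X); apply/eqP; rewrite eq_le h mdist_ge0.
  by rewrite !dist_xx mulr0.
have t0 := theta_gt0 yz.
have d0 : 0 < mdist y z by rewrite mdist_gt0; apply/eqP.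
have := qs x y z yz; rewrite /mdist /= ler_pdivrMr// => h2.
apply: (le_trans h2); rewrite ler_pM2r//.
apply: (@le_trans _ _ (eta L)); last by rewrite lerDr.
have h3 : mdist x z / mdist y z <= L by rewrite ler_pdivrMr.
have h4 : 0 <= mdist x z / mdist y z by rewrite divr_ge0 ?mdist_ge0.
move: h3; rewrite le_eqVlt => /predU1P[->//|h3].
by apply/ltW/mono => //; rewrite in_itv /= andbT.
Qed.

End AhlforsRegular.

(** * The size of a cell for a distance of the gauge *)

(** The radii r_n start at 1, which may exceed the diameter; the term [KP / D] pays for radii
    between D and 1. *)
Lemma perfect_unit (R : realType) (X : metricType R) (KP : R) (x0 x1 : X) :
  uniformly_perfect KP X -> x0 <> x1 ->
  exists2 P, 1 <= P & forall (x : X) r, 0 < r <= 1 ->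
    exists y, mdist x y < r /\ r <= P * mdist x y.
Proof.
move=> [KP1 perf] x01; set D := mdist x0 x1.
have D0 : 0 < D by rewrite mdist_gt0; apply/eqP.
have Dd : (D%:E <= diam X)%E by apply: ereal_sup_ubound; exists (x0, x1).
have KP0 : 0 < KP by lra.
exists (KP + KP / D) => [|x r /andP[r0 r1]].
  by rewrite -[1]addr0 lerD// ?divr_ge0// ltW.
have small s : 0 < s -> s <= D -> exists y, mdist x y < s /\ s <= KP * mdist x y.
  move=> s0 sD; have [|y] := perf x s s0; first by apply: le_trans Dd; rewrite lee_fin.
  rewrite !ballEmdist /= => -[h1 /negP]; rewrite -leNgt => h2.
  by exists y; split=> //; rewrite -ler_pdivrMl.
have [rD|Dr] := leP r D.
  have [y [h1 h2]] := small r r0 rD; exists y; split=> //.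
  by apply: (le_trans h2); rewrite ler_wpM2r ?mdist_ge0// lerDl divr_ge0// ltW.
have [y [h1 h2]] := small D D0 (lexx _); exists y; split; first exact: lt_trans Dr.
apply: (@le_trans _ _ (KP / D * mdist x y)).
  by apply: (le_trans r1); rewrite mulrAC ler_pdivlMr// mul1r.
by rewrite ler_wpM2r ?mdist_ge0// lerDr ltW.
Qed.

Section Size.
Variables (R : realType) (X : pointedMetricType R) (kappa a : R).
Variable S : covering_data X kappa a.
Hypotheses (kappa_ge1 : 1 <= kappa) (a_ge : 192 * kappa ^+ 2 <= a).
Variable theta : distance R X.
Hypothesis theta_qs : forall L, 0 <= L -> exists2 H, 1 <= H &
  forall x y z : X, mdist x z <= L * mdist y z -> theta x z <= H * theta y z.
Variable P : R.
Hypothesis P_ge1 : 1 <= P.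
Hypothesis perf : forall (x : X) r, 0 < r <= 1 ->
  exists y, mdist x y < r /\ r <= P * mdist x y.
Local Notation d := (@mdist R X).
Local Notation vertex := (vertex S).
Implicit Types (u v B : vertex).

Let kappa_gt0 : 0 < kappa. Proof. exact: lt_le_trans ltr01 kappa_ge1. Qed.

Let rad0 v : 0 < rad v. Proof. exact: rad_gt0 kappa_ge1 a_ge v. Qed.

Let rad01 v : 0 < rad v <= 1. Proof. by rewrite rad0 (rn_le1 kappa_ge1 a_ge). Qed.

Definition witness v : X := projT1 (cid (perf (ctr v) (rad01 v))).

Lemma witnessP v : d (ctr v) (witness v) < rad v /\
  rad v <= P * d (ctr v) (witness v).
Proof. exact: (projT2 (cid (perf (ctr v) (rad01 v)))). Qed.

Definition vsize v : R := theta (ctr v) (witness v).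

Lemma vsize_gt0 v : 0 < vsize v.
Proof.
apply: theta_gt0 => h; have [_] := witnessP v; rewrite -h mdistxx mulr0.
by rewrite leNgt rad0.
Qed.

(** Both points are compared with the center, whose distance to the witness is at least [rad v / P].
    This lemma and the next two are what ties [vsize] to [theta] in the construction of the converse
    weight. *)
Lemma vsize_up L : 0 <= L -> exists2 H, 1 <= H & forall v x y,
  d (ctr v) x <= L * rad v -> d (ctr v) y <= L * rad v ->
  theta x y <= H * vsize v.
Proof.
move=> L0; have LP0 : 0 <= L * P by rewrite mulr_ge0//; move: P_ge1; lra.
have [H H1 HP] := theta_qs LP0.
exists (2 * H) => [|v x y hx hy]; first by lra.
have h z : d (ctr v) z <= L * rad v -> theta z (ctr v) <= H * vsize v.
  move=> hz; rewrite /vsize (dist_sym theta (ctr v)); apply: HP.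
  rewrite (metric_sym z) (metric_sym (witness v)) -mulrA.
  by apply: (le_trans hz); rewrite ler_wpM2l//; case: (witnessP v).
apply: (le_trans (dist_triangle theta (ctr v) x y)).
rewrite (dist_sym theta (ctr v) y) -mulrA mulr_natl mulr2n.
by apply: lerD; exact: h.
Qed.

Lemma vsize_low L : 0 <= L -> exists2 H, 1 <= H & forall v x y,
  d (ctr v) x <= L * d x y -> rad v <= L * d x y -> vsize v <= H * theta x y.
Proof.
move=> L0; have L20 : 0 <= 2 * L by lra.
have [H H1 HP] := theta_qs L20.
exists (2 * H) => [|v x y hx hv]; first by lra.
have [hw _] := witnessP v.
apply: (le_trans (dist_triangle theta x _ _)).
rewrite (dist_sym theta x (witness v)) (dist_sym theta x y).
rewrite -mulrA mulr_natl mulr2n.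
have Ld0 : 0 <= L * d x y by rewrite mulr_ge0 ?mdist_ge0.
apply: lerD; apply: HP; rewrite (metric_sym y) -mulrA; first by lra.
have := metric_triangle (witness v) (ctr v) x.
by rewrite (metric_sym (witness v) (ctr v)); lra.
Qed.

Lemma vsize_comp L : 0 <= L -> exists2 H, 1 <= H & forall u v,
  d (ctr u) (ctr v) <= L * rad v -> rad u <= L * rad v -> vsize u <= H * vsize v.
Proof.
move=> L0; have L20 : 0 <= 2 * L by lra.
have [H H1 HP] := vsize_up L20; exists H => // u v h1 h2.
have [hw _] := witnessP u.
have Lr : 0 <= L * rad v by rewrite mulr_ge0// ltW.
apply: HP; first by rewrite metric_sym; lra.
have := metric_triangle (ctr v) (ctr u) (witness u).
by rewrite (metric_sym (ctr v) (ctr u)); lra.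
Qed.

Variables (q C : R).
Hypotheses (q_gt0 : 0 < q) (C_gt0 : 0 < C).
Hypotheses (pack : packing_bound theta q C) (cov : covering_bound theta q C).

(** Centers of one level are separated, so theta-balls about them with radii a fixed fraction of
    their sizes are disjoint. With n free the lemma bounds both sums over descendants and numbers of
    neighbours. *)
Lemma vsize_packing L : 0 <= L -> exists2 K, 1 <= K & forall v n
    (Q : pred (level S n)), (tag v <= n)%N ->
  (forall u : level S n, Q u -> d (ctr v) (ctr (vtx u)) <= L * rad v) ->
  \sum_(u | Q u) vsize (vtx u) `^ q <= K * vsize v `^ q.
Proof.
move=> L0.
have [H1 H11 lowP] := vsize_low (ltW kappa_gt0).
have [H2 H21 upP] := vsize_up L0.
have L10 : 0 <= L + 1 by lra.
have [H3 H31 compP] := vsize_comp L10.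
(* A size is at most [H1] times the theta-distance of two centers, so radii size/(2 [H1]) give
   disjoint balls. In [e], [H2] bounds the displacement of a center from [ctr v] and [H3] the radius
   of its ball. *)
pose c := 2 * H1; have c0 : 0 < c by rewrite /c; lra.
pose e := H2 + H3; have e0 : 0 < e by rewrite /e; lra.
have cq := powR_gt0 q c0; have eq0 := powR_gt0 q e0.
exists (1 + c `^ q * (C * e `^ q)) => [|v n Q vn QP].
  by rewrite lerDl !mulr_ge0// ltW.
have sv0 := vsize_gt0 v; have svq := powR_gt0 q sv0.
have ruv (u : level S n) : rad (vtx u) <= rad v by exact: (ler_rad kappa_ge1 a_ge).
have suv (u : level S n) : Q u -> vsize (vtx u) <= H3 * vsize v.
  move=> Qu; apply: compP.
    rewrite metric_sym; apply: (le_trans (QP u Qu)).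
    by rewrite ler_pM2r//; lra.
  apply: (le_trans (ruv u)); rewrite -[leLHS]mul1r ler_pM2r//; lra.
have h : \sum_(u | Q u) (vsize (vtx u) / c) `^ q <= C * (e * vsize v) `^ q.
  apply: (pack (c := fun b => ctr (vtx b)) (x := ctr v)).
  - exact: mulr_gt0.
  - move=> u Qu; split; first by rewrite divr_gt0// vsize_gt0.
    exists (ctr (vtx u)), (witness (vtx u)).
    rewrite ler_pdivrMr// ler_peMr ?theta_ge0//; rewrite /c; lra.
  - move=> u1 u2 z _ _ h1 h2; apply: contrapT => u12.
    have ne : vtx u1 <> vtx u2 by move=> /vtx_inj.
    have t12 : tag (vtx u1) = tag (vtx u2) by [].
    have sep := ctr_sep kappa_ge1 a_ge t12 ne.
    have r12 : rad (vtx u1) = rad (vtx u2) by [].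
    have h3 : rad (vtx u1) <= kappa * d (ctr (vtx u1)) (ctr (vtx u2)).
      by rewrite r12 -ler_pdivrMl.
    have l1 : vsize (vtx u1) <= H1 * theta (ctr (vtx u1)) (ctr (vtx u2)).
      by apply: lowP => //; rewrite mdistxx mulr_ge0 ?mdist_ge0// ltW.
    have l2 : vsize (vtx u2) <= H1 * theta (ctr (vtx u1)) (ctr (vtx u2)).
      rewrite dist_sym; apply: lowP; last by rewrite -r12 metric_sym.
      by rewrite mdistxx mulr_ge0 ?mdist_ge0// ltW.
    have := dist_triangle theta z (ctr (vtx u1)) (ctr (vtx u2)).
    rewrite (dist_sym theta z) leNgt => /negP; apply.
    apply: lt_le_trans (ltrD h1 h2) _.
    by rewrite -mulrDl ler_pdivrMr// /c; lra.
  - move=> u z Qu h1.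
    apply: le_lt_trans (dist_triangle theta (ctr (vtx u)) _ _) _.
    rewrite /e mulrDl; apply: ler_ltD.
      apply: upP; last exact: QP.
      by rewrite mdistxx mulr_ge0// ltW.
    apply: lt_le_trans h1 _; apply: le_trans (suv u Qu).
    rewrite ler_pdivrMr// ler_peMr ?(ltW (vsize_gt0 _))//; rewrite /c; lra.
apply: (@le_trans _ _ (c `^ q * (C * e `^ q) * vsize v `^ q)); last first.
  by rewrite ler_pM2r// lerDr.
rewrite -!mulrA -powRM// ?(ltW e0) ?(ltW sv0)//.
apply: (@le_trans _ _ (c `^ q * \sum_(u | Q u) (vsize (vtx u) / c) `^ q)).
  rewrite mulr_sumr; apply: ler_sum => u _.
  rewrite -powRM ?(ltW c0) ?divr_ge0 ?(ltW (vsize_gt0 _)) ?(ltW c0)//.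
  by rewrite mulrC mulfVK// gt_eqF.
by rewrite ler_pM2l.
Qed.

(** Nearby cells of one level have comparable sizes, so a bound on the sum of sizes to the power q
    is a bound on their number. *)
Lemma neighbor_count L : 0 <= L -> exists2 N, 1 <= N & forall v n
    (Q : pred (level S n)), tag v = n ->
  (forall u : level S n, Q u -> d (ctr v) (ctr (vtx u)) <= L * rad v) ->
  \sum_(u | Q u) 1 <= N :> R.
Proof.
move=> L0; have [K K1 KP] := vsize_packing L0.
have L10 : 0 <= L + 1 by lra.
have [H H1 HP] := vsize_comp L10.
have H0 : 0 < H by lra.
have Hq := powR_gt0 q H0.
exists (1 + H `^ q * K) => [|v n Q vn QP]; first by rewrite lerDl mulr_ge0//; lra.
have svq := powR_gt0 q (vsize_gt0 v).
rewrite -(ler_pM2r svq) mulr_suml.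
apply: (@le_trans _ _ (\sum_(u | Q u) H `^ q * vsize (vtx u) `^ q)).
  apply: ler_sum => u Qu; rewrite mul1r -powRM ?(ltW H0) ?(ltW (vsize_gt0 _))//.
  apply: ge0_ler_powR; rewrite ?nnegrE ?(ltW q_gt0)//.
  - by rewrite ltW// vsize_gt0.
  - by rewrite ltW// mulr_gt0// vsize_gt0.
  have ruv : rad (vtx u) = rad v by rewrite /rad vn.
  apply: HP; rewrite ruv; last by rewrite -[leLHS]mul1r ler_pM2r//; lra.
  by apply: (le_trans (QP u Qu)); rewrite ler_pM2r//; lra.
rewrite -mulr_sumr mulrDl -mulrA.
apply: (@le_trans _ _ (H `^ q * (K * vsize v `^ q))); last by rewrite lerDr mul1r ltW.
by rewrite ler_pM2l//; apply: KP => //; rewrite vn.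
Qed.

(** The theta-ball of radius [vsize B / H1] lies in the d-ball of radius rad B / (3 kappa), where
    [anc_near] makes every cell of level n a descendant of [B]; these cells therefore cover it. *)
Lemma vsize_covering : exists2 K, 1 <= K & forall B n, (tag B < n)%N ->
  vsize B `^ q <= K * dsum (fun v => vsize v `^ q) n B.
Proof.
have k3 : 0 < 3 * kappa by rewrite mulr_gt0.
have [H1 H11 lowP] := vsize_low (ltW k3).
have [H2 H21 upP] := vsize_up (ltW kappa_gt0).
have c0 : 0 < H1 by lra.
pose e := 2 * H2; have e0 : 0 < e by rewrite /e; lra.
have cq := powR_gt0 q c0; have eq0 := powR_gt0 q e0.
exists (1 + H1 `^ q * (C * e `^ q)) => [|B n Bn].
  by rewrite lerDl !mulr_ge0// ltW.
have sB0 := vsize_gt0 B.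
have h : (vsize B / H1) `^ q <= C * \sum_(u : level S n |
    anc (n - tag B) (vtx u) == B) (e * vsize (vtx u)) `^ q.
  apply: (cov (c := fun b => ctr (vtx b)) (x := ctr B)).
  - exact: divr_gt0.
  - exists (ctr B), (witness B); rewrite ler_pdivrMr// ler_peMr ?theta_ge0//.
  - by move=> u _; rewrite mulr_gt0// vsize_gt0.
  - move=> z hz.
    have zB : d z (ctr B) < rad B / (3 * kappa).
      rewrite ltNge; apply/negP; rewrite ler_pdivrMr// mulrC metric_sym => h.
      have := lowP B (ctr B) z; rewrite mdistxx mulr_ge0 ?mdist_ge0 ?(ltW k3)//.
      by move=> /(_ isT h); rewrite leNgt mulrC -ltr_pdivlMr// hz.
    have [v [tv zv]] := cover_ball S n z.
    have := anc_near kappa_ge1 a_ge _ zv zB; rewrite tv => /(_ Bn) vB.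
    have [u uv] := vtx_lev tv; exists u; first by rewrite uv vB.
    rewrite uv.
    have := upP v (ctr v) z; rewrite mdistxx mulr_ge0 ?(ltW kappa_gt0) ?(ltW (rad0 v))//.
    rewrite (metric_sym _ z) => /(_ isT (ltW zv)) h; apply: le_lt_trans h _.
    by rewrite ltr_pM2r ?vsize_gt0// /e; lra.
rewrite mulrDl mul1r -!mulrA.
have ds0 : 0 <= dsum (fun v => vsize v `^ q) n B.
  by apply: dsum_ge0 => v; exact: powR_ge0.
apply: (@le_trans _ _ (H1 `^ q * (C * (e `^ q * dsum (fun v => vsize v `^ q) n B))));
  last by rewrite lerDr.
rewrite -[vsize B](@mulfVK _ H1) ?gt_eqF// [_ * H1]mulrC powRM ?(ltW c0)//; last first.
  by rewrite divr_ge0// ltW.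
rewrite ler_pM2l// /dsum mulr_sumr; apply: (le_trans h); rewrite ler_pM2l//.
by apply: ler_sum => u _; rewrite powRM// ltW// vsize_gt0.
Qed.

End Size.

(** * Power distortions *)

Section Distortion.
Variable R : realType.
Implicit Types f g : R -> R.

(** A monotone function can only jump, and surjectivity forbids jumps: preimages of f x + e/2 and f
    x - e/2 bound a neighbourhood of x. If f x < e, positivity replaces the second one. *)
Lemma incr_onto_continuous f :
  {in `[0, +oo[ &, {homo f : s t / s < t}} ->
  (forall s, 0 <= s -> 0 <= f s) ->
  (forall w, 0 <= w -> exists2 s, 0 <= s & f s = w) ->
  {within `[0, +oo[, continuous f}.
Proof.
move=> mono f0 onto.
have lt s t : 0 <= s -> 0 <= t -> f s < f t -> s < t.
  move=> s0 t0; apply: contraTT; rewrite -!leNgt le_eqVlt => /predU1P[->//|ts].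
  by apply/ltW/mono => //; rewrite in_itv /= andbT.
have mono' s t : 0 <= s -> 0 <= t -> s < t -> f s < f t.
  by move=> s0 t0; apply: mono; rewrite in_itv /= andbT.
apply/subspace_continuousP => x; rewrite /= in_itv /= andbT => x0.
apply/cvgrPdist_lt => e e0; rewrite near_withinE.
have fx0 := f0 _ x0.
have [|x1 x10 fx1] := onto (f x + e / 2); first by rewrite addr_ge0// divr_ge0// ltW.
have xx1 : x < x1 by apply: lt => //; rewrite fx1 ltrDl divr_gt0.
have [d [d0 hd]] : exists d, 0 < d /\ forall z, 0 <= z -> x - d < z -> f x - e < f z.
  have [h|h] := ltP (f x) e.
    exists 1; split=> // z z0 _; apply: lt_le_trans (f0 _ z0).
    by rewrite subr_lt0.
  have [|x2 x20 fx2] := onto (f x - e / 2); first by rewrite subr_ge0; lra.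
  exists (x - x2); split.
    by rewrite subr_gt0; apply: lt => //; rewrite fx2 gtrBl divr_gt0.
  move=> z z0; rewrite subKr => /(mono' _ _ x20 z0); rewrite fx2; lra.
apply/nbhs_ballP; exists (Num.min d (x1 - x)).
  by rewrite /= lt_min d0 subr_gt0.
move=> z; rewrite /ball /= lt_min => /andP[]; rewrite !ltr_norml.
move=> /andP[h1 h2] /andP[h3 h4]; rewrite in_itv /= andbT => z0.
have {}h1 : - d < x - z :> R := h1.
have {}h3 : - (x1 - x) < x - z :> R := h3.
have {}h2 : x - z < d :> R := h2.
have a1 : f z < f x1.
  by apply: mono' => //; move: h3; rewrite opprB ltrD2l ltrN2.
have a2 : f x - e < f z.
  by apply: hd => //; move: h2; rewrite !ltrBlDr addrC.
rewrite fx1 in a1; apply/andP; split; last by rewrite ltrBlDr -ltrBlDl.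
rewrite ltrBrDl -ltrBrDr opprK; apply: lt_trans a1 _.
by rewrite ltrD2l ltr_pdivrMr// mulr_natr mulr2n ltrDl.
Qed.

Lemma incr_onto_distortion f :
  {in `[0, +oo[ &, {homo f : s t / s < t}} ->
  (forall s, 0 <= s -> 0 <= f s) ->
  (forall w, 0 <= w -> exists2 s, 0 <= s & f s = w) ->
  distortion f.
Proof.
move=> mono f0 onto.
have lt s t : 0 <= s -> 0 <= t -> f s < f t -> s < t.
  move=> s0 t0; apply: contraTT; rewrite -!leNgt le_eqVlt => /predU1P[->//|ts].
  by apply/ltW/mono => //; rewrite in_itv /= andbT.
have inj s t : 0 <= s -> 0 <= t -> f s = f t -> s = t.
  move=> s0 t0 fst; apply/eqP; case: (ltgtP s t) => // h;
  have := mono _ _ _ _ h; rewrite !in_itv /= !andbT fst ltxx => h2;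
  by have := h2 ltac:(done) ltac:(done).
split=> //.
- split.
  + by move=> s; rewrite /= !in_itv /= !andbT; exact: f0.
  + by move=> s t; rewrite !inE /= !in_itv /= !andbT; exact: inj.
  + move=> w; rewrite /= in_itv /= andbT => /onto[s s0 fs].
    by exists s => //; rewrite /= in_itv /= andbT.
- exact: incr_onto_continuous.
have gex w : exists s, 0 <= w -> 0 <= s /\ f s = w.
  have [w0|w0] := leP 0 w; last by exists 0 => //; rewrite leNgt w0.
  by have [s s0 fs] := onto w w0; exists s.
pose g w := projT1 (cid (gex w)).
have gP w : 0 <= w -> 0 <= g w /\ f (g w) = w by exact: projT2 (cid (gex w)).
have gf s : 0 <= s -> g (f s) = s.
  by move=> s0; have [h1 h2] := gP _ (f0 _ s0); exact: inj.
exists g.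
  apply: incr_onto_continuous.
  - move=> s t; rewrite !in_itv /= !andbT => s0 t0 st.
    have [h1 h2] := gP _ s0; have [h3 h4] := gP _ t0.
    by apply: lt => //; rewrite h2 h4.
  - by move=> s /gP[].
  - by move=> s s0; exists (f s); [exact: f0|exact: gf].
by move=> s; rewrite in_itv /= andbT; exact: gf.
Qed.

(** The smaller exponent [b1] governs when c s is at most 1, the larger [b2] when it is at least
    1. *)
Definition power_gauge (c C b1 b2 s : R) : R :=
  C * Num.max ((c * s) `^ b1) ((c * s) `^ b2).

Lemma power_gauge_distortion (c C b1 b2 : R) :
  0 < c -> 0 < C -> 0 < b1 -> b1 <= b2 -> distortion (power_gauge c C b1 b2).
Proof.
move=> c0 C0 b10 b12; have b20 := lt_le_trans b10 b12.
apply: incr_onto_distortion.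
- move=> s t; rewrite !in_itv /= !andbT => s0 t0 st.
  have cs0 : 0 <= c * s by rewrite mulr_ge0// ltW.
  have ct0 : 0 <= c * t by rewrite mulr_ge0// ltW.
  have lt b : 0 < b -> (c * s) `^ b < (c * t) `^ b.
    by move=> b0; apply: gt0_ltr_powR; rewrite ?nnegrE// ltr_pM2l.
  by rewrite /power_gauge ltr_pM2l// gt_max !lt_max !lt// orbT.
- by move=> s s0; rewrite mulr_ge0 ?(ltW C0)// le_max powR_ge0.
move=> w w0.
suff [u u0 uw] : exists2 u, 0 <= u & Num.max (u `^ b1) (u `^ b2) = w / C.
  exists (c^-1 * u); first by rewrite mulr_ge0// invr_ge0 ltW.
  rewrite /power_gauge mulrA mulfV ?gt_eqF// mul1r uw mulrC mulfVK//.
  by rewrite gt_eqF.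
have {w0} : 0 <= w / C by rewrite divr_ge0// ltW.
move: {w}(w / C) => w w0.
have [->|wn0] := eqVneq w 0.
  by exists 0 => //; rewrite !powR0 ?gt_eqF// maxxx.
have {wn0}w0 : 0 < w by rewrite lt_def wn0.
have [w1|w1] := leP w 1.
  exists (w `^ b1^-1); first exact: powR_ge0.
  rewrite -!powRrM mulVf ?gt_eqF// powRr1 ?(ltW w0)//.
  by apply: max_l; apply: ge1r_powR; rewrite ?w0//= mulrC ler_pdivlMr// mul1r.
exists (w `^ b2^-1); first exact: powR_ge0.
rewrite -!powRrM mulVf ?gt_eqF// powRr1 ?(ltW w0)//.
by apply: max_r; apply: ler1_powR; rewrite ?(ltW w1)//= mulrC ler_pdivrMr// mul1r.
Qed.

Lemma power_gauge0 (c C b1 b2 : R) : 0 < b1 -> b1 <= b2 ->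
  power_gauge c C b1 b2 0 = 0.
Proof.
move=> b10 b12; have b20 := lt_le_trans b10 b12.
by rewrite /power_gauge mulr0 !powR0 ?gt_eqF// maxxx mulr0.
Qed.

Lemma exponentP (a r : R) : 1 < a -> 0 < r ->
  forall k, (a ^- k) `^ (ln r^-1 / ln a) = r ^+ k.
Proof.
move=> a1 r0 k.
have a0 : 0 < a by apply: lt_trans a1.
have la : 0 < ln a by rewrite ln_gt0.
rewrite -exprVn -(@powR_mulrn _ a^-1 k) ?invr_ge0 ?(ltW a0)// powRAC.
rewrite powR_mulrn ?powR_ge0//; congr (_ ^+ k).
rewrite /powR invr_eq0 gt_eqF// lnV// lnV// mulrN !mulNr opprK.
by rewrite divfK ?gt_eqF// lnK.
Qed.

Lemma exponent_gt0 (a r : R) : 1 < a -> 0 < r < 1 -> 0 < ln r^-1 / ln a.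
Proof.
by move=> a1 /andP[r0 r1]; rewrite divr_gt0// ln_gt0// invf_gt1.
Qed.

Lemma exponent_le (a r s : R) : 1 < a -> 0 < r -> r <= s ->
  ln s^-1 / ln a <= ln r^-1 / ln a.
Proof.
move=> a1 r0 rs; have s0 := lt_le_trans r0 rs.
rewrite ler_pM2r ?invr_gt0 ?ln_gt0// ler_ln ?posrE ?invr_gt0//.
by rewrite lef_pV2.
Qed.

End Distortion.

(** * The distance of a weight *)

Lemma expr_small (R : realType) (r e : R) : 0 < r < 1 -> 0 < e -> exists N,
  forall n, (N <= n)%N -> r ^+ n < e.
Proof.
move=> /andP[r0 r1] e0.
have h : (fun n => r ^+ n) @ \oo --> (0 : R).
  by apply: cvg_expr; rewrite gtr0_norm.
have /cvgrPdist_lt /(_ _ e0) [N _ hN] := h.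
exists N => n /hN /=; rewrite sub0r normrN gtr0_norm// exprn_gt0//.
Qed.

Section Weight.
Variables (R : realType) (X : pointedMetricType R) (kappa a lambda : R).
Variable S : covering_data X kappa a.
Hypotheses (kappa_ge1 : 1 <= kappa) (lambda_ge32 : 32 <= lambda).
Hypothesis a_large : 6 * kappa ^+ 2 * lambda <= a.
Variable rho : vertex S -> R.
Variables (eta_m eta_p K0 : R).
Hypotheses (rho_H1 : H1 rho eta_m eta_p) (rho_H2 : H2 lambda rho K0).
Local Notation d := (@mdist R X).
Local Notation vertex := (vertex S).
Local Notation pi := (weight rho).
Implicit Types (u v B : vertex).

Lemma a_ge_of_large : 192 * kappa ^+ 2 <= a.
Proof. by move: kappa_ge1 lambda_ge32 a_large; rewrite expr2; nra. Qed.
Let a_ge := a_ge_of_large.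

Let kappa_gt0 : 0 < kappa. Proof. exact: lt_le_trans ltr01 kappa_ge1. Qed.
Let rad0 v : 0 < rad v. Proof. exact: rad_gt0 kappa_ge1 a_ge v. Qed.
Let eta_m0 : 0 < eta_m. Proof. by case: rho_H1. Qed.
Let eta_p1 : eta_p < 1. Proof. by case: rho_H1. Qed.
Let eta_mp : eta_m <= eta_p. Proof. by case: rho_H1. Qed.
Let eta_p0 : 0 < eta_p. Proof. exact: lt_le_trans eta_m0 eta_mp. Qed.
Let K01 : 1 <= K0. Proof. by case: rho_H2. Qed.
Let K00 : 0 < K0. Proof. exact: lt_le_trans ltr01 K01. Qed.

Lemma weight_root v : tag v = 0%N -> pi v = rho v.
Proof. by move=> v0; rewrite /weight /geodesic v0 /= big_seq1. Qed.

Lemma weight_parent v : (0 < tag v)%N -> pi v = rho v * pi (parent_vertex v).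
Proof.
move=> v0; rewrite {1}/weight /geodesic trajectS big_cons; congr (_ * _).
by rewrite /weight /geodesic tag_parent prednK.
Qed.

Let rho_bnd v : eta_m <= rho v <= eta_p. Proof. by case: rho_H1. Qed.
Let rho_gt0 v : 0 < rho v.
Proof. by have /andP[h _] := rho_bnd v; exact: lt_le_trans h. Qed.

Lemma weight_gt0 v : 0 < pi v.
Proof. by rewrite /weight; elim/big_ind: _ => // x y; exact: mulr_gt0. Qed.

Lemma weight_parent_bnd v : (0 < tag v)%N ->
  eta_m * pi (parent_vertex v) <= pi v <= eta_p * pi (parent_vertex v).
Proof.
move=> v0; rewrite (weight_parent v0) !ler_pM2r ?weight_gt0//; exact: rho_bnd.
Qed.

Lemma weight_anc k v : (k <= tag v)%N ->
  eta_m ^+ k * pi (anc k v) <= pi v <= eta_p ^+ k * pi (anc k v).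
Proof.
elim: k => [|k IH] kv; first by rewrite !expr0 !mul1r lexx.
have /andP[h1 h2] := IH (ltnW kv).
have t : (0 < tag (anc k v))%N by rewrite tag_anc subn_gt0.
have /andP[h3 h4] := weight_parent_bnd t.
rewrite !exprSr -!mulrA ancS; apply/andP; split.
  by apply: le_trans h1; rewrite ler_pM2l// exprn_gt0.
by apply: (le_trans h2); rewrite ler_pM2l// exprn_gt0.
Qed.

(** The exponent counts the vertices of [[w, v]], root included. *)
Lemma weight_level v : eta_m ^+ (tag v).+1 <= pi v <= eta_p ^+ (tag v).+1.
Proof.
have /andP[h1 h2] := weight_anc (leqnn (tag v)).
have t0 : tag (anc (tag v) v) = 0%N by rewrite tag_anc subnn.
have /andP[h3 h4] := rho_bnd (anc (tag v) v).
rewrite (weight_root t0) in h1 h2; rewrite !exprSr; apply/andP; split.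
  by apply: le_trans h1; rewrite ler_pM2l// exprn_gt0.
by apply: (le_trans h2); rewrite ler_pM2l// exprn_gt0.
Qed.

Lemma weight_sim u v z : tag u = tag v ->
  d (ctr u) z < lambda * kappa * rad u -> d (ctr v) z < lambda * kappa * rad v ->
  pi u <= K0 * pi v.
Proof.
case: u v => n u [m v] /= nm; subst m => h1 h2.
case: rho_H2 => _; apply; exists z.
by split; rewrite /dilate ballEmdist.
Qed.

Lemma edge_sim u v z : tag u = tag v -> u <> v ->
  d (ctr u) z < lambda * kappa * rad u -> d (ctr v) z < lambda * kappa * rad v ->
  edge lambda u v.
Proof.
case: u v => n u [m v] /= nm; subst m => uv h1 h2.
apply: horizontal; first by move=> h; apply: uv; rewrite h.
by exists z; split; rewrite /dilate ballEmdist.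
Qed.

Lemma edge_parent v : (0 < tag v)%N -> edge lambda v (parent_vertex v).
Proof. by case: v => -[|n] v //= _; exact: vertical_up. Qed.

Lemma edge_sym u v : edge lambda u v -> edge lambda v u.
Proof.
case=> [n b c bc [z [z1 z2]]|n b|n b]; [|exact: vertical_down|exact: vertical_up].
by apply: horizontal => [h|]; [exact: bc|exists z].
Qed.

(** * Walks between vertices and path lengths between points *)

Local Notation edgeb := (fun u v => `[< edge lambda u v >]).

Definition walk u v (L : R) := exists s : seq vertex,
  [/\ path edgeb u s, last u s = v & path_length rho (u, s) = L].

Lemma walk_refl u : walk u u (pi u).
Proof. by exists [::]; rewrite /path_length big_seq1. Qed.

Lemma walk_rcons u v w L : walk u v L -> edge lambda v w -> walk u w (L + pi w).
Proof.
move=> [s [ps ls Ls]] vw; exists (rcons s w); split.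
- by rewrite rcons_path ps ls; apply/asboolP.
- by rewrite last_rcons.
- by rewrite -Ls /path_length /= -rcons_cons big_rcons.
Qed.

Lemma walk_rev u v L : walk u v L -> walk v u L.
Proof.
move=> [s [ps ls <-]]; elim: s u ps ls => [|w s IH] u /=.
  move=> _ <-; rewrite (_ : path_length _ _ = pi u); first exact: walk_refl.
  by rewrite /path_length big_seq1.
move=> /andP[/asboolP uw ps] ls; have := walk_rcons (IH w ps ls) (edge_sym uw).
by rewrite /path_length /= [X in _ -> walk _ _ X]big_cons addrC.
Qed.

Lemma walk_cat u v w L L' : walk u v L -> walk v w L' ->
  walk u w (L + L' - pi v).
Proof.
move=> [s [ps ls <-]] [s' [ps' ls' <-]]; exists (s ++ s'); split.
- by rewrite cat_path ps ls.
- by rewrite last_cat ls.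
- rewrite /path_length /= -cat_cons big_cat /= [in RHS](big_cons _ _ v).
  by rewrite addrCA [pi v + _]addrC addrK.
Qed.

(** Two distinct vertices are linked by a horizontal edge. The graph has no loops, so equal ones are
    merged, which only shortens the walk: hence an inequality. *)
Lemma walk_join u v v' w z L L' : walk u v L -> walk v' w L' -> tag v = tag v' ->
  d (ctr v) z < lambda * kappa * rad v -> d (ctr v') z < lambda * kappa * rad v' ->
  exists2 L'', L'' <= L + L' & walk u w L''.
Proof.
move=> w1 w2 tvv h1 h2; have [vv|/eqP vv] := eqVneq v v'.
  rewrite -vv in w2; exists (L + L' - pi v); last exact: walk_cat.
  by rewrite gerBl ltW// weight_gt0.
have w3 := walk_rcons w1 (edge_sim tvv vv h1 h2).
have := walk_cat w3 w2; rewrite addrAC addrK => w4.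
by exists (L + L').
Qed.

Lemma walk_anc k v : (k <= tag v)%N ->
  exists2 L, L <= pi (anc k v) / (1 - eta_p) & walk v (anc k v) L.
Proof.
have e1 : 0 < 1 - eta_p by rewrite subr_gt0.
elim: k => [_|k IH kv].
  exists (pi v); last exact: walk_refl.
  rewrite anc0 ler_pdivlMr// ler_piMr ?(ltW (weight_gt0 _))//.
  by move: eta_p0; lra.
have [L hL wL] := IH (ltnW kv).
have t : (0 < tag (anc k v))%N by rewrite tag_anc subn_gt0.
exists (L + pi (anc k.+1 v)); last exact: walk_rcons wL (edge_parent t).
have /andP[_ h] := weight_parent_bnd t; rewrite -ancS in h.
have -> : pi (anc k.+1 v) / (1 - eta_p) =
    eta_p * pi (anc k.+1 v) / (1 - eta_p) + pi (anc k.+1 v).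
  by field; rewrite gt_eqF.
rewrite lerD2r; apply: (le_trans hL).
by rewrite ler_pM2r// invr_gt0.
Qed.

(** The factor 2 exceeds 6/5 for the ancestral chain plus 1/5 for the radius of the cell around
    x. *)
Lemma cover_anc n m x : (m <= n)%N -> exists v,
  [/\ tag v = n, cell (tagged v) x &
      d (ctr (anc (n - m) v)) x < 2 * kappa * rad (anc (n - m) v)].
Proof.
move=> mn; have [v [tv vx]] := cover S n x; exists v; split=> //.
have xv := cell_ball vx.
have [->|] := eqVneq m n.
  rewrite subnn anc0 metric_sym; apply: lt_le_trans xv _.
  by rewrite ler_pM2r// ler_peMl// ?(ltW kappa_gt0)//; lra.
move=> nm; have ltmn : (m < n)%N by rewrite ltn_neqAle nm.
set u := anc _ _; have tu : tag u = m by rewrite tag_anc tv subKn.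
have h1 : d (ctr v) (ctr u) <= 6 / 5 * kappa * rad u.
  by apply: anc_dist => //; rewrite tv leq_subr.
have h2 : a * rad v <= rad u.
  rewrite /rad tu tv; case: n ltmn {mn nm tv u tu h1 v vx xv} => // n mn.
  by rewrite -(rnS kappa_ge1 a_ge); exact: (ler_rn kappa_ge1 a_ge).
have h3 : kappa * rad v <= 1 / 5 * kappa * rad u.
  have h4 : 192 * rad v <= rad u.
    by apply: le_trans h2; rewrite ler_pM2r//; exact: a_ge192 kappa_ge1 a_ge.
  have -> : 1 / 5 * kappa * rad u = kappa * (1 / 5 * rad u) by ring.
  by rewrite ler_pM2l//; have := rad0 v; lra.
have := metric_triangle (ctr u) (ctr v) x.
rewrite (metric_sym (ctr u) (ctr v)) (metric_sym (ctr v) x).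
have kr : 0 < kappa * rad u by rewrite mulr_gt0.
by move: h1 h3 xv; lra.
Qed.

Definition ell n (x y : X) : R :=
  inf [set path_length rho g | g in Gamma lambda n x y].

Lemma path_length_ge0 g : 0 <= path_length rho g.
Proof. by apply: sumr_ge0 => v _; exact: ltW (weight_gt0 v). Qed.

Lemma ell_lb n x y : has_lbound [set path_length rho g | g in Gamma lambda n x y].
Proof. by exists 0 => _ [g _ <-]; exact: path_length_ge0. Qed.

Lemma Gamma_walk n x y u v L : tag u = n -> tag v = n ->
  cell (tagged u) x -> cell (tagged v) y -> walk u v L ->
  [set path_length rho g | g in Gamma lambda n x y] L.
Proof.
case: u v => n1 b [n2 c] /= e1 e2; subst n1 n2 => bx cy [s [ps ls <-]].
by exists (existT _ n b, s) => //; split => //; exists b, c.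
Qed.

Lemma walk_Gamma n x y L : [set path_length rho g | g in Gamma lambda n x y] L ->
  exists u v, [/\ tag u = n, tag v = n, cell (tagged u) x, cell (tagged v) y &
    walk u v L].
Proof.
move=> [[g s] [/= ps [b [c [bx cy gb ls]]]] <-].
by exists (vtx b), (vtx c); split => //; exists s; rewrite -gb.
Qed.

Lemma ell_le n x y u v L : tag u = n -> tag v = n ->
  cell (tagged u) x -> cell (tagged v) y -> walk u v L -> ell n x y <= L.
Proof.
move=> tu tv ux vy w; apply: ge_inf; first exact: ell_lb.
exact: Gamma_walk w.
Qed.

Let C1 : R := 1 + 2 * K0 / (1 - eta_p).

(** The path climbs from a cell of x to the level of [B], passes through [B] and descends to y. [C1]
    counts [B] once and two vertical legs of cost at most K0 pi(B) / (1 - eta_p). *)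
Lemma ell_up n x y B alpha : alpha <= lambda -> 2 <= lambda -> (tag B <= n)%N ->
  dilate alpha B x -> dilate alpha B y -> ell n x y <= C1 * pi B.
Proof.
move=> al l2 Bn; rewrite /dilate !ballEmdist /= => Bx By.
have e1 : 0 < 1 - eta_p by rewrite subr_gt0.
have big z : d (ctr B) z < alpha * kappa * rad B -> d (ctr B) z < lambda * kappa * rad B.
  by move=> h; apply: (lt_le_trans h); rewrite -!mulrA ler_pM2r// mulr_gt0.
have half z : d (ctr B) z < alpha * kappa * rad B -> exists v, [/\ tag v = n,
    cell (tagged v) z & exists L, [/\ L <= K0 * pi B / (1 - eta_p),
    walk v (anc (n - tag B) v) L, tag (anc (n - tag B) v) = tag B &
    d (ctr (anc (n - tag B) v)) z < lambda * kappa * rad (anc (n - tag B) v)]].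
  move=> Bz; have [v [tv vz vBz]] := cover_anc z Bn.
  exists v; split=> //.
  have kv : (n - tag B <= tag v)%N by rewrite tv leq_subr.
  have [L hL w] := walk_anc kv.
  have tB : tag (anc (n - tag B) v) = tag B by rewrite tag_anc tv subKn.
  have near : d (ctr (anc (n - tag B) v)) z < lambda * kappa * rad (anc (n - tag B) v).
    by apply: (lt_le_trans vBz); rewrite -!mulrA ler_pM2r// mulr_gt0.
  exists L; split=> //; apply: (le_trans hL).
  by rewrite ler_pM2r ?invr_gt0//; exact: weight_sim tB near (big _ Bz).
have [u [tu ux [L [hL wL t1 n1]]]] := half x Bx.
have [v [tv vy [L' [hL' wL' t2 n2]]]] := half y By.
have [L1 hL1 w1] := walk_join wL (walk_refl B) t1 n1 (big _ Bx).
have [L2 hL2 w2] := walk_join w1 (walk_rev wL') (esym t2) (big _ By) n2.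
apply: le_trans (ell_le tu tv ux vy w2) _.
rewrite /C1 mulrDl mul1r.
have -> : 2 * K0 / (1 - eta_p) * pi B = K0 * pi B / (1 - eta_p) + K0 * pi B / (1 - eta_p).
  by field; rewrite gt_eqF.
lra.
Qed.

Lemma root_dilate alpha B x : 1 <= alpha -> tag B = 0%N -> dilate alpha B x.
Proof.
move=> al; case: B => n w /= n0; subst n; rewrite /dilate expr0 invr1 mulr1.
have : [set: X] x by [].
rewrite -(normalization w) !ballEmdist /= => h; apply: (lt_le_trans h).
by rewrite ler_peMl// ltW.
Qed.

Lemma Gamma_neq0 n x y : [set path_length rho g | g in Gamma lambda n x y] !=set0.
Proof.
have [u [tu ux hu]] := cover_anc x (leq0n n).
have [v [tv vy hv]] := cover_anc y (leq0n n).
have [|L hL wL] := @walk_anc n u; first by rewrite tu.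
have [|L' hL' wL'] := @walk_anc n v; first by rewrite tv.
have e : anc n v = anc n u by apply: root_unique; rewrite tag_anc ?tu ?tv subnn.
rewrite e in wL'; have w' := walk_cat wL (walk_rev wL').
by eexists; exact: Gamma_walk w'.
Qed.

Lemma ell_bounded x y : bounded_seq (fun n => ell n x y).
Proof.
have [w [w0 _]] := cover S 0 x.
apply: (@bounded_seq_ge0 _ _ (C1 * pi w)) => n; apply/andP; split; last first.
  apply: (@ell_up _ _ _ _ 1); rewrite ?w0//; [move: lambda_ge32; lra..| |];
  exact: root_dilate.
by apply: lb_le_inf => [|_ [g _ <-]]; [exact: Gamma_neq0|exact: path_length_ge0].
Qed.

Lemma ell_sym n x y : ell n x y = ell n y x.
Proof.
congr inf; apply/seteqP; split=> L /walk_Gamma[u [v [tu tv ux vy w]]];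
exact: Gamma_walk (walk_rev w).
Qed.

(** The last cell of one path and the first cell of the next both contain y and have level n, so
    [walk_join] links them without a new vertex. *)
Lemma ell_triangle n x y z : ell n x z <= ell n x y + ell n y z.
Proof.
apply/ler_addgt0Pl => e e0; have e2 : 0 < e / 2 by rewrite divr_gt0.
have hi x' y' : has_inf [set path_length rho g | g in Gamma lambda n x' y'].
  by split; [exact: Gamma_neq0|exact: ell_lb].
have [L /walk_Gamma[u [v [tu tv ux vy w]]] hL] := inf_adherent e2 (hi x y).
have [L' /walk_Gamma[u' [v' [tu' tv' ux' vy' w']]] hL'] := inf_adherent e2 (hi y z).
have near u0 : cell (tagged u0) y -> d (ctr u0) y < lambda * kappa * rad u0.
  move=> /cell_ball h; rewrite metric_sym; apply: (lt_le_trans h).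
  rewrite ler_pM2r// ler_peMl//; first exact: ltW.
  by move: lambda_ge32; lra.
have [|L'' hL'' w''] := walk_join w w' _ (near _ vy) (near _ ux').
  by rewrite tv tu'.
apply: le_trans (ell_le tu tv' ux vy' w'') _.
by rewrite -/(ell n x y) -/(ell n y z) in hL hL' *; lra.
Qed.

(** Lengths count vertices, so [ell n x x] is positive at each level; one cell of level n costs at
    most eta_p^(n+1), which vanishes in the limit. *)
Lemma ell_refl x : ulim (fun n => ell n x x) = 0.
Proof.
apply/eqP; rewrite eq_le; apply/andP; split; last first.
  rewrite -[leLHS](ulim_cst (0 : R)); apply: (@ler_ulim _ _ _ 0%N) => [||n _].
  - exact: bounded_seq_cst.
  - exact: ell_bounded.
  - apply: lb_le_inf; first exact: Gamma_neq0.
    by move=> _ [g _ <-]; exact: path_length_ge0.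
apply/ler_addgt0Pl => e e0; rewrite addr0.
have [|N hN] := @expr_small _ eta_p e _ e0; first by rewrite eta_p0.
rewrite -[leRHS](ulim_cst e); apply: (@ler_ulim _ _ _ N) => [||n Nn].
- exact: ell_bounded.
- exact: bounded_seq_cst.
have [u [tu ux]] := cover S n x.
apply: (le_trans (ell_le tu tu ux ux (walk_refl u))).
have /andP[_ h] := weight_level u; apply: (le_trans h); apply: ltW.
by apply: hN; rewrite tu leqW.
Qed.

(** * The scale of a pair of points and the limit distance *)

Variable alpha : R.
Hypotheses (alpha2 : 2 <= alpha) (alpha_le : alpha <= lambda / 4).
Let alpha_lambda : alpha <= lambda.
Proof. by move: alpha_le lambda_ge32; lra. Qed.

Lemma c_set_neq0 x y : x <> y -> c_set (S := S) alpha x y !=set0.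
Proof.
move=> xy; have d0 : 0 < d x y by rewrite mdist_gt0; apply/eqP.
pose good n := `[< exists v, [/\ tag v = n, dilate alpha v x & dilate alpha v y] >].
have [w [w0 _]] := cover S 0 x.
have good0 : exists n, good n.
  by exists 0%N; apply/asboolP; exists w; split=> //; apply: root_dilate => //;
  move: alpha2; lra.
have [N hN] : exists N, forall n, good n -> (n <= N)%N.
  have e0 : 0 < d x y / (2 * (alpha * kappa)).
    by rewrite divr_gt0// !mulr_gt0//; move: alpha2; lra.
  have [N hN] := rn_small kappa_ge1 a_ge e0; exists N => n /asboolP[v [vn]].
  rewrite /dilate !ballEmdist /= => vx vy; rewrite leqNgt; apply/negP => Nn.
  have h1 := metric_triangle x (ctr v) y; rewrite (metric_sym x (ctr v)) in h1.
  have h2 := ler_rn kappa_ge1 a_ge (ltnW Nn).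
  have ak : 0 < alpha * kappa by rewrite mulr_gt0//; move: alpha2; lra.
  have hN' : a ^- N * (2 * (alpha * kappa)) < d x y.
    by rewrite -ltr_pdivlMr// mulr_gt0.
  have h3 : alpha * kappa * a ^- tag v <= alpha * kappa * a ^- N.
    by rewrite vn ler_pM2l.
  by move: vx vy h1; rewrite -/(ctr v); lra.
have [m /asboolP[v [vm vx vy]] mmax] := ex_maxnP good0 hN.
exists v; split=> // v' v'x v'y; rewrite vm; apply: mmax.
by apply/asboolP; exists v'.
Qed.

Lemma dilate_lambda v x : dilate alpha v x -> d (ctr v) x < lambda * kappa * rad v.
Proof.
rewrite /dilate ballEmdist /= -/(ctr v) -/(rad v) => h; apply: (lt_le_trans h).
by rewrite -!mulrA ler_pM2r// mulr_gt0.
Qed.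

(** Members of [c_set] have the same level and dilates meeting at x, so by (H2) any one of them may
    stand for the maximum. *)
Lemma c_set_weight x y B : c_set alpha x y B ->
  pi B <= weight_c rho alpha x y <= K0 * pi B.
Proof.
move=> cB; have ub v : c_set alpha x y v -> pi v <= K0 * pi B.
  case: cB => Bx By Bm [vx vy vm].
  have tvB : tag v = tag B by apply/eqP; rewrite eqn_leq Bm ?vm.
  exact: (weight_sim tvB (dilate_lambda vx) (dilate_lambda Bx)).
apply/andP; split.
  by apply: ub_le_sup; [exists (K0 * pi B) => _ [v /ub ? <-]|exists B].
by apply: ge_sup; [exists (pi B), B|move=> _ [v /ub ? <-]].
Qed.

(** Were d x y less than kappa times the next radius, the dilate of a next-level cell around x would
    contain y, as alpha is at least 2; this contradicts maximality of the level. *)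
Lemma c_set_dist x y B : c_set alpha x y B ->
  kappa * rad B <= a * d x y /\ d x y < 2 * (alpha * kappa * rad B).
Proof.
move=> [Bx By Bm]; split; last first.
  move: Bx By; rewrite /dilate !ballEmdist /= => Bx By.
  have := metric_triangle x (ctr B) y; rewrite (metric_sym x (ctr B)).
  by rewrite mulr_natl mulr2n => h; apply: le_lt_trans h _; exact: ltrD.
have [v [tv xv]] := cover_ball S (tag B).+1 x.
have rB : rad B = a * rad v by rewrite /rad tv -(rnS kappa_ge1 a_ge).
have a0 := a_gt0 kappa_ge1 a_ge.
rewrite rB mulrCA ler_pM2l// leNgt; apply/negP => h.
have kr : 0 < kappa * rad v by rewrite mulr_gt0.
have kar : 2 * (kappa * rad v) <= alpha * kappa * rad v.
  by rewrite -mulrA ler_pM2r.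
have : (tag v <= tag B)%N.
  apply: Bm; rewrite /dilate ballEmdist /= -/(rad v) -/(ctr v).
    by rewrite metric_sym; lra.
  have := metric_triangle (ctr v) x y; rewrite (metric_sym (ctr v) x); lra.
by rewrite tv ltnn.
Qed.

Variable K1 : R.
Hypothesis rho_H3 : H3 lambda rho alpha K1.
Let K11 : 1 <= K1. Proof. by case: rho_H3. Qed.

Theorem path_distance : exists theta : distance R X,
  forall x y, x <> y ->
    K1^-1 * weight_c rho alpha x y <= theta x y <= C1 * weight_c rho alpha x y.
Proof.
pose th x y := ulim (fun n => ell n x y).
have C10 : 0 <= C1.
  rewrite /C1 addr_ge0// divr_ge0 ?mulr_ge0 ?(ltW K00)//.
  by rewrite subr_ge0 ltW.
have thP x y : x <> y -> K1^-1 * weight_c rho alpha x y <= th x y <= C1 * weight_c rho alpha x y.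
  move=> xy; have [B cB] := c_set_neq0 xy; have /andP[h1 h2] := c_set_weight cB.
  case: (cB) => Bx By _; apply/andP; split.
    rewrite -[leLHS]ulim_cst; case: rho_H3 => _ _ _ /(_ x y xy)[n0 _ h].
    apply: (@ler_ulim _ _ _ n0) => [||n n0n].
    - exact: bounded_seq_cst.
    - exact: ell_bounded.
    - apply: lb_le_inf; first exact: Gamma_neq0.
      by move=> _ [g gG <-]; exact: h n0n gG.
  apply: le_trans (_ : C1 * pi B <= _); last by rewrite ler_wpM2l.
  rewrite -[leRHS]ulim_cst.
  apply: (@ler_ulim _ _ _ (tag B)) => [||n nB].
  - exact: ell_bounded.
  - exact: bounded_seq_cst.
  - by apply: (ell_up alpha_lambda) => //; move: lambda_ge32; lra.
have th0 x : th x x = 0 by exact: ell_refl.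
have thpos x y : th x y = 0 -> x = y.
  move=> h; apply: contrapT => xy; have /andP[] := thP x y xy.
  rewrite h => h1 _; have [B cB] := c_set_neq0 xy; have /andP[h2 _] := c_set_weight cB.
  move: h1; rewrite leNgt mulr_gt0//; last exact: lt_le_trans (weight_gt0 B) h2.
  by rewrite invr_gt0 (lt_le_trans ltr01 K11).
have thsym x y : th x y = th y x.
  by rewrite /th; congr ulim; apply/funext => n; exact: ell_sym.
have thtri y x z : th x z <= th x y + th y z.
  rewrite -ulimD; try exact: ell_bounded.
  apply: (@ler_ulim _ _ _ 0%N) => [||n _]; last exact: ell_triangle.
    exact: ell_bounded.
  by apply: bounded_seqD; exact: ell_bounded.
by exists (Distance th0 thpos thsym thtri).
Qed.

Lemma anc_dilate k v z : (k <= tag v)%N -> dilate alpha v z ->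
  d (ctr (anc k v)) z < lambda * kappa * rad (anc k v).
Proof.
move=> kv; rewrite /dilate ballEmdist /= -/(ctr v) -/(rad v) => vz.
have h1 := anc_dist kappa_ge1 a_ge kv.
have h2 : rad v <= rad (anc k v).
  by apply: ler_rad => //; rewrite tag_anc leq_subr.
have h3 : alpha * kappa * rad v <= alpha * kappa * rad (anc k v).
  by rewrite ler_pM2l// mulr_gt0//; move: alpha2; lra.
have h4 := metric_triangle (ctr (anc k v)) (ctr v) z.
rewrite (metric_sym _ (ctr v)) in h4.
have h5 : (6 / 5 + alpha) * (kappa * rad (anc k v)) <= lambda * (kappa * rad (anc k v)).
  by rewrite ler_pM2r ?mulr_gt0//; move: alpha_le lambda_ge32; lra.
by move: h1 h3 h4 h5 vz; rewrite mulrDl !mulrA; lra.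
Qed.

(** The ancestor of v at the level of u has a lambda-dilate containing z: (H2) compares it with u,
    and (H1) handles the vertical part. *)
Lemma weight_compare u v z : dilate alpha u z -> dilate alpha v z ->
  (tag u <= tag v)%N ->
  pi v <= K0 * eta_p ^+ (tag v - tag u) * pi u /\
  eta_m ^+ (tag v - tag u) * pi u <= K0 * pi v.
Proof.
move=> uz vz uv; set k := (tag v - tag u)%N.
have kv : (k <= tag v)%N by rewrite leq_subr.
have vz' := anc_dilate kv vz; have uz' := dilate_lambda uz.
have tk : tag (anc k v) = tag u by rewrite tag_anc subKn.
have /andP[h1 h2] := weight_anc kv; split.
  apply: (le_trans h2); rewrite -mulrA mulrCA ler_pM2l ?exprn_gt0//.
  exact: weight_sim tk vz' uz'.
apply: (@le_trans _ _ (eta_m ^+ k * (K0 * pi (anc k v)))).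
  by rewrite ler_pM2l ?exprn_gt0//; exact: weight_sim (esym tk) uz' vz'.
by rewrite mulrCA ler_pM2l.
Qed.

(** * Topology and quasisymmetry of the limit distance *)

Variable theta : distance R X.
Hypothesis theta_c : forall x y, x <> y ->
  K1^-1 * weight_c rho alpha x y <= theta x y <= C1 * weight_c rho alpha x y.

Let C11 : 1 <= C1.
Proof.
rewrite lerDl divr_ge0 ?mulr_ge0 ?(ltW K00)//.
by rewrite subr_ge0 ltW.
Qed.
Let C10 : 0 < C1. Proof. exact: lt_le_trans ltr01 C11. Qed.
Let K10 : 0 < K1. Proof. exact: lt_le_trans ltr01 K11. Qed.
Let alpha0 : 0 < alpha. Proof. by apply: lt_le_trans alpha2. Qed.

Lemma theta_c_set x y B : x <> y -> c_set alpha x y B ->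
  K1^-1 * pi B <= theta x y <= C1 * K0 * pi B.
Proof.
move=> xy cB; have /andP[h1 h2] := theta_c xy.
have /andP[h3 h4] := c_set_weight cB; apply/andP; split.
  by apply: le_trans h1; rewrite ler_pM2l// invr_gt0.
by apply: (le_trans h2); rewrite -mulrA ler_pM2l.
Qed.

Lemma theta_small e : 0 < e -> exists2 dl, 0 < dl &
  forall x y, d x y < dl -> theta x y < e.
Proof.
move=> e0; have e1 : 0 < e / (C1 * K0) by rewrite divr_gt0// mulr_gt0.
have [|N hN] := @expr_small _ eta_p _ _ e1; first by rewrite eta_p0.
have a0 := a_gt0 kappa_ge1 a_ge.
exists (kappa * a ^- N / a).
  by rewrite divr_gt0// mulr_gt0//; exact: rn_gt0 kappa_ge1 a_ge N.
move=> x y hd; have [->|/eqP xy] := eqVneq x y; first by rewrite dist_xx.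
have [B cB] := c_set_neq0 xy; have [h1 _] := c_set_dist cB.
have /andP[_ h2] := theta_c_set xy cB; apply: (le_lt_trans h2).
rewrite mulrC -ltr_pdivlMr ?mulr_gt0//.
have /andP[_ h3] := weight_level B; apply: (le_lt_trans h3); apply: hN.
rewrite leqNgt; apply/negP => BN.
have h4 : a ^- N <= rad B by apply: (ler_rn kappa_ge1 a_ge); exact: ltnW (ltnW BN).
move: hd; rewrite ltr_pdivlMr// mulrC ltNge => /negP; apply.
by apply: le_trans h1; rewrite ler_pM2l.
Qed.

Lemma dist_small e : 0 < e -> exists2 dl, 0 < dl &
  forall x y, theta x y < dl -> d x y < e.
Proof.
move=> e0; have e1 : 0 < e / (2 * (alpha * kappa)) by rewrite divr_gt0// !mulr_gt0.
have [N hN] := rn_small kappa_ge1 a_ge e1.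
exists (K1^-1 * eta_m ^+ N.+1); first by rewrite mulr_gt0 ?invr_gt0 ?exprn_gt0.
move=> x y hd; have [->|/eqP xy] := eqVneq x y; first by rewrite mdistxx.
have [B cB] := c_set_neq0 xy; have [_ h1] := c_set_dist cB.
have /andP[h2 _] := theta_c_set xy cB; apply: (lt_trans h1).
have /andP[h3 _] := weight_level B.
have NB : (N < tag B)%N.
  rewrite ltnNge; apply/negP => BN; move: hd; rewrite ltNge => /negP; apply.
  apply: le_trans h2; rewrite ler_pM2l ?invr_gt0//; apply: le_trans h3.
  by apply: ler_wiXn2l; rewrite ?(ltW eta_m0) ?(le_trans eta_mp (ltW eta_p1)).
have h4 : rad B <= a ^- N by apply: (ler_rn kappa_ge1 a_ge); exact: ltnW.
rewrite mulrA mulrC -ltr_pdivlMr ?mulr_gt0//.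
by apply: le_lt_trans hN.
Qed.

Lemma theta_homeo : homeomorphism (id : X -> remetric theta).
Proof.
split.
  move=> x A /nbhs_ballP[e /= e0 eA]; have [dl dl0 hd] := theta_small e0.
  apply/nbhs_ballP; exists dl => // y; rewrite ballEmdist /= => xy.
  by apply: eA; rewrite ballEmdist; exact: hd.
exists id; split=> // x A /nbhs_ballP[e /= e0 eA]; have [dl dl0 hd] := dist_small e0.
apply/nbhs_ballP; exists dl => // y; rewrite ballEmdist /= => xy.
by apply: eA; rewrite ballEmdist; exact: hd.
Qed.

Let ba : 1 < a. Proof. by have := a_ge192 kappa_ge1 a_ge; lra. Qed.

(** The exponents convert a factor a of radius into a factor [eta_p] or [eta_m] of weight. The
    constant combines theta x z <= C1 K0 pi(B), pi(B') <= K1 theta y z and one factor K0 between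
    pi(B) and pi(B'). *)
Definition qs_gauge : R -> R := power_gauge (lambda * a) (K1 * (C1 * K0 ^+ 2))
  (ln eta_p^-1 / ln a) (ln eta_m^-1 / ln a).

Lemma theta_quasisymmetric :
  quasisymmetric qs_gauge (id : X -> remetric theta).
Proof.
have a0 : 0 < a by apply: lt_trans ba.
have l0 : 0 < lambda by apply: lt_le_trans lambda_ge32.
have bp0 : 0 < ln eta_p^-1 / ln a by apply: exponent_gt0 => //; rewrite eta_p0.
have bmp := exponent_le ba eta_m0 eta_mp.
have bm0 := lt_le_trans bp0 bmp.
have KC0 : 0 < K1 * (C1 * K0 ^+ 2) by rewrite !mulr_gt0// exprn_gt0.
split.
- by apply: power_gauge_distortion => //; exact: mulr_gt0.
- exact: theta_homeo.
move=> x y z yz; rewrite -[mdist _ _ / mdist _ _]/(theta x z / theta y z).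
have [->|/eqP xz] := eqVneq x z.
  by rewrite dist_xx mdistxx !mul0r /qs_gauge power_gauge0.
have [B cB] := c_set_neq0 xz; have [B' cB'] := c_set_neq0 yz.
have [h1 _] := c_set_dist cB; have [_ h2] := c_set_dist cB'.
have /andP[_ h3] := theta_c_set xz cB; have /andP[h4 _] := theta_c_set yz cB'.
have dyz : 0 < d y z by rewrite mdist_gt0; apply/eqP.
have tyz : 0 < theta y z by apply: theta_gt0.
set s := mdist x z / mdist y z; pose u := lambda * a * s.
(* Here 2 alpha <= lambda removes alpha from the gauge. *)
have hu : rad B <= u * rad B'.
  rewrite /u /s -(ler_pM2l kappa_gt0) mulrA.
  have -> : kappa * (lambda * a * (d x z / d y z)) * rad B' =
      (lambda * kappa * rad B') * (a * d x z) / d y z by ring.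
  rewrite ler_pdivlMr//.
  apply: (@le_trans _ _ (a * d x z * (2 * (alpha * kappa * rad B')))).
    by apply: ler_pM => //; rewrite ?mulr_ge0 ?mdist_ge0 ?(ltW kappa_gt0) ?(ltW (rad0 _)) ?ltW.
  rewrite mulrC ler_wpM2r ?mulr_ge0 ?mdist_ge0 ?(ltW a0)//.
  rewrite !mulrA ler_pM2r// ler_pM2r//; move: alpha_le lambda_ge32; lra.
case: cB => Bx Bz _; case: cB' => B'y B'z _.
have key g b : 0 < g -> pi B <= K0 * g * pi B' -> 0 < b -> g <= u `^ b ->
    u `^ b <= Num.max (u `^ (ln eta_p^-1 / ln a)) (u `^ (ln eta_m^-1 / ln a)) ->
    theta x z / theta y z <= qs_gauge s.
  move=> g0 h b0 gu ub; rewrite ler_pdivrMr//.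
  apply: (le_trans h3).
  apply: (@le_trans _ _ (K1 * (C1 * K0 ^+ 2) * g * (K1^-1 * pi B'))).
    have -> : K1 * (C1 * K0 ^+ 2) * g * (K1^-1 * pi B') = C1 * K0 * (K0 * g * pi B').
      by field; rewrite gt_eqF.
    by rewrite ler_pM2l// mulr_gt0.
  apply: ler_pM => //.
  - by rewrite mulr_ge0// ltW.
  - by rewrite mulr_ge0 ?invr_ge0 ?(ltW K10) ?(ltW (weight_gt0 _)).
  - by rewrite /qs_gauge /power_gauge ler_pM2l//; apply: (le_trans gu).
have u0 : 0 <= u.
  apply: mulr_ge0; first exact: mulr_ge0 (ltW l0) (ltW a0).
  by rewrite divr_ge0 ?mdist_ge0.
(* If [B] is at least as deep as [B'], weights shrink by [eta_p] or better per level; otherwise they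
   grow by at most 1/[eta_m] per level. *)
have [le|lt] := leqP (tag B') (tag B).
  have [h _] := weight_compare B'z Bz le.
  apply: (key (eta_p ^+ (tag B - tag B')) (ln eta_p^-1 / ln a)) => //.
  - by rewrite exprn_gt0.
  - rewrite -(exponentP ba eta_p0); apply: ge0_ler_powR; rewrite ?nnegrE ?(ltW bp0)//.
      by rewrite ltW// (rn_gt0 kappa_ge1 a_ge).
    have r' : 0 < rad B' := rad0 B'.
    rewrite -(ler_pM2r r') ; apply: le_trans hu.
    by rewrite /rad -invfM -exprD subnK.
  - by rewrite le_max lexx.
have [_ h] := weight_compare Bz B'z (ltnW lt).
pose k := (tag B' - tag B)%N.
have ek : 0 < eta_m ^+ k by rewrite exprn_gt0.
apply: (key (eta_m ^- k) (ln eta_m^-1 / ln a)) => //.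
- by rewrite invr_gt0.
- by rewrite mulrAC ler_pdivlMr// mulrC.
- have e : (a ^+ k) `^ (ln eta_m^-1 / ln a) * eta_m ^+ k = 1.
    rewrite -(exponentP ba eta_m0) -powRM ?exprn_ge0 ?invr_ge0 ?exprn_ge0 ?(ltW a0)//.
    by rewrite mulfV ?powR1// gt_eqF// exprn_gt0.
  rewrite -[leLHS]mul1r -e mulfK ?gt_eqF//.
  apply: ge0_ler_powR; rewrite ?nnegrE ?(ltW bm0) ?exprn_ge0 ?(ltW a0)//.
  rewrite -(ler_pM2r (rad0 B')); apply: le_trans hu.
  rewrite /rad -(subnK (ltnW lt)) -/k exprD invfM mulrA mulfV ?mul1r//.
  by rewrite gt_eqF// exprn_gt0.
- by rewrite le_max lexx orbT.
Qed.

(** * Ahlfors regularity of the limit distance *)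

Variables (p K2 : R).
Hypothesis rho_H4 : H4 rho p K2.
Hypothesis X_compact : compact [set: X].
Variable N : R.
Hypothesis neighbors : forall v n (Q : pred (level S n)), tag v = n ->
  (forall u : level S n, Q u -> d (ctr v) (ctr (vtx u)) <= 2 * lambda * kappa * rad v) ->
  \sum_(u | Q u) 1 <= N :> R.

Let p0 : 0 < p. Proof. by case: rho_H4. Qed.
Let K21 : 1 <= K2. Proof. by case: rho_H4. Qed.
Let K20 : 0 < K2. Proof. exact: lt_le_trans ltr01 K21. Qed.

Let near x n : exists v, tag v = n /\ d x (ctr v) < kappa * rad v.
Proof. exact: cover_ball. Qed.
Let b x n : vertex := projT1 (cid (near x n)).
Let tag_b x n : tag (b x n) = n.
Proof. by case: (projT2 (cid (near x n))). Qed.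
Let b_near x n : d x (ctr (b x n)) < kappa * rad (b x n).
Proof. by case: (projT2 (cid (near x n))). Qed.

Let b_dilate x n : dilate alpha (b x n) x.
Proof.
rewrite /dilate ballEmdist /= metric_sym -/(rad _); apply: (lt_le_trans (b_near x n)).
by rewrite ler_pM2r// ler_peMl ?(ltW kappa_gt0)//; move: alpha2; lra.
Qed.

Let b_step x n : eta_m * pi (b x n) <= K0 * pi (b x n.+1).
Proof.
have [|_] := weight_compare (b_dilate x n) (b_dilate x n.+1); first by rewrite !tag_b.
by rewrite !tag_b subSnn expr1.
Qed.

(* Realized by the first level at which the cell around x is lighter than s. *)
Let stop x s : 0 < s -> exists n, pi (b x n) < s /\
  (n = 0%N \/ eta_m * s <= K0 * pi (b x n)).
Proof.
move=> s0; have [|M hM] := @expr_small _ eta_p s _ s0; first by rewrite eta_p0.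
have ex : exists n, pi (b x n) < s.
  exists M; have /andP[_ h] := weight_level (b x M); apply: (le_lt_trans h).
  by apply: hM; rewrite tag_b.
have [n hn nmin] := ex_minnP ex; exists n; split=> //.
case: n hn nmin => [|n] hn nmin; [by left|right].
apply: le_trans (b_step x n); rewrite ler_pM2l// leNgt; apply/negP => h.
by have := nmin _ h; rewrite ltnn.
Qed.

Let Ct := C1 * K0.

Let Ct0 : 0 < Ct. Proof. exact: mulr_gt0. Qed.

Let theta_le x y : theta x y <= Ct.
Proof.
have [->|/eqP xy] := eqVneq x y; first by rewrite dist_xx ltW.
have [B cB] := c_set_neq0 xy; have /andP[_ h] := theta_c_set xy cB.
apply: (le_trans h); rewrite -/Ct ler_piMr ?(ltW Ct0)//.
have /andP[_ h'] := weight_level B; apply: (le_trans h').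
by rewrite exprn_ile1// ltW.
Qed.

Lemma theta_ahlfors : ahlfors_regular p (remetric theta).
Proof.
split=> //; set Y := remetric theta.
have f0 v : 0 <= pi v `^ p by exact: powR_ge0.
have [_ _ hH4] := rho_H4.
have fK B n : (tag B < n)%N -> K2^-1 * pi B `^ p <= dsum (fun v => pi v `^ p) n B <=
    K2 * pi B `^ p.
  by case: B => m B /= mn; rewrite -(dsumE (fun v => pi v `^ p)); exact: hH4.
have [nu [nuK nuadd]] := additive_weight f0 fK.
have nu0 v : 0 <= nu v.
  by have /andP[h _] := nuK v; apply: le_trans h; rewrite mulr_ge0// invr_ge0 ltW.
have nuadd1 B : dsum nu (tag B).+1 B = nu B by apply: nuadd.
have th_open (A : set X) : @open Y A -> @open X A.
  by move=> Ao; have [/continuousP h _] := theta_homeo; exact: (h A Ao).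
have [mu [mufin mulow muup]] := tree_measure kappa_ge1 a_ge X_compact nu0 nuadd1 th_open.
have cY : compact [set: Y] := homeo_compact X_compact theta_homeo.
(* If theta x y < r, a cell of [c_set] weighs at most K1 r, and the chosen cell [b x n] of the same
   level at most K0 times more. *)
pose A := K0 * (K1 + 1); have A0 : 0 < A by rewrite mulr_gt0// addr_gt0.
(* [e * r] is the weight guaranteed by [stop] at threshold r / (Ct K0). *)
pose e := eta_m / (K0 * (Ct * K0)); have e0 : 0 < e by rewrite divr_gt0// !mulr_gt0.
have ep := powR_gt0 p e0.
have N0 : 0 <= N.
  have [w [w0 _]] := cover S 0 point.
  apply: le_trans (neighbors (v := w) (Q := pred0) w0 _) => //.
  by rewrite big_pred0_eq.
pose U := N * (K2 * (K0 * A) `^ p).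
have U0 : 0 <= U by rewrite mulr_ge0// mulr_ge0 ?powR_ge0// ltW.
exists mu, (1 + U + K2 / e `^ p); split.
- exact: finite_radon.
- by rewrite -addrA lerDl addr_ge0// divr_ge0// ltW.
move=> x r r0 rd.
have rCt : r <= Ct.
  rewrite -lee_fin; apply: (le_trans rd); apply: ge_ereal_sup => _ [[y z] _ <-].
  by rewrite lee_fin; exact: theta_le.
have rp := powR_gt0 p r0.
have bo : @open Y (ball x r) by exact: open_metric_ball.
have low : ((K2^-1 * (e * r) `^ p)%:E <= mu (ball x r))%E.
  (* With this threshold every point y near the stopped cell satisfies theta x y <= Ct pi(B) <= Ct
     K0 pi(b x n) < r. *)
  have rs : 0 < r / (Ct * K0) by rewrite divr_gt0// mulr_gt0.
  have [n [bn hn]] := stop x rs.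
  apply: (@le_trans _ _ (nu (b x n))%:E).
    rewrite lee_fin; have /andP[h _] := nuK (b x n); apply: le_trans h.
    rewrite ler_pM2l ?invr_gt0//; apply: ge0_ler_powR; rewrite ?nnegrE ?(ltW p0)//.
    + by rewrite mulr_ge0// ltW.
    + by rewrite ltW// weight_gt0.
    have -> : e * r = eta_m * (r / (Ct * K0)) / K0.
      by rewrite /e; field; rewrite ?gt_eqF.
    case: hn => [n0|]; last by rewrite ler_pdivrMr// [leRHS]mulrC.
    (* A search stopping at the root gives no lower bound; the root weighs at least [eta_m], and r
       <= Ct suffices. *)
    rewrite n0; have /andP[h _] := weight_level (b x 0); apply: le_trans h.
    rewrite tag_b expr1 ler_pdivrMr// ler_pM2l// ler_pdivrMr ?mulr_gt0//.
    apply: (le_trans rCt); rewrite mulrCA -[leLHS]mulr1 ler_pM2l//.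
    exact: mulr_ege1.
  apply: mulow => // y hy; rewrite ballEmdist /=.
  have [<-|/eqP xy] := eqVneq x y; first by rewrite mdistxx.
  have [B cB] := c_set_neq0 xy; have /andP[_ h] := theta_c_set xy cB.
  apply: (le_lt_trans h); case: cB => Bx By Bmax.
  have by' : dilate alpha (b x n) y.
    rewrite /dilate ballEmdist /= -/(rad _) -/(ctr _); apply: (le_lt_trans hy).
    by rewrite ltr_pM2r ?rad0// ltr_pM2r//; move: alpha2; lra.
  have tB := Bmax _ (b_dilate x n) by'.
  have [h1 _] := weight_compare (b_dilate x n) Bx tB.
  rewrite -/Ct -ltr_pdivlMl//.
  apply: (le_lt_trans h1); apply: (@le_lt_trans _ _ (K0 * pi (b x n))).
    rewrite ler_pM2r ?weight_gt0// ler_piMr ?(ltW K00)//.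
    by rewrite exprn_ile1// ltW.
  by rewrite -ltr_pdivlMl// mulrA -invfM mulrC [K0 * Ct]mulrC.
have up : (mu (ball x r) <= (U * r `^ p)%:E)%E.
  have As : 0 < A * r by rewrite mulr_gt0.
  have [n [bn hn]] := stop x As.
  (* [n'] is the first level where the cell around x weighs at most A r; the scale of x and any y of
     the ball is then at least that deep, so d x y is at most 2 alpha kappa r_n'. *)
  have [n' [bn' nmin]] : exists n', pi (b x n') <= A * r /\
      forall k, pi (b x k) <= A * r -> (n' <= k)%N.
    have ex : exists k, pi (b x k) <= A * r by exists n; exact: ltW.
    by have [k hk kmin] := ex_minnP ex; exists k.
  pose Q (u : level S n') := d (ctr (vtx u)) x < lambda * kappa * a ^- n'.
  have bx := b_near x n'.
  have l1k : kappa * a ^- n' <= lambda * kappa * a ^- n'.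
    rewrite -mulrA ler_peMl ?mulr_ge0 ?(ltW kappa_gt0) ?(ltW (rn_gt0 kappa_ge1 a_ge _))//.
    by move: lambda_ge32; lra.
  have bxE : rad (b x n') = a ^- n' by rewrite /rad tag_b.
  apply: le_trans (muup (ball x r) n' Q bo _) _.
    move=> y u; rewrite ballEmdist /= => ty hu.
    have dxy : d x y <= 2 * (alpha * kappa * a ^- n').
      have [<-|/eqP xy] := eqVneq x y.
        rewrite mdistxx !mulr_ge0 ?(ltW kappa_gt0) ?(ltW (rn_gt0 kappa_ge1 a_ge _))//.
        exact: ltW.
      have [B cB] := c_set_neq0 xy; have [_ h1] := c_set_dist cB.
      have /andP[h2 _] := theta_c_set xy cB; case: cB => Bx By _.
      apply: ltW; apply: (lt_le_trans h1); rewrite ler_pM2l// ler_pM2l ?mulr_gt0//.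
      apply: (ler_rn kappa_ge1 a_ge); apply: nmin.
      have [|h3 _] := weight_compare Bx (b_dilate x (tag B)); first by rewrite tag_b.
      apply: (le_trans h3); rewrite tag_b subnn expr0 mulr1 /A -mulrA ler_pM2l//.
      have h4 : pi B <= K1 * theta x y by rewrite -ler_pdivrMl.
      apply: (le_trans h4); apply: ler_pM => //; rewrite ?theta_ge0 ?(ltW K10)//.
        by rewrite lerDl.
      exact: ltW.
    rewrite /Q; apply: le_lt_trans (@metric_triangle R X _ y _) _.
    rewrite (@metric_sym R X y); apply: le_lt_trans (lerD hu dxy) _.
    have kr : 0 < kappa * a ^- n' by rewrite mulr_gt0// (rn_gt0 kappa_ge1 a_ge).
    have -> : 6 / 5 * kappa * a ^- n' + 2 * (alpha * kappa * a ^- n') =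
        (6 / 5 + 2 * alpha) * (kappa * a ^- n') by ring.
    by rewrite -mulrA ltr_pM2r//; move: alpha_le lambda_ge32; lra.
  rewrite lee_fin.
  apply: (@le_trans _ _ (\sum_(u | Q u) K2 * (K0 * (A * r)) `^ p)).
    apply: ler_sum => u Qu; have /andP[_ h] := nuK (vtx u); apply: (le_trans h).
    rewrite ler_pM2l//; apply: ge0_ler_powR; rewrite ?nnegrE ?(ltW p0)//.
    + by rewrite ltW// weight_gt0.
    + by rewrite ltW// mulr_gt0.
    apply: (@le_trans _ _ (K0 * pi (b x n'))); last by rewrite ler_pM2l.
    have tt : tag (vtx u) = tag (b x n') by rewrite tag_b.
    apply: (weight_sim tt Qu).
    by rewrite metric_sym bxE; apply: lt_le_trans l1k; rewrite -bxE.
  have -> : \sum_(u | Q u) K2 * (K0 * (A * r)) `^ p =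
      (\sum_(u | Q u) 1) * (K2 * (K0 * (A * r)) `^ p).
    by rewrite mulr_suml; apply: eq_bigr => u _; rewrite mul1r.
  have -> : (K0 * (A * r)) `^ p = (K0 * A) `^ p * r `^ p.
    by rewrite mulrA powRM// ltW// mulr_gt0.
  have -> : U * r `^ p = N * (K2 * ((K0 * A) `^ p * r `^ p)) by rewrite /U; ring.
  apply: ler_wpM2r.
    by rewrite mulr_ge0 ?(ltW K20)// mulr_ge0 ?powR_ge0.
  apply: (neighbors (tag_b x n')) => u Qu.
  apply: le_trans (@metric_triangle R X _ x _) _.
  rewrite (@metric_sym R X _ x) (@metric_sym R X x (ctr (vtx u))).
  apply: le_trans (ltW (ltrD bx Qu)) _; rewrite bxE.
  have := l1k; rewrite -!mulrA; lra.
have mb : measurable (ball x r : set (borel Y)) by exact: open_borel.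
have mE : mu (ball x r) = (fine (mu (ball x r)))%:E.
  by rewrite fineK// ge0_fin_numE//; exact: borel_fin.
rewrite mE lee_fin in low; rewrite mE lee_fin in up.
rewrite mE -EFinM !lee_fin; apply/andP; split.
  rewrite ler_pdivlMr//; apply: le_trans low.
  rewrite powRM ?(ltW e0) ?(ltW r0)// mulrA ler_pM2r//.
  rewrite -[leRHS]invrK lef_pV2 ?posrE ?invr_gt0 ?mulr_gt0 ?invr_gt0//; last first.
    by rewrite addr_gt0 ?divr_gt0// ltr_pwDl.
  by rewrite invfM invrK lerDr addr_ge0.
rewrite ler_pdivrMr//; apply: (le_trans up); rewrite ler_pM2r//.
by rewrite -addrA addrCA lerDl addr_ge0// divr_ge0// ltW.
Qed.

End Weight.

(** * The weight of a distance *)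

Section Converse.
Variables (R : realType) (X : pointedMetricType R) (kappa a lambda KP : R).
Variable S : covering_data X kappa a.
Hypotheses (kappa_ge1 : 1 <= kappa) (lambda_ge32 : 32 <= lambda).
Hypotheses (a_large : 6 * kappa ^+ 2 * lambda <= a) (a_KP : 6 * kappa ^+ 2 * KP <= a).
Hypothesis KP_perfect : uniformly_perfect KP X.
Variables (x0 x1 : X).
Hypothesis x01 : x0 <> x1.
Variables (theta : distance R X) (q : R) (t : vertex S -> R) (K : R).
Hypotheses (q_gt0 : 0 < q) (t_gt0 : forall v, 0 < t v).
Local Notation d := (@mdist R X).
Local Notation vertex := (vertex S).
Implicit Types (u v B : vertex).
Hypothesis t_up : forall L, 0 <= L -> exists2 H, 1 <= H & forall v x y,
  d (ctr v) x <= L * rad v -> d (ctr v) y <= L * rad v -> theta x y <= H * t v.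
Hypothesis t_low : forall L, 0 <= L -> exists2 H, 1 <= H & forall v x y,
  d (ctr v) x <= L * d x y -> rad v <= L * d x y -> t v <= H * theta x y.
Hypothesis t_comp : forall L, 0 <= L -> exists2 H, 1 <= H & forall u v,
  d (ctr u) (ctr v) <= L * rad v -> rad u <= L * rad v -> t u <= H * t v.
Hypothesis K_ge1 : 1 <= K.
Hypothesis t_sum : forall B n, (tag B < n)%N ->
  K^-1 * t B `^ q <= dsum (fun v => t v `^ q) n B <= K * t B `^ q.

Let a_ge : 192 * kappa ^+ 2 <= a.
Proof. exact: a_ge_of_large kappa_ge1 lambda_ge32 a_large. Qed.
Let kappa_gt0 : 0 < kappa. Proof. exact: lt_le_trans ltr01 kappa_ge1. Qed.
Let rad0 v : 0 < rad v. Proof. exact: rad_gt0 kappa_ge1 a_ge v. Qed.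
Let a_gt0 : 0 < a. Proof. exact: a_gt0 kappa_ge1 a_ge. Qed.
Let K_gt0 : 0 < K. Proof. exact: lt_le_trans ltr01 K_ge1. Qed.

Let t_half : 0 < 1 / 2 :> R. Proof. by lra. Qed.

(** The center of [B] and a point of the annulus of outer radius rad B / (3 kappa) both lie in
    children of [B]. Since a >= 6 kappa^2 KP, they are too far apart for one child. Levels from [N]
    on have such radii below the diameter. *)
Lemma two_children : exists N, forall B u, (N <= tag B)%N ->
  tag u = (tag B).+1 -> parent_vertex u = B ->
  exists u', [/\ tag u' = (tag B).+1, parent_vertex u' = B & u' <> u].
Proof.
have [KP1 perf] := KP_perfect; have KP0 : 0 < KP by lra.
set D := d x0 x1; have D0 : 0 < D by rewrite mdist_gt0; apply/eqP.
have k3 : 0 < 3 * kappa by rewrite mulr_gt0.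
have [N hN] := rn_small kappa_ge1 a_ge (mulr_gt0 k3 D0).
exists N => B u NB tu uB.
set r := rad B / (3 * kappa); have r0 : 0 < r by rewrite divr_gt0.
have rD : r <= D.
  rewrite ler_pdivrMr// mulrC; apply: le_trans (ltW hN).
  exact: ler_rn kappa_ge1 a_ge _ _ NB.
have rdiam : (r%:E <= diam X)%E.
  apply: (@le_trans _ _ D%:E); first by rewrite lee_fin.
  by apply: ereal_sup_ubound; exists (x0, x1).
have [y []] := perf (ctr B) r r0 rdiam.
rewrite !ballEmdist /= => y1 /negP; rewrite -leNgt => y2.
have kid z : d (ctr B) z < r -> exists v, [/\ tag v = (tag B).+1,
    parent_vertex v = B & d z (ctr v) < kappa * rad v].
  move=> hz; have [v [tv vz]] := cover_ball S (tag B).+1 z.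
  exists v; split=> //; rewrite metric_sym in hz.
  have := anc_near kappa_ge1 a_ge _ vz hz; rewrite tv => /(_ (ltnSn _)).
  by rewrite subSnn.
have [|v1 [tv1 pv1 d1]] := kid (ctr B); first by rewrite mdistxx.
have [v2 [tv2 pv2 d2]] := kid y y1.
have [v1u|/eqP ?] := eqVneq v1 u; last by exists v1.
have [v2u|/eqP ?] := eqVneq v2 u; last by exists v2.
exfalso; rewrite v1u in d1; rewrite v2u in d2.
have rB : rad B = a * rad u by rewrite -uB rad_parent// tu.
have h1 : 2 * (kappa * rad u) <= KP^-1 * r.
  rewrite ler_pdivlMl// /r ler_pdivlMr// rB.
  have -> : KP * (2 * (kappa * rad u)) * (3 * kappa) = 6 * kappa ^+ 2 * KP * rad u.
    by ring.
  by rewrite ler_pM2r.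
have := metric_triangle (ctr B) (ctr u) y; rewrite (metric_sym (ctr u) y).
by lra.
Qed.

(** A second child takes at least the fraction [c^-1] of the weight of the parent, so no child keeps
    more than [1 - c^-1] of it. *)
Lemma contracting_weight : exists (g : vertex -> R) (M eta0 eta1 : R),
  [/\ 1 <= M, 0 < eta0, eta1 < 1,
      forall v, M^-1 * t v `^ q <= g v <= M * t v `^ q &
      (forall v, (0 < tag v)%N ->
        eta0 * g (parent_vertex v) <= g v <= eta1 * g (parent_vertex v)) /\
      forall B n, (tag B < n)%N -> M^-1 * g B <= dsum g n B <= M * g B].
Proof.
have tq v : 0 < t v `^ q by exact: powR_gt0.
have [nu [nuK nuadd]] := additive_weight (fun v => ltW (tq v)) t_sum.
have nu0 v : 0 < nu v.
  by have /andP[h _] := nuK v; apply: lt_le_trans h; rewrite mulr_gt0// invr_gt0.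
have [N two] := two_children.
have ka0 : 0 <= kappa * a by rewrite mulr_ge0// ltW.
have [H H_ge1 HP] := t_comp ka0; have H0 : 0 < H by lra.
have Hq := powR_gt0 q H0.
pose c := 1 + K * H `^ q * K.
have c1 : 1 <= c by rewrite lerDl !mulr_ge0// ltW.
have c0 : 0 < c by lra.
have nu_parent v : (0 < tag v)%N -> nu (parent_vertex v) <= c * nu v.
  move=> v0; have rp := rad_parent kappa_ge1 a_ge v0.
  have h : t (parent_vertex v) <= H * t v.
    apply: HP.
      rewrite metric_sym -mulrA -rp; apply: ltW; exact: parent_dist.
    by rewrite rp -mulrA ler_peMl// mulr_ge0// ltW.
  have /andP[_ h1] := nuK (parent_vertex v); have /andP[h2 _] := nuK v.
  apply: (le_trans h1); apply: (@le_trans _ _ (K * (H `^ q * (K * nu v)))).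
    rewrite ler_pM2l//; apply: (@le_trans _ _ ((H * t v) `^ q)).
      apply: ge0_ler_powR; rewrite ?nnegrE ?(ltW q_gt0) ?(ltW (t_gt0 _))//.
      by rewrite ltW// mulr_gt0.
    rewrite powRM ?(ltW H0) ?(ltW (t_gt0 _))// ler_pM2l//.
    by rewrite -ler_pdivrMl.
  by rewrite !mulrA ler_pM2r// /c lerDr.
have nu_child1 v : (0 < tag v)%N -> nu v <= nu (parent_vertex v).
  move=> v0; have tv : tag v = (tag (parent_vertex v)).+1 by rewrite tag_parent prednK.
  have [b bv] := vtx_lev tv.
  rewrite -(nuadd (parent_vertex v) (tag (parent_vertex v)).+1)// /dsum (bigD1 b) /=.
    by rewrite bv lerDl; apply: sumr_ge0 => ? _; exact: ltW (nu0 _).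
  by rewrite bv subSnn.
have nu_child2 v u : (0 < tag v)%N -> tag u = tag v ->
    parent_vertex u = parent_vertex v -> u <> v -> nu v + nu u <= nu (parent_vertex v).
  move=> v0 tuv puv uv; have tv : tag v = (tag (parent_vertex v)).+1 by rewrite tag_parent prednK.
  have [b bv] := vtx_lev tv; have [e eu] := vtx_lev (etrans tuv tv).
  rewrite -(nuadd (parent_vertex v) (tag (parent_vertex v)).+1)// /dsum (bigD1 b) /=.
    rewrite bv lerD2l (bigD1 e) /=.
      by rewrite eu lerDl; apply: sumr_ge0 => ? _; exact: ltW (nu0 _).
    rewrite eu subSnn /anc /= puv eqxx /=; apply/eqP => eb; apply: uv.
    by rewrite -eu eb bv.
  by rewrite bv subSnn.
(* The factor 1/2 on the first N levels makes up for cells with a single child. *)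
pose s n : R := (1 / 2) ^+ minn n N.
have s0 n : 0 < s n by rewrite exprn_gt0.
have s_le m n : (m <= n)%N -> s n <= s m.
  by move=> mn; apply: ler_wiXn2l; [lra|lra|rewrite leq_min geq_minr geq_min mn].
have s1 n : s n <= 1 by rewrite exprn_ile1//; lra.
have sN n : s N <= s n.
  by apply: ler_wiXn2l; [lra|lra|rewrite minnn geq_minr].
pose g v := nu v * s (tag v).
have g0 v : 0 < g v by rewrite mulr_gt0.
(* The correction [s] stays between [s N] and 1, so this constant absorbs it. *)
pose M := K / s N.
have KM : K <= M by rewrite ler_pdivlMr// ler_piMr// ltW.
have M0 : 0 < M by rewrite divr_gt0.
have MV : M^-1 = s N / K by rewrite /M invf_div.
have cV : c^-1 <= 1 by rewrite invf_le1.
have cV0 : 0 < c^-1 by rewrite invr_gt0.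
exists g, M, (c^-1 / 2), (Num.max (1 / 2) (1 - c^-1)); split.
- exact: le_trans KM.
- by rewrite divr_gt0.
- by rewrite gt_max; apply/andP; split; lra.
- move=> v; have /andP[h1 h2] := nuK v; apply/andP; split.
    have -> : M^-1 * t v `^ q = (K^-1 * t v `^ q) * s N by rewrite MV; ring.
    apply: ler_pM => //; last exact: ltW (s0 _).
    by rewrite mulr_ge0 ?invr_ge0 ?(ltW K_gt0) ?(ltW (tq v)).
  apply: (@le_trans _ _ (nu v)); first by rewrite /g ler_piMr// ltW.
  by apply: (le_trans h2); rewrite ler_pM2r.
split.
- move=> v v0; set B := parent_vertex v.
  have tv : tag v = (tag B).+1 by rewrite tag_parent prednK.
  have n1 : nu B * c^-1 <= nu v.
    by rewrite ler_pdivrMr// mulrC; exact: nu_parent.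
  have [BN|NB] := ltnP (tag B) N.
    have sE : s (tag v) = 1 / 2 * s (tag B).
      by rewrite /s tv (minn_idPl BN) (minn_idPl (ltnW BN)) exprS.
    rewrite /g sE; have sB := s0 (tag B); apply/andP; split.
      have -> : c^-1 / 2 * (nu B * s (tag B)) = (nu B * c^-1) * (1 / 2 * s (tag B)) by field; rewrite gt_eqF.
      by rewrite ler_pM2r ?mulr_gt0.
    rewrite mulrCA; apply: ler_pM.
    + exact: ltW t_half.
    + by rewrite mulr_ge0 ?(ltW (nu0 _)) ?(ltW sB).
    + by rewrite le_max lexx.
    + by rewrite ler_pM2r//; exact: nu_child1.
  have sE : s (tag v) = s (tag B).
    by rewrite /s tv (minn_idPr NB) (minn_idPr (leqW NB)).
  rewrite /g sE !mulrA !ler_pM2r//; apply/andP; split.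
    apply: le_trans n1; rewrite mulrC ler_pM2l//; lra.
  have [u [tu pu uv]] := two B v NB tv erefl.
  have tuv : tag u = tag v by rewrite tu tv.
  have h := nu_child2 v u v0 tuv pu uv; rewrite -/B in h.
  have u0 : (0 < tag u)%N by rewrite tu.
  have n2 : nu B * c^-1 <= nu u.
    by rewrite ler_pdivrMr// mulrC -{1}pu; exact: nu_parent.
  apply: (@le_trans _ _ ((1 - c^-1) * nu B)).
    by rewrite mulrBl mul1r [c^-1 * _]mulrC; lra.
  by rewrite ler_pM2r// le_max lexx orbT.
move=> B n Bn.
have -> : dsum g n B = nu B * s n.
  by rewrite -(nuadd B n (ltnW Bn)) /dsum mulr_suml.
have sNM : M^-1 <= s N by rewrite MV ler_pdivrMr// ler_peMr// ltW.
have gB : g B <= nu B by rewrite /g ler_piMr// ltW.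
apply/andP; split.
  rewrite [leRHS]mulrC; apply: ler_pM => //; rewrite ?invr_ge0 ?(ltW M0) ?(ltW (g0 B))//.
  exact: le_trans sNM (sN n).
apply: (@le_trans _ _ (g B)); first by rewrite ler_pM2l//; exact: s_le (ltnW Bn).
by rewrite ler_peMl// ?(ltW (g0 B))// (le_trans K_ge1).
Qed.

End Converse.

(** * From a contracting weight to the function rho *)

Section Normalized.
Variables (R : realType) (X : pointedMetricType R) (kappa a lambda : R).
Variable S : covering_data X kappa a.
Hypotheses (kappa_ge1 : 1 <= kappa) (lambda_ge32 : 32 <= lambda).
Hypotheses (a_large : 6 * kappa ^+ 2 * lambda <= a).
Variables (theta : distance R X) (q : R) (t : vertex S -> R).
Hypotheses (q_gt0 : 0 < q) (t_gt0 : forall v, 0 < t v).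
Local Notation d := (@mdist R X).
Local Notation vertex := (vertex S).
Implicit Types (u v B : vertex).
Hypothesis t_up : forall L, 0 <= L -> exists2 H, 1 <= H & forall v x y,
  d (ctr v) x <= L * rad v -> d (ctr v) y <= L * rad v -> theta x y <= H * t v.
Hypothesis t_low : forall L, 0 <= L -> exists2 H, 1 <= H & forall v x y,
  d (ctr v) x <= L * d x y -> rad v <= L * d x y -> t v <= H * theta x y.
Hypothesis t_comp : forall L, 0 <= L -> exists2 H, 1 <= H & forall u v,
  d (ctr u) (ctr v) <= L * rad v -> rad u <= L * rad v -> t u <= H * t v.
Variables (g : vertex -> R) (M eta0 eta1 : R).
Hypotheses (M_ge1 : 1 <= M) (eta0_gt0 : 0 < eta0) (eta1_lt1 : eta1 < 1).
Hypothesis g_t : forall v, M^-1 * t v `^ q <= g v <= M * t v `^ q.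
Hypothesis g_parent : forall v, (0 < tag v)%N ->
  eta0 * g (parent_vertex v) <= g v <= eta1 * g (parent_vertex v).
Hypothesis g_sum : forall B n, (tag B < n)%N -> M^-1 * g B <= dsum g n B <= M * g B.

Let a_ge : 192 * kappa ^+ 2 <= a.
Proof. exact: a_ge_of_large kappa_ge1 lambda_ge32 a_large. Qed.
Let kappa_gt0 : 0 < kappa. Proof. exact: lt_le_trans ltr01 kappa_ge1. Qed.
Let rad0 v : 0 < rad v. Proof. exact: rad_gt0 kappa_ge1 a_ge v. Qed.
Let a_gt0 : 0 < a. Proof. exact: a_gt0 kappa_ge1 a_ge. Qed.
Let M_gt0 : 0 < M. Proof. exact: lt_le_trans ltr01 M_ge1. Qed.
Let qV0 : 0 < q^-1. Proof. by rewrite invr_gt0. Qed.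
Let tq v : 0 < t v `^ q. Proof. exact: powR_gt0. Qed.
Let g0 v : 0 < g v.
Proof.
by have /andP[h _] := g_t v; apply: lt_le_trans h; rewrite mulr_gt0// invr_gt0.
Qed.

Let root := projT1 (cid (cover S 0 point)).
Let root0 : tag root = 0%N. Proof. by case: (projT2 (cid (cover S 0 point))). Qed.

Let le_root x y : 0 <= x -> x <= y -> x `^ q^-1 <= y `^ q^-1.
Proof.
move=> x0 xy; apply: ge0_ler_powR; rewrite ?nnegrE ?(ltW qV0)//.
exact: le_trans xy.
Qed.

Let rootK x : 0 <= x -> (x `^ q) `^ q^-1 = x.
Proof. by move=> x0; rewrite -powRrM mulfV ?gt_eqF// powRr1. Qed.

Let rootK' x : 0 <= x -> (x `^ q^-1) `^ q = x.
Proof. by move=> x0; rewrite -powRrM mulVf ?gt_eqF// powRr1. Qed.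

(** The factor 1/2 gives the root the weight 1/2, since rho of the root must lie strictly between 0
    and 1. *)
Definition normalized_weight v : R := 2^-1 * (g v / g root) `^ q^-1.
Local Notation pi0 := normalized_weight.

Let pi0_gt0 v : 0 < pi0 v.
Proof. by rewrite mulr_gt0 ?invr_gt0// powR_gt0// divr_gt0. Qed.

Let pi0_scale c u v : 0 < c -> g u <= c * g v -> pi0 u <= c `^ q^-1 * pi0 v.
Proof.
move=> c0 h; rewrite mulrCA ler_pM2l ?invr_gt0//.
rewrite -powRM ?(ltW c0) ?divr_ge0 ?(ltW (g0 _))//.
apply: le_root; first by rewrite divr_ge0 ?(ltW (g0 _)).
by rewrite mulrA ler_pM2r// invr_gt0.
Qed.

Let pi0_scale' c u v : 0 < c -> c * g v <= g u -> c `^ q^-1 * pi0 v <= pi0 u.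
Proof.
move=> c0 h; rewrite mulrCA ler_pM2l ?invr_gt0//.
rewrite -powRM ?(ltW c0) ?divr_ge0 ?(ltW (g0 _))//.
apply: le_root; first by rewrite mulr_ge0 ?divr_ge0 ?(ltW (g0 _)) ?(ltW c0).
by rewrite mulrA ler_pM2r// invr_gt0.
Qed.

Let pi0_root v : tag v = 0%N -> pi0 v = 2^-1.
Proof.
move=> v0; rewrite (root_unique v0 root0) /pi0 divff ?gt_eqF//.
by rewrite powR1 mulr1.
Qed.

(** Products of these quotients telescope. The root is its own [parent_vertex], so its quotient
    would be the forbidden value 1. *)
Definition ratio_weight v : R :=
  if tag v == 0%N then 2^-1 else pi0 v / pi0 (parent_vertex v).
Local Notation rho := ratio_weight.

Lemma ratio_weightE v : weight rho v = pi0 v.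
Proof.
move en : (tag v) => n; elim: n v en => [|n IH] v tv.
  by rewrite weight_root// pi0_root// /rho tv eqxx.
rewrite weight_parent ?tv// IH ?tag_parent ?tv// /rho tv /=.
by rewrite divfK// gt_eqF.
Qed.

Let em := Num.min 2^-1 (eta0 `^ q^-1).
Let ep := Num.max 2^-1 (eta1 `^ q^-1).

Let half_lt1 : 2^-1 < 1 :> R. Proof. by rewrite invf_lt1// ltr1n. Qed.

Let e10 : 0 < eta1.
Proof.
have [v [tv _]] := cover S 1 point.
have v0 : (0 < tag v)%N by rewrite tv.
have /andP[_ h] := g_parent v0.
by have := lt_le_trans (g0 v) h; rewrite pmulr_lgt0.
Qed.

Lemma ratio_H1 : H1 rho em ep.
Proof.
have h0 : 0 < eta0 `^ q^-1 by exact: powR_gt0.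
split.
- by rewrite lt_min invr_gt0 ltr0n.
- by rewrite ge_min !le_max lexx.
- rewrite gt_max half_lt1 /=.
  have e1q : 1 `^ q^-1 = 1 :> R by rewrite powR1.
  by rewrite -[ltRHS]e1q; apply: gt0_ltr_powR; rewrite ?nnegrE ?(ltW e10).
- move=> v; rewrite /rho; case: eqP => [_|/eqP v0].
    by rewrite ge_min le_max !lexx.
  rewrite -lt0n in v0; have /andP[h1 h2] := g_parent v0.
  rewrite ler_pdivlMr// ler_pdivrMr//; apply/andP; split.
    apply: le_trans (pi0_scale' eta0_gt0 h1).
    by rewrite ler_pM2r// ge_min lexx orbT.
  apply: (le_trans (pi0_scale e10 h2)).
  by rewrite ler_pM2r// le_max lexx orbT.
Qed.

Let l0 : 0 < lambda. Proof. exact: lt_le_trans lambda_ge32. Qed.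
(** Bounds both kinds of edges: 2 lambda kappa for a horizontal one, kappa a for a step to the
    parent, whose radius is a times larger. *)
Let L := 2 * lambda * kappa + kappa * a.
Let lk0 : 0 <= 2 * lambda * kappa.
Proof. by rewrite !mulr_ge0 ?(ltW l0) ?(ltW kappa_gt0). Qed.
Let L0 : 0 <= L.
Proof. by rewrite addr_ge0// mulr_ge0// ltW. Qed.

Lemma sim_dist n (b c : level S n) : sim lambda b c ->
  d (ctr (vtx b)) (ctr (vtx c)) <= 2 * lambda * kappa * rad (vtx c).
Proof.
move=> [z []]; rewrite /dilate !ballEmdist /= => h1 h2.
apply: le_trans (metric_triangle _ z _) _; rewrite (metric_sym z).
apply: le_trans (ltW (ltrD h1 h2)) _; rewrite /rad /=.
by rewrite -!mulrA mulr_natl mulr2n.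
Qed.

Lemma ratio_H2 : exists K0, H2 lambda rho K0.
Proof.
have L10 : 0 <= 2 * lambda * kappa + 1 by rewrite addr_ge0.
have [H H_ge1 HP] := t_comp L10; have H0 : 0 < H by lra.
pose c := M * (H `^ q * M); have c0 : 0 < c by rewrite !mulr_gt0// powR_gt0.
exists (1 + c `^ q^-1); split; first by rewrite lerDl powR_ge0.
move=> n b b' bb; rewrite !ratio_weightE.
apply: (@le_trans _ _ (c `^ q^-1 * pi0 (vtx b'))); last first.
  by rewrite ler_pM2r// lerDr.
apply: pi0_scale => //.
have h : t (vtx b) <= H * t (vtx b').
  apply: HP.
    apply: (le_trans (sim_dist bb)); rewrite ler_pM2r//; lra.
  by rewrite /rad /= -[leLHS]mul1r ler_pM2r ?lerDr//; exact: rad0 (vtx b').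
have /andP[_ h1] := g_t (vtx b); have /andP[h2 _] := g_t (vtx b').
apply: (le_trans h1); rewrite /c -!mulrA ler_pM2l//.
apply: (@le_trans _ _ ((H * t (vtx b')) `^ q)).
  apply: ge0_ler_powR; rewrite ?nnegrE ?(ltW q_gt0) ?(ltW (t_gt0 _))//.
  by rewrite ltW// mulr_gt0.
by rewrite powRM ?(ltW H0) ?(ltW (t_gt0 _))// ler_pM2l ?powR_gt0// -ler_pdivrMl.
Qed.

Lemma ratio_H4 : H4 rho q M.
Proof.
split=> // m B n mn.
pose c := (2^-1) `^ q / g root; have c0 : 0 < c by rewrite divr_gt0// powR_gt0// invr_gt0.
have wE v : weight rho v `^ q = c * g v.
  rewrite ratio_weightE powRM ?invr_ge0 ?powR_ge0//.
  rewrite rootK' ?divr_ge0 ?(ltW (g0 _))// /c; ring.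
have -> : \sum_(B' in descendants B n) weight rho (vtx B') `^ q = c * dsum g n (vtx B).
  rewrite -(dsumE g) mulr_sumr; apply: eq_bigr => b _; exact: wE.
rewrite wE mulrCA [M * _]mulrCA !ler_pM2l//.
exact: g_sum.
Qed.

Lemma weight_t : exists2 A, 1 <= A & forall v,
  t v <= A * weight rho v /\ weight rho v <= A * t v.
Proof.
have gr := g0 root.
pose c1 := M * g root; have c10 : 0 < c1 by rewrite mulr_gt0.
pose c2 := M / g root; have c20 : 0 < c2 by rewrite divr_gt0.
have p1 := powR_gt0 q^-1 c10; have p2 := powR_gt0 q^-1 c20.
exists (1 + 2 * c1 `^ q^-1 + c2 `^ q^-1).
  by rewrite -addrA lerDl addr_ge0 ?mulr_ge0 ?(ltW p1) ?(ltW p2).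
move=> v; rewrite ratio_weightE; have /andP[h1 h2] := g_t v.
have tv := t_gt0 v; have pv := pi0_gt0 v.
split.
  apply: (@le_trans _ _ (2 * c1 `^ q^-1 * pi0 v)); last first.
    by rewrite ler_pM2r//; lra.
  have -> : 2 * c1 `^ q^-1 * pi0 v = c1 `^ q^-1 * (g v / g root) `^ q^-1.
    by rewrite /pi0; field.
  rewrite -powRM ?(ltW c10) ?divr_ge0 ?(ltW (g0 _))//.
  have -> : c1 * (g v / g root) = M * g v by rewrite /c1; field; rewrite gt_eqF.
  rewrite -[leLHS]rootK ?(ltW tv)//; apply: le_root; first exact: ltW.
  by rewrite -ler_pdivrMl.
apply: (@le_trans _ _ (c2 `^ q^-1 * t v)); last first.
  by rewrite ler_pM2r//; lra.
rewrite -[X in _ * X](rootK (ltW tv)) -powRM ?(ltW c20) ?powR_ge0//.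
apply: (@le_trans _ _ ((g v / g root) `^ q^-1)).
  by rewrite /pi0 ler_piMl ?powR_ge0// ltW.
apply: le_root; first by rewrite divr_ge0// ltW.
by rewrite ler_pdivrMr// /c2 mulrAC divfK ?gt_eqF.
Qed.

Lemma edge_dist u v : edge lambda u v -> d (ctr u) (ctr v) <= L * rad u.
Proof.
have k1 (w : vertex) : 0 <= kappa * a * rad w.
  exact: mulr_ge0 (mulr_ge0 (ltW kappa_gt0) (ltW a_gt0)) (ltW (rad0 w)).
have k2 (w : vertex) : 0 <= 2 * lambda * kappa * rad w.
  exact: mulr_ge0 lk0 (ltW (rad0 w)).
case=> [n b c _ [z [z1 z2]]|n b|n b]; rewrite /L mulrDl.
- have h := @sim_dist n c b (ex_intro _ z (conj z2 z1)).
  by rewrite metric_sym; apply: (le_trans h); rewrite lerDl.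
- have /ltW h := parent_dist kappa_ge1 a_ge (vtx b).
  have e : rad (parent_vertex (vtx b)) = a * rad (vtx b) by exact: rad_parent.
  rewrite e mulrA in h.
  by apply: (le_trans h); rewrite lerDr.
- have /ltW h := parent_dist kappa_ge1 a_ge (vtx b).
  rewrite metric_sym; apply: (le_trans h).
  rewrite -[X in X <= _]add0r; apply: lerD => //.
  by rewrite ler_pM2r ?rad0// ler_peMr ?(ltW kappa_gt0)//; have := a_ge192 kappa_ge1 a_ge; lra.
Qed.

(** An edge is theta-short compared with the weight of its first vertex, whatever its kind, so the
    triangle inequality bounds paths that change level freely. This is the core of (H3). *)
Lemma path_theta : exists2 A, 1 <= A & forall u s,
  path (fun u v => `[< edge lambda u v >]) u s ->
  theta (ctr u) (ctr (last u s)) <= A * path_length rho (u, s).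
Proof.
have [H H_ge1 HP] := t_up L0; have [A A1 AP] := weight_t.
have H0 : 0 < H by lra.
exists (H * A); first exact: mulr_ege1.
move=> u s; elim: s u => [|v s IH] u /=.
  move=> _; rewrite dist_xx mulr_ge0 ?mulr_ge0 ?(ltW H0)//; first by lra.
  by rewrite /path_length big_seq1 ratio_weightE ltW.
move=> /andP[/asboolP uv /IH {}IH].
apply: le_trans (dist_triangle theta (ctr v) _ _) _.
rewrite /path_length /= big_cons mulrDr; apply: lerD; last exact: IH.
have h : theta (ctr u) (ctr v) <= H * t u.
  by apply: HP; [rewrite mdistxx mulr_ge0// ltW|exact: edge_dist].
apply: (le_trans h); rewrite -mulrA ler_pM2l//; by case: (AP u).
Qed.

Let two2 : (2 : R) <= 2. Proof. by []. Qed.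
Let two_le : 2 <= lambda / 4. Proof. by move: lambda_ge32; lra. Qed.

Lemma weight_c_theta : exists2 A, 1 <= A & forall x y, x <> y ->
  weight_c rho 2 x y <= A * theta x y.
Proof.
have a20 : 0 <= 2 * a by rewrite mulr_ge0// ltW.
have [H H_ge1 HP] := t_low a20; have [A A1 AP] := weight_t.
exists (A * H); first exact: mulr_ege1.
move=> x y xy; have A0 : 0 < A by lra.
apply: ge_sup.
  have [B cB] := c_set_neq0 S kappa_ge1 lambda_ge32 a_large two2 xy.
  by exists (weight rho B), B.
move=> _ [B cB <-].
have [h1 _] := c_set_dist kappa_ge1 lambda_ge32 a_large two2 cB.
have [_ h2] := AP B; apply: (le_trans h2); rewrite -mulrA ler_pM2l//.
case: cB => Bx _ _; apply: HP.
  move: Bx; rewrite /dilate ballEmdist /= -/(ctr B) -/(rad B) => Bx.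
  by apply: (le_trans (ltW Bx)); rewrite -!mulrA ler_pM2l.
have r : rad B <= kappa * rad B by rewrite ler_peMl// ltW.
apply: (le_trans r); apply: (le_trans h1); rewrite -mulrA ler_peMl//; last by lra.
by rewrite mulr_ge0 ?mdist_ge0// ltW.
Qed.

Lemma ratio_H3 : exists K1, H3 lambda rho 2 K1.
Proof.
have [H H_ge1 HP] := t_up (ltW kappa_gt0); have [A A1 AP] := weight_t.
have [A' A'1 AP'] := path_theta; have [A'' A''1 AP''] := weight_c_theta.
(* Two terms [H * A] join x and y to the end centers, [A'] is for the path between these, and [A'']
   passes from [weight_c] to [theta]. No asymptotics is involved, hence the level 1 below. *)
pose C := A'' * (2 * (H * A) + A').
have HA : 1 <= H * A by exact: mulr_ege1.
have C1 : 1 <= C by apply: mulr_ege1 => //; lra.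
exists C; split=> // x y xy; exists 1%N => // n [u s] n1 [/= ps [b [c [bx cy ub ls]]]].
rewrite ler_pdivrMl; last by lra.
apply: le_trans (AP'' x y xy) _; rewrite /C -mulrA ler_pM2l; last by lra.
set Ln := path_length rho (u, s).
have wl v : v \in u :: s -> weight rho v <= Ln.
  move=> vs; rewrite /Ln /path_length (big_rem _ vs) /= lerDl.
  by apply: sumr_ge0 => w _; rewrite ratio_weightE ltW.
have tw v z : v \in u :: s -> cell (tagged v) z -> theta (ctr v) z <= H * A * Ln.
  move=> vs vz; apply: (@le_trans _ _ (H * t v)).
    apply: HP; first by rewrite mdistxx mulr_ge0// ltW.
    by rewrite metric_sym; exact: ltW (cell_ball vz).
  rewrite -mulrA ler_pM2l; last by lra.
  by case: (AP v) => h _; apply: (le_trans h); rewrite ler_pM2l ?wl//; lra.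
have t1 := tw u x (mem_head _ _); rewrite ub /= in t1; have {}t1 := t1 bx.
have t2 := tw (last u s) y (mem_last _ _); rewrite ls /= in t2; have {}t2 := t2 cy.
have t3 := AP' u s ps; rewrite -/Ln ls ub in t3.
have h1 := dist_triangle theta (ctr (vtx b)) x y.
have h2 := dist_triangle theta (ctr (vtx c)) (ctr (vtx b)) y.
rewrite (dist_sym theta x (ctr _)) in h1.
by rewrite mulrDl; move: t1 t2 t3 h1 h2; lra.
Qed.

Theorem converse_weight : exists eta_m eta_p K0 K1,
  admissible lambda rho eta_m eta_p K0 2 K1 q M /\
  exists2 C, 1 <= C & forall x y : X, x <> y ->
    C^-1 * weight_c rho 2 x y <= theta x y <= C * weight_c rho 2 x y.
Proof.
have [K0 h2] := ratio_H2; have [K1 h3] := ratio_H3; have h1 := ratio_H1.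
exists em, ep, K0, K1; split.
  split=> //; last exact: ratio_H4.
  move=> v; case: h1 => e0 _ e1 /(_ v)/andP[r1 r2].
  by rewrite (lt_le_trans e0 r1) (le_lt_trans r2 e1).
have [H H_ge1 HP] := t_up (mulr_ge0 (ler0n R 2) (ltW kappa_gt0)).
have [A A1 AP] := weight_t; have [A' A'1 AP'] := weight_c_theta.
have HA : 1 <= H * A by exact: mulr_ege1.
exists (A' + H * A); first by lra.
move=> x y xy; have th := theta_gt0 theta xy; apply/andP; split.
  rewrite ler_pdivrMl; last by lra.
  apply: (le_trans (AP' x y xy)); rewrite ler_pM2r//; lra.
have [B cB] := c_set_neq0 S kappa_ge1 lambda_ge32 a_large two2 xy.
have /andP[wB _] := c_set_weight kappa_ge1 lambda_ge32 a_large h2 two_le cB.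
have wB0 : 0 < weight rho B by rewrite ratio_weightE.
have h : theta x y <= H * t B.
  case: cB => Bx By _; apply: HP; [move: Bx|move: By];
  by rewrite /dilate ballEmdist /= => /ltW.
apply: (le_trans h); apply: (@le_trans _ _ (H * A * weight rho B)).
  by rewrite -mulrA ler_pM2l; [case: (AP B)|lra].
apply: ler_pM => //; [lra|exact: ltW|lra].
Qed.

End Normalized.

(** * Bounded numbers of neighbours from one distance of the gauge *)

Section Doubling.
Variables (R : realType) (X : pointedMetricType R) (kappa a KP : R).
Variable S : covering_data X kappa a.
Hypotheses (kappa_ge1 : 1 <= kappa) (a_ge : 192 * kappa ^+ 2 <= a).
Hypotheses (X_compact : compact [set: X]) (KP_perfect : uniformly_perfect KP X).
Local Notation d := (@mdist R X).

Lemma gauge_neighbors (L : R) : 0 <= L -> @J_AR R X !=set0 ->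
  exists N, forall (v : vertex S) n (Q : pred (level S n)), tag v = n ->
  (forall u : level S n, Q u -> d (ctr v) (ctr (vtx u)) <= L * rad v) ->
  \sum_(u | Q u) 1 <= N :> R.
Proof.
move=> L0 [theta [[eta qs] [q ar]]].
have [[x0 [x1 x01]]|X1] := pselect (exists x y : X, x <> y).
  have [P P1 perf] := perfect_unit KP_perfect x01.
  have [_ homeo _] := qs; have [q0 _] := ar.
  have [C [C0 pack _]] := ahlfors_bounds (homeo_compact X_compact homeo) ar
    (ex_intro _ x0 (ex_intro _ x1 x01)).
  have [N _ hN] := neighbor_count S kappa_ge1 a_ge (quasisymmetric_weak qs) P1 perf
    q0 C0 pack L0.
  by exists N.
(* In a one-point space all centers coincide, so separation leaves one cell per level. *)
have uniq n (b c : level S n) : b = c.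
  apply: contrapT => bc; have ne : vtx b <> vtx c by move=> /vtx_inj.
  have := ctr_sep kappa_ge1 a_ge (erefl : tag (vtx b) = tag (vtx c)) ne.
  have -> : ctr (vtx b) = ctr (vtx c) by apply: contrapT => h; apply: X1; eexists; eexists; exact: h.
  rewrite mdistxx leNgt mulr_gt0//; last exact: rad_gt0 kappa_ge1 a_ge _.
  by rewrite invr_gt0 (lt_le_trans ltr01).
exists 1 => v n Q tv _; have [b bv] := vtx_lev tv.
rewrite big_mkcond (bigD1 b) //= big1 ?addr0; first by case: (Q b).
by move=> c; rewrite (uniq n c b) eqxx.
Qed.

End Doubling.

(** * Both directions, with one family of gauges *)

Theorem theorem1p1 (R : realType) (X : pointedMetricType R)
    (X_compact : compact [set: X]) (J_AR_neq0 : @J_AR R X !=set0)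
    (KP kappa lambda a : R) (KP_perfect : uniformly_perfect KP X)
    (kappa_ge1 : 1 <= kappa) (lambda_ge32 : 32 <= lambda)
    (a_large : 6 * kappa ^+ 2 * Num.max lambda KP <= a)
    (S : covering_data X kappa a) :
  exists eta : R -> R -> R -> R -> R -> R,
    (forall (rho : vertex S -> R) (eta_m eta_p K0 alpha K1 p K2 : R),
       admissible lambda rho eta_m eta_p K0 alpha K1 p K2 ->
       exists theta_rho : distance R X,
         is_theta_rho rho alpha p (eta eta_m eta_p K0 K1) theta_rho) /\
    ((exists x y : X, x <> y) ->
     forall theta : distance R X, J_AR theta ->
       exists (rho : vertex S -> R) (eta_m eta_p K0 alpha K1 p K2 : R)
              (theta_rho : distance R X),
         [/\ admissible lambda rho eta_m eta_p K0 alpha K1 p K2,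
             is_theta_rho rho alpha p (eta eta_m eta_p K0 K1) theta_rho &
             bilipschitz theta theta_rho]).
Proof.
have k2 : 0 <= 6 * kappa ^+ 2 by rewrite mulr_ge0// sqr_ge0.
have a_lambda : 6 * kappa ^+ 2 * lambda <= a.
  by apply: le_trans a_large; rewrite ler_wpM2l// le_max lexx.
have a_KP : 6 * kappa ^+ 2 * KP <= a.
  by apply: le_trans a_large; rewrite ler_wpM2l// le_max lexx orbT.
have a_ge := a_ge_of_large kappa_ge1 lambda_ge32 a_lambda.
have kappa_gt0 : 0 < kappa by apply: lt_le_trans kappa_ge1.
have L0 : 0 <= 2 * lambda * kappa by rewrite !mulr_ge0// ?(ltW kappa_gt0)//; lra.
have [N neighbors] := gauge_neighbors S kappa_ge1 a_ge X_compact KP_perfect L0 J_AR_neq0.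
(* Chosen before rho, from the four constants and the fixed covering data only. *)
pose eta (eta_m eta_p K0 K1 : R) := qs_gauge a lambda eta_m eta_p K0 K1.
exists eta.
have forward (rho : vertex S -> R) (eta_m eta_p K0 alpha K1 p K2 : R) :
    admissible lambda rho eta_m eta_p K0 alpha K1 p K2 ->
    exists theta_rho : distance R X,
      is_theta_rho rho alpha p (eta eta_m eta_p K0 K1) theta_rho.
  move=> [_ h1 h2 h3 h4]; have [alpha2 alpha_le K1_ge1 _] := h3.
  have [theta thetaP] := path_distance kappa_ge1 lambda_ge32 a_lambda h1 h2
    alpha2 alpha_le h3.
  exists theta; split.
  - exact: (theta_quasisymmetric kappa_ge1 lambda_ge32 a_lambda h1 h2
      alpha2 alpha_le h3 thetaP).
  - exact: (theta_ahlfors kappa_ge1 lambda_ge32 a_lambda h1 h2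
      alpha2 alpha_le h3 thetaP h4 X_compact neighbors).
  have [K0_ge1 _] := h2; have [_ _ eta_p1 _] := h1.
  set C := 1 + _ in thetaP.
  have C_ge1 : 1 <= C.
    rewrite lerDl divr_ge0 ?mulr_ge0// ?subr_ge0 ?(ltW eta_p1)//.
    by rewrite (le_trans ler01).
  have KC : K1 <= K1 * C by rewrite ler_peMr// (le_trans ler01).
  have CK : C <= K1 * C by rewrite ler_peMl// (le_trans ler01).
  exists (K1 * C); first exact: mulr_ege1.
  move=> x y xy; have /andP[l u] := thetaP x y xy.
  have K1_gt0 : 0 < K1 by rewrite (lt_le_trans ltr01).
  have C_gt0 : 0 < C by rewrite (lt_le_trans ltr01).
  have w0 : 0 <= weight_c rho alpha x y.
    have [B cB] := c_set_neq0 S kappa_ge1 lambda_ge32 a_lambda alpha2 xy.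
    have /andP[h _] := c_set_weight kappa_ge1 lambda_ge32 a_lambda h2 alpha_le cB.
    exact: le_trans (ltW (weight_gt0 h1 B)) h.
  apply/andP; split.
    by apply: le_trans l; rewrite ler_wpM2r// lef_pV2 ?posrE ?mulr_gt0.
  by apply: (le_trans u); rewrite ler_wpM2r.
split=> // -[x0 [x1 x01]] theta [[eta' qs] [q ar]].
have [P P1 perf] := perfect_unit KP_perfect x01.
have [_ homeo _] := qs; have [q0 _] := ar.
have [C [C0 pack cov]] := ahlfors_bounds (homeo_compact X_compact homeo) ar
  (ex_intro _ x0 (ex_intro _ x1 x01)).
have tqs := quasisymmetric_weak qs.
pose t (v : vertex S) := vsize kappa_ge1 a_ge theta perf v.
have t0 v : 0 < t v by exact: vsize_gt0.
(* By [anc_dist] the descendants of a cell have their centers within this multiple of its radius. *)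
have L1 : 0 <= 6 / 5 * kappa by rewrite mulr_ge0// ltW.
have [Ku Ku1 sumu] := vsize_packing S kappa_ge1 a_ge tqs P1 perf C0 pack L1.
have [Kl Kl1 suml] := vsize_covering S kappa_ge1 a_ge tqs P1 perf C0 cov.
have K1 : 1 <= Ku + Kl by lra.
have t_sum B n : (tag B < n)%N -> (Ku + Kl)^-1 * t B `^ q <=
    dsum (fun v => t v `^ q) n B <= (Ku + Kl) * t B `^ q.
  move=> Bn; have tB := powR_gt0 q (t0 B); apply/andP; split.
    rewrite ler_pdivrMl; last by lra.
    apply: (le_trans (suml B n Bn)); rewrite ler_wpM2r//; last by lra.
    by apply: dsum_ge0 => v; exact: powR_ge0.
  apply: (@le_trans _ _ (Ku * t B `^ q)); last by rewrite ler_pM2r//; lra.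
  apply: sumu; first exact: ltnW.
  move=> u /eqP uB; rewrite metric_sym -uB metric_sym metric_sym.
  by rewrite anc_dist// leq_subr.
have [g [M [eta0 [eta1 [M1 e0 e1 g_t [g_parent g_sum]]]]]] :=
  contracting_weight kappa_ge1 lambda_ge32 a_lambda a_KP KP_perfect x01 q0 t0
    (fun L => vsize_comp S kappa_ge1 a_ge tqs P1 perf (L := L)) K1 t_sum.
have [eta_m [eta_p [K0 [K1' [adm [C' C'1 thetaP]]]]]] :=
  converse_weight kappa_ge1 lambda_ge32 a_lambda q0 t0
    (fun L => vsize_up S kappa_ge1 a_ge tqs P1 perf (L := L))
    (fun L => vsize_low S kappa_ge1 a_ge tqs perf (L := L))
    (fun L => vsize_comp S kappa_ge1 a_ge tqs P1 perf (L := L))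
    M1 e0 e1 g_t g_parent g_sum.
(* The distance is rebuilt from rho to carry the prescribed gauge; it is bi-Lipschitz to [theta]
   because both are comparable to [weight_c]. *)
have [theta_rho theta_rhoP] := forward _ _ _ _ _ _ _ _ adm.
eexists; exists eta_m, eta_p, K0, 2, K1', q, M, theta_rho; split.
- exact: adm.
- exact: theta_rhoP.
have [_ _ [D D1 rhoP]] := theta_rhoP.
have C'0 : 0 < C' by lra.
have D0 : 0 < D by lra.
exists (C' * D); first exact: mulr_ege1.
move=> x y; have [->|/eqP xy] := eqVneq x y; first by rewrite !dist_xx !mulr0 lexx.
have /andP[l1 u1] := thetaP x y xy; have /andP[l2 u2] := rhoP x y xy.
apply/andP; split.
  rewrite ler_pdivrMl ?mulr_gt0//; apply: (le_trans u1).
  by rewrite -mulrA ler_pM2l// -ler_pdivrMl.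
apply: (le_trans u2); rewrite [C' * D]mulrC -mulrA ler_pM2l//.
by rewrite -ler_pdivrMl.
Qed.
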